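(* Let $G=\mathrm{SL}_n(\mathbb{C})$, so $W=\mathfrak{S}_n$. Then Bruhat intervals $[v,w]$ and $[v',w']$ of $\mathfrak{S}_n$ are opposed if and only if for every $k\in\{1,\dots,n-1\}$ there exist $x\in[v,w]$ and $x'\in[v',w']$ with $x(\{1,\dots,k\})=x'(\{1,\dots,k\})$.
   Context: Standard pinning of $\mathrm{SL}_n(\mathbb{C})$: $B_+$ upper triangular, $B_-$ lower triangular, $T_0$ diagonal matrices; $I=\{1,\dots,n-1\}$ and $\phi_i$ embeds $\mathrm{SL}_2(\mathbb{C})$ in rows and columns $i,i+1$, with $y_i(t)=\phi_i\left(\begin{smallmatrix}1&0\\t&1\end{smallmatrix}\right)$. $W=\mathfrak{S}_n$ with Bruhat order, $s_i=(i\ i{+}1)$, $w_0(i)=n+1-i$; for $w\in\mathfrak S_n$, $\dot w\in\mathrm{SL}_n(\mathbb{C})$ is the signed permutation matrix with $\dot w_{i,j}=\pm\delta_{i,w(j)}$, signs chosen so all left-justified minors are nonnegative. $g\cdot B_+=gB_+g^{-1}$; Borel subgroups form the flag variety $\mathcal{B}$. $U_-^{>0}=\{y_{i_1}(t_1)\cdots y_{i_l}(t_l)\mid t_j>0\}$ for a reduced expression of $w_0$, $U_-^{<0}=(U_-^{>0})^{-1}$, $\mathcal{B}_{\ge0}$ and $\mathcal{B}_{\le0}$ the Euclidean closures of $\{u\cdot B_+\mid u\in U_-^{>0}\}$ and $\{u\cdot B_+\mid u\in U_-^{<0}\}$. Two Borel subgroups are opposed if their intersection is a maximal torus. For $v\le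 w$, $\mathcal{R}_{v,w}=\{b\dot v\cdot B_+\mid b\in B_-\}\cap\{b\dot w\cdot B_+\mid b\in B_+\}$, $\mathcal{R}^{>0}_{v,w}=\mathcal{R}_{v,w}\cap\mathcal{B}_{\ge0}$, $\mathcal{R}^{<0}_{v,w}=\mathcal{R}_{v,w}\cap\mathcal{B}_{\le0}$. Bruhat intervals $[v,w]$, $[v',w']$ are opposed if an element of $\mathcal{R}^{>0}_{v,w}$ is opposed to an element of $\mathcal{R}^{<0}_{w'w_0,v'w_0}$ (independent of the choice of elements). *)

(* Defs.v *)
From HB Require Import structures.
From mathcomp Require Import all_boot all_order all_algebra all_fingroup.
From mathcomp Require Import complex.
From mathcomp Require Import all_classical all_reals all_analysis.
Set Implicit Arguments.
Unset Strict Implicit.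
Unset Printing Implicit Defensive.
Import Order.TTheory GRing.Theory Num.Theory.
Import numFieldNormedType.Exports.

(* The type ascription gives the complex numbers the topology that the library
   puts on every numClosedFieldType (the one of the complex modulus). *)
Definition Cx (R : realType) : numClosedFieldType := complex R.

Section SymmetricGroup.
Variable n : nat.
Implicit Types (u v w x : 'S_n) (i : 'I_n.-1).

(* Composition of functions, pmul u v = u o v: the product of {perm T} in the
   library composes the other way round, (u * v)%g x = v (u x). *)
Definition pmul u v : 'S_n := (v * u)%g.

Lemma pmulE u v a : pmul u v a = u (v a).
Proof. by rewrite /pmul permM. Qed.

Lemma ord_loP i : i < n.
Proof. exact: leq_trans (ltn_ord i) (leq_pred n). Qed.

Lemma ord_hiP i : i.+1 < n.
Proof. by rewrite -ltn_predRL. Qed.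

Definition ord_lo i : 'I_n := Ordinal (ord_loP i).
Definition ord_hi i : 'I_n := Ordinal (ord_hiP i).

Definition sref i : 'S_n := tperm (ord_lo i) (ord_hi i).

Definition longest : 'S_n := perm (@rev_ord_inj n).

Definition word_perm (s : seq 'I_n.-1) : 'S_n :=
  foldr (fun i w => pmul (sref i) w) 1%g s.

Definition reduced_word (s : seq 'I_n.-1) w : Prop :=
  word_perm s = w /\ forall s', word_perm s' = w -> size s <= size s'.

(* The Coxeter length of a permutation is its number of inversions. *)
Definition perm_length w : nat :=
  #|[set p : 'I_n * 'I_n | (p.1 < p.2) && (w p.2 < w p.1)]|.

(* Reflexive transitive closure of v -> v t, for t a transposition with
   length v < length (v t). *)
Inductive bruhat_le u : 'S_n -> Prop :=
| bruhat_refl : bruhat_le u u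
| bruhat_step v (a b : 'I_n) :
    bruhat_le u v -> perm_length v < perm_length (pmul v (tperm a b)) ->
    bruhat_le u (pmul v (tperm a b)).

Definition bruhat_interval v w x : Prop := bruhat_le v x /\ bruhat_le x w.

(* 0-based: {1, ..., k} is the set of the first k elements of 'I_n. *)
Definition initial_seg k : {set 'I_n} := [set a : 'I_n | a < k].

End SymmetricGroup.

Local Open Scope classical_set_scope.
Local Open Scope ring_scope.

(* The algebra of functions generated by the family gen. *)
Inductive generated_fun (K : comNzRingType) (X I : Type) (gen : I -> X -> K) :
    (X -> K) -> Prop :=
| gen_const c : generated_fun gen (fun=> c)
| gen_gen i : generated_fun gen (gen i)
| gen_add p q : generated_fun gen p -> generated_fun gen q ->
    generated_fun gen (fun x => p x + q x)
| gen_mul p q : generated_fun gen p -> generated_fun gen q ->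
    generated_fun gen (fun x => p x * q x).

Section SpecialLinear.
Variables (R : realType) (n : nat).
Local Notation C := (Cx R).
Local Notation M := 'M[Cx R]_n.
Implicit Types (g b x y : M) (B T : set M) (F Z : set (set M)).

Definition SL : set M := [set g | \det g = 1].
Definition Bplus : set M :=
  [set b | SL b /\ forall i j : 'I_n, (j < i)%N -> b i j = 0].
Definition Bminus : set M :=
  [set b | SL b /\ forall i j : 'I_n, (i < j)%N -> b i j = 0].

Definition conjg_set g B : set M := [set g *m b *m invmx g | b in B].

Definition subgroup_SL T : Prop :=
  [/\ T `<=` SL, T 1%:M, (forall x y, T x -> T y -> T (x *m y))
    & (forall x, T x -> T (invmx x))].

(* Polynomials in the n^2 matrix entries. *)
Definition poly_fun_mx (p : M -> C) : Prop :=
  generated_fun (fun (ij : 'I_n * 'I_n) x => x ij.1 ij.2) p.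

Definition zariski_closed T : Prop :=
  exists2 E : set (M -> C), (forall p, E p -> poly_fun_mx p) &
    T = [set x | forall p, E p -> p x = 0].

Definition Gm m : set ('I_m -> C) := [set t | forall k, t k != 0].

(* Laurent polynomials in the coordinates of the group Gm m. *)
Definition laurent_fun m (p : ('I_m -> C) -> C) : Prop :=
  generated_fun (fun (ke : 'I_m * bool) (t : 'I_m -> C) =>
    if ke.2 then t ke.1 else (t ke.1)^-1) p.

(* A torus is a closed subgroup isomorphic, as an algebraic group, to some
   Gm m; f and h are the mutually inverse isomorphisms, and only their
   values on Gm m and on T matter. *)
Definition is_torus T : Prop :=
  [/\ subgroup_SL T, zariski_closed T &
    exists (m : nat) (f : ('I_m -> C) -> M) (h : M -> 'I_m -> C),
      [/\ (forall i j, laurent_fun (fun t => f t i j)) /\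
          (forall k, poly_fun_mx (fun x => h x k)),
          (forall t, Gm t -> T (f t)) /\ (forall x, T x -> Gm (h x)),
          (forall t, Gm t -> h (f t) = t) /\ (forall x, T x -> f (h x) = x)
        & forall s t, Gm s -> Gm t -> f (fun k => s k * t k) = f s *m f t]].

Definition maximal_torus T : Prop :=
  is_torus T /\ forall T', is_torus T' -> T `<=` T' -> T' = T.

(* The Borel subgroups of SL_n are the conjugates of Bplus. *)
Definition flag_variety : set (set M) := [set conjg_set g Bplus | g in SL].

Definition opposed_borel B B' : Prop :=
  [/\ flag_variety B, flag_variety B' & maximal_torus (B `&` B')].

(* Euclidean topology of the flag variety, i.e. the quotient topology for
   g |-> g . B_+; since SL is closed, closedness may be tested in M. *)
Definition flag_closed Z : Prop :=
  closed [set g : M | SL g /\ Z (conjg_set g Bplus)].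

Definition flag_closure F : set (set M) :=
  [set B | flag_variety B /\ forall Z, flag_closed Z -> F `<=` Z -> Z B].

Definition ymx (i : 'I_n.-1) (t : C) : M :=
  1%:M + t *: delta_mx (ord_hi i) (ord_lo i).

(* The union over all reduced words of w_0; each word gives the same set. *)
Definition Uminus_pos : set M :=
  [set u | exists s : seq ('I_n.-1 * R),
    [/\ reduced_word [seq p.1 | p <- s] (longest n),
        (forall p, p \in s -> 0 < p.2)
      & u = \big[mulmx/1%:M]_(p <- s) ymx p.1 (real_complex R p.2)]].

Definition Uminus_neg : set M := [set invmx u | u in Uminus_pos].

Definition flag_ge0 : set (set M) :=
  flag_closure [set conjg_set u Bplus | u in Uminus_pos].
Definition flag_le0 : set (set M) :=
  flag_closure [set conjg_set u Bplus | u in Uminus_neg].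

(* g is the signed permutation matrix of w all of whose minors on the first k
   columns (and any increasing choice r of k rows) are nonnegative; these
   conditions determine g. *)
Definition perm_lift (w : 'S_n) g : Prop :=
  (forall i j, g i j = (i == w j)%:R \/ g i j = - (i == w j)%:R) /\
  (forall (k : nat) (kn : (k <= n)%N) (r : 'I_k -> 'I_n),
     {homo r : a b / (a < b)%N >-> (a < b)%N} ->
     0 <= \det (mxsub r (widen_ord kn) g)).

Definition richardson (v w : 'S_n) : set (set M) :=
  [set B | exists b d, [/\ Bminus b, perm_lift v d &
                           B = conjg_set (b *m d) Bplus]] `&`
  [set B | exists b d, [/\ Bplus b, perm_lift w d &
                           B = conjg_set (b *m d) Bplus]].

Definition richardson_pos (v w : 'S_n) : set (set M) :=
  richardson v w `&` flag_ge0.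
Definition richardson_neg (v w : 'S_n) : set (set M) :=
  richardson v w `&` flag_le0.

Definition opposed_intervals (v w v' w' : 'S_n) : Prop :=
  exists B B', [/\ richardson_pos v w B,
    richardson_neg (pmul w' (longest n)) (pmul v' (longest n)) B' &
    opposed_borel B B'].

End SpecialLinear.

(* Main.v *)
Require Import Defs.
From HB Require Import structures.
From mathcomp Require Import all_classical all_reals all_analysis.
From mathcomp Require Import all_boot all_order all_algebra all_fingroup.
From mathcomp Require Import complex.
From mathcomp Require Import zify ring lra.
Set Implicit Arguments.
Unset Strict Implicit.
Unset Printing Implicit Defensive.
Import Order.TTheory GRing.Theory Num.Theory.

(** Write a flag as [g B_+] and let [pl g k J] be the minor of [g] on the rows
    [J] and the first [k] columns.  Laplace expansion along the last column
    makes [pl g k] a wedge product, and contracting it yields every incidence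
    relation between the Pluecker coordinates of a flag.

    The cells [B_+ w B_+] and [B_- v B_+] are read off from the Gale-extremal
    nonzero Pluecker coordinates, and the Bruhat order is the Gale order on
    initial segments, so a nonzero coordinate of a flag in [R_{v,w}] is always
    indexed by some [x {1..k}] with [x] in [[v, w]].

    Conversely a flag in [R_{v,w}] with nonnegative coordinates has a positive
    coordinate at every [x {1..k}].  This is an induction on [w]: three-term
    relations show that a well-chosen left factor [y_i(t)] (or a simple
    reflection) can be stripped off without losing nonnegativity.  The same
    elimination factors the flags in [R_{1,w_0}] through [U_-^{>0}], and
    perturbing by Chevalley generators puts every nonnegative flag in the
    closure of these.

    Finally [g B_+] and [g' B_+] are opposed iff the pairings
    [sum_J pl g k J * pl g'' k J] do not vanish, where [g'' = g'^-T w_0] spans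
    the dual flag; duality sends [R_{w'w_0,v'w_0}] to [R_{v',w'}] and exchanges
    the two signs, so for nonnegative flags nothing cancels in that sum. *)

(** [tnn] is a system of inequalities over a real field; complex numbers and closures enter only
    when explicit real matrices are exhibited as limits of elements of U_-^{>0} or U_-^{<0}.

    The obstacle is to divide by y_i(t) on the left without leaving [tnn]. Let p0 be the first
    position moved by w, and m = w p0. Up to level p0 the flag is the standard coordinate flag, so
    at level p0+1 only minors on {1..p0-1} plus one row survive, and they vanish beyond row m.
    Taking rows m-1 and m for y_i, and for t the ratio of the minors at m and m-1, cancels the last
    of them; this is the largest admissible t, and incidence with this level carries nonnegativity
    to all higher levels. A zero denominator means t = infinity, where the simple reflection
    replaces y_i(t).

    The two signs are tied by the matrix D of alternating signs: D y_i(t) D = y_i(-t), while inverse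
    transposition sends y_i(t) to x_i(-t). So g -> D g^-T w_0 turns a left factor y_i(t) into
    x_i(t), again positive, and one induction makes a flag and its twisted dual nonnegative
    together. *)

Section Gale.

(** * Gale order on subsets, relative to a height function *)

Variable n : nat.
Implicit Types (J K : {set 'I_n}) (h : 'I_n -> nat) (p q j : 'I_n).

(** For sets of equal size, comparing all threshold counts amounts to comparing the sorted heights
    entry by entry. The height is a parameter so that the same lemmas serve [hval] (upper triangular
    side) and [hrev] (lower triangular side). *)
Definition cnt h t J : nat := #|[set j in J | t <= h j]|.
Definition gle h J K : Prop := forall t, cnt h t J <= cnt h t K.

Lemma cntU1 h t J j : j \notin J -> cnt h t (j |: J) = (t <= h j) + cnt h t J.
Proof.
move=> jJ; rewrite /cnt; case: (boolP (t <= h j)) => htj.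
  have -> : [set x in j |: J | t <= h x] = j |: [set x in J | t <= h x].
    by apply/setP=> x; rewrite !inE; case: eqP => // ->; rewrite htj.
  by rewrite cardsU1 inE (negPf jJ).
congr #|pred_of_set _|; apply/setP=> x; rewrite !inE; case: eqP => // ->.
by rewrite (negPf htj) !andbF.
Qed.

Lemma cntD1 h t J j : j \in J -> cnt h t J = (t <= h j) + cnt h t (J :\ j).
Proof. by move=> jJ; rewrite -{1}(setD1K jJ) cntU1 // !inE eqxx. Qed.

Lemma cntS h t J j : injective h -> h j = t ->
  cnt h t J = (j \in J) + cnt h t.+1 J.
Proof.
move=> hI hj; rewrite /cnt.
have -> : [set x in J | t <= h x] =
          [set x in J | x == j] :|: [set x in J | t < h x].
  apply/setP=> x; rewrite !inE -andb_orr leq_eqVlt; congr (_ && (_ || _)).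
  by rewrite -hj eq_sym (inj_eq hI).
rewrite cardsU; set X := (_ :&: _); have -> : X = set0.
  apply/setP=> x; rewrite !inE; case: (x =P j) => [->|]; last by rewrite andbF.
  by rewrite hj ltnn !andbF.
rewrite cards0 subn0; congr (_ + _); case jJ: (j \in J).
  rewrite (_ : [set _ in _ | _] = [set j]) ?cards1 //.
  by apply/setP=> x; rewrite !inE; case: eqP => [->|]; rewrite ?jJ ?andbF.
apply/eqP; rewrite cards_eq0; apply/eqP/setP=> x; rewrite !inE.
by case: eqP => [->|]; rewrite ?jJ ?andbF.
Qed.

Lemma gle_refl h J : gle h J J. Proof. by []. Qed.

Lemma gle_trans h J K L : gle h J K -> gle h K L -> gle h J L.
Proof. by move=> a b t; apply: leq_trans (a t) (b t). Qed.

Lemma gle_anti h J K : injective h -> gle h J K -> gle h K J -> J = K.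
Proof.
move=> hI a b; apply/setP=> x; have /= := cntS J hI (erefl (h x)).
have /= := cntS K hI (erefl (h x)); move: (a (h x)) (b (h x)) (a (h x).+1) (b (h x).+1).
by case: (x \in J); case: (x \in K); lia.
Qed.

Lemma gle_add h J K i j : i \in J -> j \notin K -> h i <= h j ->
  gle h (J :\ i) K -> gle h J (j |: K).
Proof.
move=> iJ jK ij JK t; rewrite (cntD1 _ _ iJ) cntU1 //; apply: leq_add (JK t).
by case: (leqP t (h i)) => // ti; rewrite (leq_trans ti ij).
Qed.

Lemma mem_swap p q J j :
  (j \in tperm p q @: J) = (tperm p q j \in J).
Proof. by rewrite -{1}(tpermK p q j) mem_imset //; apply: perm_inj. Qed.

Lemma swapK p q J : tperm p q @: (tperm p q @: J) = J.
Proof. by apply/setP=> x; rewrite !mem_swap tpermK. Qed.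

Lemma swap_id p q J : (p \in J) = (q \in J) -> tperm p q @: J = J.
Proof. by move=> e; apply/setP=> x; rewrite mem_swap; case: tpermP => // ->. Qed.

Lemma swap_exch p q J : p \in J -> q \notin J -> tperm p q @: J = q |: (J :\ p).
Proof.
move=> pJ qJ; apply/setP=> x; rewrite mem_swap !inE.
case: tpermP => [->|->|/eqP xp /eqP xq].
- by rewrite (negPf qJ) eqxx orbF; apply/esym/negbTE; apply: contraNneq qJ => <-.
- by rewrite pJ eqxx.
- by rewrite xp (negPf xq).
Qed.

Lemma card_swap p q J : #|tperm p q @: J| = #|J|.
Proof. by rewrite card_imset //; apply: perm_inj. Qed.

Lemma cnt_swap h p q J t : injective h -> h p = (h q).+1 -> t != h p ->
  cnt h t (tperm p q @: J) = cnt h t J.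
Proof.
move=> hI hpq tp; case: (boolP (p \in J)) (boolP (q \in J)) => [pJ|pJ] [qJ|qJ].
- by rewrite swap_id // pJ qJ.
- rewrite swap_exch // cntU1 ?(cntD1 h t pJ); last first.
    by rewrite !inE negb_and qJ orbT.
  congr (_ + _); lia.
- rewrite tpermC swap_exch // cntU1 ?(cntD1 h t qJ); last first.
    by rewrite !inE negb_and pJ orbT.
  congr (_ + _); lia.
- by rewrite swap_id // (negPf pJ) (negPf qJ).
Qed.

(** Lifting property on sets. The swap alters only the count at threshold [h p]; there the bounds at
    the two neighbouring thresholds suffice, because K contains p whenever it contains q. *)
Lemma gle_swapl h p q J K : injective h -> h p = (h q).+1 ->
  (q \in K -> p \in K) -> gle h J K -> gle h (tperm p q @: J) K.
Proof.
move=> hI hpq qpK JK t; case: (eqVneq t (h p)) => [->|tp]; last first.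
  by rewrite (cnt_swap _ hI hpq).
have := cnt_swap J hI hpq (_ : h q != h p); have := cnt_swap J hI hpq (_ : (h p).+1 != h p).
have := cntS (tperm p q @: J) hI (erefl (h q)); have := cntS (tperm p q @: J) hI (erefl (h p)).
have := cntS K hI (erefl (h q)); have := cntS K hI (erefl (h p)).
rewrite -hpq !mem_swap tpermL tpermR.
move=> e1 e2 e3 e4 e5 e6; have {}e5 := e5 ltac:(lia); have {}e6 := e6 ltac:(lia).
move: (JK (h q)) (JK (h p).+1) e1 e2 e3 e4; rewrite e5 e6 {e5 e6}.
move: (cnt _ _ _) (cnt _ _ _) (cnt _ _ _) (cnt _ _ _) (cnt _ _ _) (cnt _ _ _) => c1 c2 c3 c4 c5 c6.
by case: (q \in K) qpK => [/(_ isT) ->|_]; case: (p \in J); case: (q \in J);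
  case: (p \in K) => /=; lia.
Qed.

Lemma gle_swapr h p q J K : injective h -> h p = (h q).+1 ->
  (p \in J -> q \in J) -> gle h J K -> gle h J (tperm p q @: K).
Proof.
move=> hI hpq qpK JK t; case: (eqVneq t (h p)) => [->|tp]; last first.
  by rewrite (cnt_swap _ hI hpq).
have := cnt_swap K hI hpq (_ : h q != h p); have := cnt_swap K hI hpq (_ : (h p).+1 != h p).
have := cntS (tperm p q @: K) hI (erefl (h q)); have := cntS (tperm p q @: K) hI (erefl (h p)).
have := cntS J hI (erefl (h q)); have := cntS J hI (erefl (h p)).
rewrite -hpq !mem_swap tpermL tpermR.
move=> e1 e2 e3 e4 e5 e6; have {}e5 := e5 ltac:(lia); have {}e6 := e6 ltac:(lia).
move: (JK (h q)) (JK (h p).+1) e1 e2 e3 e4; rewrite e5 e6 {e5 e6}.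
move: (cnt _ _ _) (cnt _ _ _) (cnt _ _ _) (cnt _ _ _) (cnt _ _ _) (cnt _ _ _) => c1 c2 c3 c4 c5 c6.
by case: (p \in J) qpK => [/(_ isT) ->|_]; case: (p \in K); case: (q \in K);
  case: (q \in J) => /=; lia.
Qed.

Definition hval : 'I_n -> nat := fun j => j.
Definition hrev : 'I_n -> nat := fun j => n - j.+1.

Lemma hval_inj : injective hval. Proof. exact: val_inj. Qed.
Lemma hrev_inj : injective hrev.
Proof. by move=> i j /= e; apply: val_inj => /=; move: e (ltn_ord i) (ltn_ord j); rewrite /hrev; lia. Qed.

Lemma cnt_rev t J : cnt hrev t J = #|J| - cnt hval (n - t) J.
Proof.
rewrite /cnt /hval /hrev -(cardsID [set j : 'I_n | n - t <= j] J).
rewrite [X in X + _](_ : _ = #|[set j in J | n - t <= j]|); last first.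
  by congr #|pred_of_set _|; apply/setP=> x; rewrite !inE.
rewrite addKn; congr #|pred_of_set _|; apply/setP=> x; rewrite !inE andbC.
by congr (_ && _); have := ltn_ord x; lia.
Qed.

Lemma gle_rev J K : #|J| = #|K| -> gle hrev J K <-> gle hval K J.
Proof.
move=> e; have le L t : cnt hval t L <= #|L|.
  by apply/subset_leq_card/subsetP=> x; rewrite !inE => /andP[->].
split=> H t.
  have [tn|tn] := leqP t n; last first.
    rewrite /cnt (_ : [set _ in _ | _] = set0) ?cards0 //; apply/setP=> x.
    by rewrite !inE /hval; have := ltn_ord x; lia.
  have := H (n - t); rewrite !cnt_rev subKn //; move: (le J t) (le K t); lia.
by rewrite !cnt_rev; move: (H (n - t)) (le J (n - t)) (le K (n - t)); lia.
Qed.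

End Gale.

(** * Permutations: the tableau criterion for the Bruhat order *)

Section Bruhat.
Variable n : nat.
Implicit Types (J K : {set 'I_n}) (u v w x : 'S_n) (p q j a b : 'I_n) (k : nat).

Definition sset w k : {set 'I_n} := w @: initial_seg n k.
(** The value p stands before q in one-line notation; for p = q+1 this is a left descent of w. As
    the group law composes from left to right, [(w * tperm p q)%g] is the left multiple s w. *)
Definition bef w p q : bool := (w^-1%g p < w^-1%g q)%N.
Definition ble u w : Prop := forall k, gle (@hval n) (sset u k) (sset w k).

Lemma mem_sset w k j : (j \in sset w k) = (w^-1%g j < k).
Proof. by rewrite /sset -{1}(permKV w j) mem_imset ?inE //; apply: perm_inj. Qed.

Lemma card_initial_seg k : k <= n -> #|initial_seg n k| = k.
Proof.
move=> kn; rewrite (_ : initial_seg n k = [set widen_ord kn i | i : 'I_k]).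
  by rewrite card_imset ?card_ord // => i j /(congr1 val) /= /val_inj.
apply/setP=> x; rewrite inE; apply/idP/imsetP => [xk|[y _ ->]]; last exact: (ltn_ord y).
by exists (Ordinal xk) => //; apply: val_inj.
Qed.

Lemma card_sset w k : k <= n -> #|sset w k| = k.
Proof. by move=> kn; rewrite card_imset ?card_initial_seg //; apply: perm_inj. Qed.

Lemma sset_mul w p q k : sset (w * tperm p q)%g k = tperm p q @: sset w k.
Proof.
by apply/setP=> x; rewrite mem_swap !mem_sset invMg permM tpermV.
Qed.

Lemma ssetS w k (kn : k < n) : sset w k.+1 = w (Ordinal kn) |: sset w k.
Proof.
apply/setP=> x; rewrite !inE !mem_sset ltnS leq_eqVlt; congr (_ || _).
by rewrite -(inj_eq (@perm_inj _ w^-1%g)) permK -val_eqE.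
Qed.

Lemma ssetS_ord w (a : 'I_n) : sset w a.+1 = w a |: sset w a.
Proof. by rewrite (ssetS w (ltn_ord a)); congr (w _ |: _); apply: val_inj. Qed.

Lemma sset0 w : sset w 0 = set0.
Proof. by apply/setP=> x; rewrite mem_sset !inE. Qed.

Lemma ssetn w : sset w n = setT.
Proof. by apply/setP=> x; rewrite mem_sset !inE ltn_ord. Qed.

Lemma sset_notin w (k : 'I_n) : w k \notin sset w k.
Proof. by rewrite mem_sset permK ltnn. Qed.

Lemma sset_inj u w : (forall k, k <= n -> sset u k = sset w k) -> u = w.
Proof.
move=> e; apply: invg_inj; apply/permP=> j; apply: val_inj => /=.
have H (v1 v2 : 'S_n) : (forall k, k <= n -> sset v1 k = sset v2 k) -> v1^-1%g j <= v2^-1%g j.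
  by move=> E; rewrite -ltnS -mem_sset E ?mem_sset ?ltnSn.
by apply/eqP; rewrite eqn_leq !H // => k kn; rewrite e.
Qed.

Lemma ble_refl u : ble u u.
Proof. by move=> k t. Qed.

Lemma ble_trans v u w : ble u v -> ble v w -> ble u w.
Proof. by move=> a b k; apply: gle_trans (a k) (b k). Qed.

Lemma bef_mem w p q k : bef w p q -> q \in sset w k -> p \in sset w k.
Proof. by rewrite !mem_sset /bef; lia. Qed.

Lemma bef_total w p q : p != q -> bef w p q = ~~ bef w q p.
Proof.
move=> pq; rewrite /bef; have : w^-1%g p != w^-1%g q by rewrite (inj_eq perm_inj).
by rewrite -val_eqE /=; lia.
Qed.

Lemma bef_swap w p q : bef (w * tperm p q) p q = bef w q p.
Proof. by rewrite /bef invMg !permM tpermV tpermL tpermR. Qed.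

Lemma bef_swap' w p q : bef (w * tperm p q) q p = bef w p q.
Proof. by rewrite /bef invMg !permM tpermV tpermL tpermR. Qed.

Lemma bef_sset w p q : bef w p q ->
  exists2 k, k <= n & (p \in sset w k) && (q \notin sset w k).
Proof.
move=> b; exists (w^-1%g p).+1; first exact: ltn_ord.
by rewrite !mem_sset leqnn -leqNgt.
Qed.

Section Simple.
Variables (p q : 'I_n) (pq : p = q.+1 :> nat).
Let s := tperm p q.

Let hpq : hval p = (hval q).+1. Proof. exact: pq. Qed.

Lemma pq_neq : p != q. Proof. by rewrite -val_eqE /= pq; lia. Qed.

Lemma ble_swapl u w : bef w p q -> ble u w -> ble (u * s)%g w.
Proof.
move=> b uw k; rewrite sset_mul; apply: (gle_swapl (@hval_inj n) hpq _ (uw k)).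
exact: bef_mem.
Qed.

Lemma ble_swapr u w : bef u q p -> ble u w -> ble u (w * s)%g.
Proof.
move=> b uw k; rewrite sset_mul; apply: (gle_swapr (@hval_inj n) hpq _ (uw k)).
exact: bef_mem.
Qed.

Lemma ble_asc u : bef u q p -> ble u (u * s)%g.
Proof. by move=> b; apply: ble_swapr b _ => //; apply: ble_refl. Qed.

Lemma ble_desc u : bef u p q -> ble (u * s)%g u.
Proof. by move=> b; apply: ble_swapl b _ => //; apply: ble_refl. Qed.

Lemma ble_swap2 u w : bef w p q -> bef u p q -> ble u w -> ble (u * s)%g (w * s)%g.
Proof.
move=> bw bu uw; apply: ble_swapr; last exact: ble_swapl.
by rewrite bef_swap'.
Qed.

Lemma mulgtK u : (u * s * s)%g = u.
Proof. by rewrite -mulgA tperm2 mulg1. Qed.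

Lemma mul_simpleE u : (u * tperm p q)%g = pmul u (tperm (u^-1%g p) (u^-1%g q)).
Proof.
apply/permP=> x; rewrite /pmul !permM (@inj_tperm _ _ u) ?permKV //.
exact: perm_inj.
Qed.

(** Exchanging adjacent values changes the relative order at one pair of positions only, namely
    [pr]. *)
Lemma perm_length_leS w : perm_length (w * s)%g <= (perm_length w).+1.
Proof.
pose pr := if bef w q p then (w^-1%g q, w^-1%g p) else (w^-1%g p, w^-1%g q).
apply: leq_trans (_ : #|pr |: [set r : 'I_n * 'I_n | (r.1 < r.2) && (w r.2 < w r.1)]| <= _).
  apply/subset_leq_card/subsetP=> -[a b]; rewrite !inE /= !permM => /andP[ab].
  rewrite ab /=; case: (tpermP p q (w b)) (tpermP p q (w a)) => [eb|eb|/eqP b1 /eqP b2] [ea|ea|/eqP a1 /eqP a2]; rewrite ?eb ?ea.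
  - by move: (perm_inj (etrans eb (esym ea))) ab => ->; rewrite ltnn.
  - by rewrite pq => _; apply/orP; left; rewrite /pr /bef -eb -ea !permK ab.
  - by move=> H; apply/orP; right; rewrite pq; move: a1 a2 H; rewrite -!val_eqE /=; lia.
  - by rewrite pq; lia.
  - by move: (perm_inj (etrans eb (esym ea))) ab => ->; rewrite ltnn.
  - by move=> H; apply/orP; right; move: a1 a2 H; rewrite -!val_eqE /=; lia.
  - by move=> H; apply/orP; right; move: b1 b2 H; rewrite -!val_eqE /=; lia.
  - by move=> H; apply/orP; right; move: b1 b2 H; rewrite -!val_eqE /=; lia.
  - by move=> ->; rewrite orbT.
by rewrite cardsU1 addnC -addn1 leq_add2l; case: (_ \notin _).
Qed.

End Simple.

Lemma perm_length_lt v a b : a < b -> v a < v b ->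
  perm_length v < perm_length (pmul v (tperm a b)).
Proof.
move=> ab vab; pose t := tperm a b.
(* Injects the inversions of v into those of the product: both positions are moved by t unless this
   reverses their order. The new inversion (a, b) is not in the image. *)
pose phi (r : 'I_n * 'I_n) := if t r.1 < t r.2 then (t r.1, t r.2) else r.
have ne (x y : 'I_n) : x <> y -> (x : nat) <> y by move=> H /val_inj.
have sub : phi @: [set r : 'I_n * 'I_n | (r.1 < r.2) && (v r.2 < v r.1)] \subset
   [set r : 'I_n * 'I_n | (r.1 < r.2) && (pmul v t r.2 < pmul v t r.1)] :\ (a, b).
  apply/subsetP=> _ /imsetP[[x y] + ->]; rewrite inE /= => /andP[xy vxy].
  rewrite /phi /=; case: ifPn => txy; rewrite !inE xpair_eqE !pmulE /=.
    rewrite !tpermK txy vxy /= !andbT; apply/negP=> /andP[/eqP e1 /eqP e2].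
    by move: xy; rewrite -(tpermK a b x) -(tpermK a b y) -/t e1 e2 /t tpermL tpermR; lia.
  rewrite xy /=; move: txy; rewrite /t.
  case: (tpermP a b x) (tpermP a b y) => [ex|ex|/ne x1 /ne x2] [ey|ey|/ne y1 /ne y2]; subst; rewrite ?eqxx ?tpermL ?tpermR //=; try lia.
  - move=> _; rewrite (_ : (y == b) = false) ?andbF /=; last by apply/eqP=> e; apply: y2; rewrite e.
    by lia.
  - by move=> _; rewrite (_ : (x == a) = false) /=; [lia|apply/eqP=> e; apply: x1; rewrite e].
rewrite /perm_length -(@card_in_imset _ _ phi).
  apply: leq_ltn_trans (subset_leq_card sub) _.
  rewrite [X in _ < X](cardsD1 (a, b)) inE /= !pmulE ab tpermL tpermR vab /=.
  by rewrite add1n.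
move=> [x y] [x' y']; rewrite !inE /= => /andP[xy vxy] /andP[xy' vxy'].
rewrite /phi /=; case: ifPn => c1; case: ifPn => c2 [e1 e2] //.
- by rewrite (perm_inj e1) (perm_inj e2).
- by subst x' y'; move: c2; rewrite /t !tpermK xy.
- by subst x y; move: c1; rewrite /t !tpermK xy'.
- by rewrite e1 e2.
Qed.

Lemma bruhat_step_lt v a b : a < b -> v a < v b ->
  bruhat_le v (pmul v (tperm a b)).
Proof. by move=> *; apply: bruhat_step; [exact: bruhat_refl|exact: perm_length_lt]. Qed.

Lemma bruhat_trans v u w : bruhat_le u v -> bruhat_le v w -> bruhat_le u w.
Proof. by move=> uv; elim=> // ? ? ? ? ? ?; apply: bruhat_step. Qed.

Lemma perm_length_step v a b : perm_length v < perm_length (pmul v (tperm a b)) ->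
  exists a' b' : 'I_n, [/\ tperm a b = tperm a' b', a' < b' & v a' < v b'].
Proof.
wlog ab : a b / a <= b.
  move=> H; have [|] := leqP a b; first exact: H.
  by move/ltnW=> ba; rewrite tpermC; apply: H.
move: ab; rewrite leq_eqVlt => /orP[/eqP/val_inj->|ab].
  by rewrite tperm1 /pmul mul1g ltnn.
move=> H; exists a, b; split=> //; rewrite ltnNge leq_eqVlt; apply/negP=> /orP[|vba].
  by move/eqP/val_inj/perm_inj=> e; rewrite e ltnn in ab.
have := @perm_length_lt (pmul v (tperm a b)) a b ab.
rewrite !pmulE tpermL tpermR vba => /(_ isT).
rewrite (_ : pmul (pmul _ _) _ = v); first by lia.
by rewrite /pmul mulgA tperm2 mul1g.
Qed.

Lemma ble_step v a b : a < b -> v a < v b -> ble v (pmul v (tperm a b)).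
Proof.
move=> ab vab k t.
have e : sset (pmul v (tperm a b)) k = v @: (tperm a b @: initial_seg n k).
  by rewrite -imset_comp; apply: eq_imset => x; rewrite pmulE.
have [ka|ka] := leqP k a; [|have [kb|kb] := leqP k b].
- by rewrite e swap_id // !inE; lia.
- rewrite e swap_exch ?inE //; last by lia.
  rewrite imsetU1 cntU1; last first.
    by rewrite mem_imset ?inE ?negb_and -?leqNgt ?kb ?orbT //; apply: perm_inj.
  rewrite (@cntD1 _ _ _ (sset v k) (v a)); last by rewrite mem_sset permK.
  have -> : v @: (initial_seg n k :\ a) = sset v k :\ v a.
    apply/setP=> x; rewrite !inE !mem_sset -{1}(permKV v x) mem_imset ?inE; last exact: perm_inj.
    by rewrite -(inj_eq (@perm_inj _ v)) permKV.
  by rewrite leq_add2r /hval; case: (leqP t (v a)) => //= H; lia.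
- by rewrite e swap_id // !inE; lia.
Qed.

Lemma bruhat_ble u w : bruhat_le u w -> ble u w.
Proof.
elim=> [|v a b _ uv /perm_length_step[a' [b' [-> ab vab]]]]; first exact: ble_refl.
exact: ble_trans uv (ble_step ab vab).
Qed.

Lemma first_moved w : w != 1%g ->
  exists2 p0 : 'I_n, (forall a, a < p0 -> w a = a) & p0 < w p0.
Proof.
move=> w1; have [a0 a0P] : exists a, w a != a.
  apply/existsP; apply: contraNT w1; rewrite negb_exists => /forallP H.
  by apply/eqP/permP=> x; rewrite perm1; apply/eqP; rewrite -[_ == _]negbK.
case: (@arg_minnP _ a0 (fun a => w a != a) (@nat_of_ord n) a0P) => p0 p0P minp.
have fix_lt a : a < p0 -> w a = a.
  by move=> ap; apply/eqP; apply: contraLR ap => /minp; rewrite -leqNgt.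
exists p0 => //; rewrite ltnNge leq_eqVlt; apply/negP=> /orP[|/fix_lt/perm_inj e].
  by rewrite val_eqE (negPf p0P).
by rewrite e eqxx in p0P.
Qed.

(** The value w p0 - 1 is at least p0, so it is not taken before p0 and must stand after w p0. This
    is the descent at which nonnegative flags are eliminated. *)
Lemma first_descent w : w != 1%g ->
  exists (p0 : 'I_n) (i : 'I_n.-1),
   [/\ forall a, a < p0 -> w a = a, p0 < w p0, w p0 = ord_hi i
     & bef w (ord_hi i) (ord_lo i)].
Proof.
move=> /first_moved[p0 fix_lt lt]; have iP : (w p0).-1 < n.-1.
  by have := ltn_ord (w p0); lia.
have e : w p0 = ord_hi (Ordinal iP) by apply: val_inj => /=; lia.
exists p0, (Ordinal iP); split=> //.
rewrite /bef -e permK; set j := w^-1%g _.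
have wj : w j = ord_lo (Ordinal iP) by rewrite /j permKV.
have /= wj' := congr1 val wj.
rewrite ltn_neqAle; apply/andP; split.
  by apply/eqP=> /val_inj H; move: wj' lt; rewrite -H; lia.
by rewrite leqNgt; apply/negP=> jp; move: wj'; rewrite (fix_lt _ jp); lia.
Qed.

Section BruhatMax.
Variables (p q : 'I_n) (pq : p = q.+1 :> nat).
Let s := tperm p q.
Let mx u := if bef u q p then (u * s)%g else u.

Lemma bruhat_asc u : bef u q p -> bruhat_le u (u * s)%g.
Proof.
move=> b; rewrite /s mul_simpleE tpermC; apply: bruhat_step_lt => //.
by rewrite !permKV pq.
Qed.

(** A single step y -> y' either is the left multiplication by s, or s keeps the order of the two
    exchanged values and s y -> s y' is a step as well. This is the lifting property for chains. *)
Lemma bruhat_max u v : bruhat_le u v -> bruhat_le (mx u) (mx v).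
Proof.
have tot y : bef y p q = ~~ bef y q p by apply: bef_total; apply: pq_neq.
elim=> [|y a b _ uy /perm_length_step[a' [b' [-> ab yab]]]]; first exact: bruhat_refl.
apply: bruhat_trans uy _; move: a' b' ab yab => {}a {}b ab yab.
set y' := pmul y (tperm a b).
have yy' : bruhat_le y y' by apply: bruhat_step_lt.
case: (boolP ((y a == q) && (y b == p))) => [/andP[/eqP ya /eqP yb]|ne].
  have ey : y' = (y * s)%g.
    by rewrite /s mul_simpleE -ya -yb !permK tpermC.
  rewrite /mx ey bef_swap' tot; case: ifP => [_|/negbT/negP[]]; first exact: bruhat_refl.
  by rewrite /bef -ya -yb !permK.
have yy's : bruhat_le (y * s)%g (y' * s)%g.
  have -> : (y' * s)%g = pmul (y * s)%g (tperm a b) by rewrite /y' /pmul mulgA.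
  apply: bruhat_step_lt => //; rewrite !permM /s.
  have nn (x z : 'I_n) : x <> z -> (x : nat) <> z by move=> H /val_inj.
  move: ne; case: (tpermP p q (y a)) (tpermP p q (y b)) =>
     [ea|ea|/nn a1 /nn a2] [eb|eb|/nn b1 /nn b2]; rewrite ?ea ?eb ?eqxx //; move: yab; rewrite ?ea ?eb ?pq; lia.
have up z : bef z p q -> bruhat_le (z * s)%g z.
  by move=> b'; rewrite -{2}(mulgtK p q z); apply: bruhat_asc; rewrite bef_swap'.
rewrite /mx; case: ifPn => b1; case: ifPn => b2 //.
- by apply: bruhat_trans yy's (up _ _); rewrite tot.
- exact: bruhat_trans yy' (bruhat_asc b2).
Qed.

End BruhatMax.

Lemma perm_length_desc w (p q : 'I_n) : p = q.+1 :> nat -> bef w p q ->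
  perm_length (w * tperm p q)%g < perm_length w.
Proof.
move=> pq b; set w1 := (w * tperm p q)%g.
have -> : w = pmul w1 (tperm (w1^-1%g q) (w1^-1%g p)).
  by rewrite tpermC -mul_simpleE /w1 mulgtK.
apply: perm_length_lt; last by rewrite !permKV pq.
by move: b; rewrite -bef_swap' /bef.
Qed.

Lemma ble1 u : ble u 1%g -> u = 1%g.
Proof.
move=> u1; apply/eqP; apply/negPn/negP=> /first_moved[p0 fx lt].
have := u1 p0.+1 (u p0); rewrite leqNgt => /negP; apply.
rewrite [X in X < _](_ : _ = 0).
  by rewrite (@cntD1 _ _ _ _ (u p0)) /hval ?leqnn // mem_sset permK.
apply/eqP; rewrite cards_eq0; apply/eqP/setP=> x; rewrite !inE mem_sset invg1 perm1 /hval.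
by lia.
Qed.

(** Induction on the length of w through a left descent s. If s u > u, lifting on sets gives u <= s
    w; otherwise s u <= s w, and [bruhat_max] multiplies the resulting chain by s. *)
Lemma bruhat_leP u w : bruhat_le u w <-> ble u w.
Proof.
split; first exact: bruhat_ble.
move: {2}(perm_length w).+1 (ltnSn (perm_length w)) => N.
elim: N u w => // N IH u w wN uw.
have [w1|/first_descent[p0 [i [_ _ _ b]]]] := eqVneq w 1%g.
  by move: uw; rewrite w1 => /ble1 ->; exact: bruhat_refl.
set p := ord_hi i in b *; set q := ord_lo i in b *.
have pq : p = q.+1 :> nat by [].
have lt := perm_length_desc pq b.
have [bu|] := boolP (bef u q p).
  apply: (@bruhat_trans (w * tperm p q)%g).
    by apply: IH; [lia|exact: ble_swapr].
  by rewrite -{2}(mulgtK p q w); apply: bruhat_asc; rewrite ?bef_swap'.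
rewrite -bef_total ?pq_neq // => bu.
have := @bruhat_max p q pq (u * tperm p q)%g (w * tperm p q)%g.
rewrite !bef_swap' bu b !mulgtK; apply; apply: IH; first by lia.
exact: ble_swap2.
Qed.

(** The set (w w_0){1..k} is the complement of w{1..n-k}, and complements reverse counts. *)
Lemma ble_longest u w : ble u w -> ble (pmul w (longest n)) (pmul u (longest n)).
Proof.
move=> uw k t.
have e x : sset (pmul x (longest n)) k = ~: sset x (n - k).
  apply/setP=> y; rewrite !inE !mem_sset /pmul invMg permM -leqNgt.
  set z := x^-1%g y; have -> : (longest n)^-1%g z = rev_ord z.
    by apply: (@perm_inj _ (longest n)); rewrite permKV permE rev_ordK.
  by rewrite /=; have := ltn_ord z; lia.
have c J : cnt (@hval n) t J + cnt (@hval n) t (~: J) = cnt (@hval n) t setT.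
  rewrite /cnt -(cardsID J [set j in setT | t <= hval j]); congr (_ + _).
    by congr #|pred_of_set _|; apply/setP=> x; rewrite !inE andbC.
  by congr #|pred_of_set _|; apply/setP=> x; rewrite !inE.
by rewrite !e; have := c (sset u (n - k)); have := c (sset w (n - k)); have := uw (n - k) t; lia.
Qed.

Lemma longestK w : pmul (pmul w (longest n)) (longest n) = w.
Proof.
by apply/permP=> x; rewrite !pmulE !permE rev_ordK.
Qed.

Lemma perm_of_seq (s : seq 'I_n) : uniq s -> size s = n ->
  exists w : 'S_n, forall k, sset w k = [set x in take k s].
Proof.
move=> us ss; have [n0|[x0 _]] : n = 0 \/ exists x0 : 'I_n, true.
- by case: n; [left|right; exists ord0].
- exists 1%g => k; apply/setP=> x; by have := ltn_ord x; rewrite {2}n0.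
pose f (a : 'I_n) := nth x0 s a.
have fI : injective f.
  by move=> a b /eqP; rewrite nth_uniq ?ss ?ltn_ord // => /eqP/val_inj.
exists (perm fI) => k; apply/setP=> x; rewrite inE; apply/imsetP/idP.
  case=> a; rewrite inE permE /f => ak ->; rewrite -(nth_take _ ak) mem_nth //.
  by rewrite size_take ss; case: ifP => //; rewrite ltn_ord.
move=> xs; have xn : index x s < n by have := mem_take xs; rewrite -index_mem ss.
exists (Ordinal xn); last by rewrite permE /f /= nth_index //; apply: mem_take xs.
rewrite inE /= ltnNge; apply/negP=> ki; move: us; rewrite -(cat_take_drop k s) cat_uniq.
case/and3P=> _ /hasPn H _; have /H : x \in drop k s; last by rewrite xs.
rewrite -(nth_index x0 (mem_take xs)) -[in X in nth _ _ X](subnKC ki) -nth_drop mem_nth //.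
by rewrite size_drop ss ltn_sub2r // (leq_ltn_trans ki).
Qed.

End Bruhat.

Local Open Scope ring_scope.

(** * Pluecker coordinates as iterated wedges, and their incidence relations *)

Section Forms.
Variables (F : numFieldType) (n : nat).
Implicit Types (J K E : {set 'I_n}) (c d : 'I_n -> F) (f : {set 'I_n} -> F).
Implicit Types (g : 'M[F]_n) (i j p q : 'I_n).

Definition above J j : nat := #|[set a in J | (j < a)%N]|.
Definition sgn J j : F := (-1) ^+ above J j.

(** Exterior product with c as the last factor: [sgn J j] counts the elements that e_j has to
    pass. *)
Definition wedge c f : {set 'I_n} -> F :=
  fun J => \sum_(j in J) sgn J j * (c j * f (J :\ j)).

Lemma above_cnt J j : above J j = cnt (@hval n) j.+1 J.
Proof. by []. Qed.

Lemma aboveD1 J i j : i \in J -> above J j = ((j < i) + above (J :\ i) j)%N.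
Proof. by move=> iJ; rewrite !above_cnt (cntD1 _ _ iJ). Qed.

Lemma aboveU1 J i j : i \notin J -> above (i |: J) j = ((j < i) + above J j)%N.
Proof. by move=> iJ; rewrite !above_cnt (cntU1 _ _ iJ). Qed.

Lemma sgnD1 J i j : i \in J -> sgn J j = (-1) ^+ (j < i)%N * sgn (J :\ i) j.
Proof. by move=> iJ; rewrite /sgn (aboveD1 _ iJ) exprD. Qed.

Lemma sgnU1 J i j : i \notin J -> sgn (i |: J) j = (-1) ^+ (j < i)%N * sgn J j.
Proof. by move=> iJ; rewrite /sgn (aboveU1 _ iJ) exprD. Qed.

Lemma sgnD1id J j : j \in J -> sgn (J :\ j) j = sgn J j.
Proof. by move=> jJ; rewrite (sgnD1 _ jJ) ltnn mul1r. Qed.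

Lemma sgnU1id J j : j \notin J -> sgn (j |: J) j = sgn J j.
Proof. by move=> jJ; rewrite (sgnU1 _ jJ) ltnn mul1r. Qed.

Lemma sgnsq J j : sgn J j * sgn J j = 1.
Proof. by rewrite -expr2 sqrr_sign. Qed.

Lemma sgn_neq0 J j : sgn J j != 0.
Proof. by rewrite signr_eq0. Qed.

Lemma sgn_swap i j : i != j -> (-1) ^+ (i < j)%N = - (-1) ^+ (j < i)%N :> F.
Proof.
by rewrite -val_eqE /= neq_ltn; case: ltngtP => // _ _; rewrite ?expr0 ?expr1 ?opprK.
Qed.

Lemma eq_wedge c d f f' : c =1 d -> f =1 f' -> wedge c f =1 wedge d f'.
Proof. by move=> cd ff J; apply: eq_bigr => j _; rewrite cd ff. Qed.

Lemma wedge0l c f J : c =1 (fun=> 0) -> wedge c f J = 0.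
Proof. by move=> c0; apply: big1 => j _; rewrite c0 mul0r mulr0. Qed.

Lemma wedge0r c f J : f =1 (fun=> 0) -> wedge c f J = 0.
Proof. by move=> f0; apply: big1 => j _; rewrite f0 !mulr0. Qed.

Lemma wedgeDl c d f J : wedge (fun j => c j + d j) f J = wedge c f J + wedge d f J.
Proof. by rewrite -big_split; apply: eq_bigr => j _; rewrite mulrDl mulrDr. Qed.

Lemma wedgeZl (a : F) c f J : wedge (fun j => a * c j) f J = a * wedge c f J.
Proof. by rewrite big_distrr; apply: eq_bigr => j _ /=; ring. Qed.

Lemma wedgeZr (a : F) c f J : wedge c (fun K => a * f K) J = a * wedge c f J.
Proof. by rewrite big_distrr; apply: eq_bigr => j _ /=; ring. Qed.

Lemma wedge_sum I (r : seq I) (P : pred I) (a : I -> F) (C : I -> 'I_n -> F) f J :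
  wedge (fun j => \sum_(i <- r | P i) a i * C i j) f J =
  \sum_(i <- r | P i) a i * wedge (C i) f J.
Proof.
elim: r => [|i r IH]; first by rewrite big_nil; apply: wedge0l => j; rewrite big_nil.
rewrite big_cons -IH; case Pi: (P i); last first.
  by apply: eq_wedge => // j; rewrite big_cons Pi.
by rewrite -wedgeZl -wedgeDl; apply: eq_wedge => // j; rewrite big_cons Pi.
Qed.

Lemma wedgeC c d f J : wedge c (wedge d f) J = - wedge d (wedge c f) J.
Proof.
rewrite /wedge.
under eq_bigr do rewrite mulrA big_distrr /=.
under [in RHS]eq_bigr do rewrite mulrA big_distrr /=.
rewrite (exchange_big_dep (mem J)) /=; last by move=> i j _; rewrite !inE => /andP[].
rewrite -sumrN; apply: eq_bigr => j jJ; rewrite -sumrN.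
apply: eq_big => [i|i /andP[iJ ij]]; first by rewrite !inE jJ andbT eq_sym andbC.
have {}ij : j != i by move: ij; rewrite !inE => /andP[].
have -> : J :\ i :\ j = J :\ j :\ i by apply/setP=> x; rewrite !inE andbCA.
rewrite (sgnD1 i jJ) (sgnD1 j iJ) (sgn_swap ij).
have -> : sgn (J :\ j) i = sgn (J :\ j :\ i) i.
  by rewrite sgnD1id // !inE eq_sym ij.
have -> : sgn (J :\ i) j = sgn (J :\ j :\ i) j.
  have -> : J :\ j :\ i = J :\ i :\ j by apply/setP=> x; rewrite !inE andbCA.
  by rewrite [RHS]sgnD1id // !inE ij.
by case: (i < j)%N; rewrite ?expr0 ?expr1; ring.
Qed.

Lemma wedge_id c f J : wedge c (wedge c f) J = 0.
Proof.
have /eqP := wedgeC c c f J; rewrite -subr_eq0 opprK -mulr2n mulrn_eq0 /=.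
by move/eqP.
Qed.

(** Contraction of f by the basis element of E. For f = [pl g k] it is a vector in the span of the
    first k columns of g, see [vec_span]. *)
Definition vec f E : 'I_n -> F :=
  fun j => if j \in E then 0 else sgn E j * f (j |: E).

(** Contraction is an antiderivation: either E is absorbed by f and c remains, or one element of E
    is absorbed by c. *)
Lemma vec_wedge c f E j :
  vec (wedge c f) E j =
  f E * c j + \sum_(e in E) (- (sgn E e * c e)) * vec f (E :\ e) j.
Proof.
rewrite /vec; case: ifPn => jE.
  rewrite (bigD1 j) //= [X in _ + X]addrC big1 ?add0r => [|e /andP[eE ej]]; last first.
    by rewrite !inE jE (eq_sym j) (negPf ej) mulr0.
  rewrite setD11 setD1K // sgnD1id //.
  have -> : - (sgn E j * c j) * (sgn E j * f E) = - ((sgn E j * sgn E j) * (f E * c j)) by ring.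
  by rewrite sgnsq; ring.
rewrite /wedge big_setU1 //= mulrDr setU1K // mulrA sgnU1id // sgnsq mul1r mulrC.
congr (_ + _); rewrite big_distrr; apply: eq_bigr => e eE /=.
have ej : e != j by apply: contraNneq jE => <-.
rewrite !inE (negPf jE) andbF (sgnU1 _ jE).
have -> : (j |: E) :\ e = j |: E :\ e.
  by apply/setP=> x; rewrite !inE; case: (eqVneq x j) => [->|]; rewrite ?andbT ?(eq_sym j) ?ej.
by rewrite (sgnD1 _ eE) (sgn_swap ej); case: (j < e)%N; rewrite ?expr0 ?expr1; ring.
Qed.

(** Columns are indexed by [nat], with value zero from n on, so that [pl g k] makes sense for every
    k and vanishes for k > n. *)
Definition vcol g (k : nat) : 'I_n -> F :=
  fun j => if insub k is Some a then g j a else 0.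

Lemma vcolE g (a : 'I_n) j : vcol g a j = g j a.
Proof. by rewrite /vcol valK. Qed.

Fixpoint pl g (k : nat) : {set 'I_n} -> F :=
  if k is k'.+1 then wedge (vcol g k') (pl g k') else fun J => (J == set0)%:R.

Lemma plS g k : pl g k.+1 = wedge (vcol g k) (pl g k).
Proof. by []. Qed.

Lemma pl0 g J : pl g 0 J = (J == set0)%:R.
Proof. by []. Qed.

Arguments pl : simpl never.

Lemma pl_sub g k J : pl g k.+1 J != 0 ->
  exists2 j, j \in J & vcol g k j * pl g k (J :\ j) != 0.
Proof.
move=> H; apply/exists_inP; apply: contraNT H; rewrite negb_exists_in => /forall_inP H.
rewrite plS; apply/eqP; apply: big1 => j jJ.
by have := H j jJ; rewrite negbK => /eqP ->; rewrite mulr0.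
Qed.

Lemma pl_card g k J : pl g k J != 0 -> #|J| = k.
Proof.
elim: k J => [|k IH] J.
  by rewrite pl0; case: (eqVneq J set0) => [-> _|_]; rewrite ?cards0 ?eqxx.
move=> /pl_sub[j jJ]; rewrite mulf_eq0 negb_or => /andP[_ /IH].
by move=> <-; rewrite [LHS](cardsD1 j) jJ.
Qed.

Lemma wedge_pl_le u g k l : (k <= l)%N -> wedge u (pl g k) =1 (fun=> 0) ->
  wedge u (pl g l) =1 fun=> 0.
Proof.
move=> kl H; elim: l kl => [|l IH]; first by rewrite leqn0 => /eqP <-.
rewrite leq_eqVlt => /orP[/eqP<- //|/IH {}IH] J.
by rewrite plS wedgeC (wedge0r _ _ IH) oppr0.
Qed.

Lemma wedge_vcol g a k : (a < k)%N -> wedge (vcol g a) (pl g k) =1 fun=> 0.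
Proof. by move=> ak; apply: (wedge_pl_le ak) => J; rewrite plS wedge_id. Qed.

(** The contraction lies in the span of the first k columns, which all occur in [pl g l] already.
    Its coordinates are the relations [incidence]. *)
Lemma wedge_vec g k l E : (k <= l)%N -> wedge (vec (pl g k) E) (pl g l) =1 fun=> 0.
Proof.
move=> kl; apply: (wedge_pl_le kl) => {l kl}.
elim: k E => [|k IH] E J.
  apply: wedge0l => j; rewrite /vec pl0; case: ifP => //= _.
  case: eqP => [e|]; last by rewrite mulr0.
  by have := setU11 j E; rewrite e inE.
rewrite (eq_wedge (vec_wedge _ _ _) (fun=> erefl)) wedgeDl wedgeZl wedge_vcol // mulr0 add0r.
rewrite wedge_sum big1 // => e _.
by rewrite plS wedgeC (wedge0r _ _ (IH (E :\ e))) oppr0 mulr0.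
Qed.

Lemma incidence g k l E (Z : {set 'I_n}) : (k <= l)%N ->
  \sum_(z in Z) sgn Z z * (vec (pl g k) E z * pl g l (Z :\ z)) = 0.
Proof. by move=> kl; apply: (wedge_vec g E kl Z). Qed.

(** Incidence of levels l and l+1 for Z = E with a, b, c added: the elements of E contribute
    nothing, and the order a < b < c isolates the middle term on one side. *)
Lemma three_term g l E (a b c : 'I_n) : (a < b < c)%N ->
  a \notin E -> b \notin E -> c \notin E ->
  pl g l (b |: E) * pl g l.+1 (a |: (c |: E)) =
  pl g l (a |: E) * pl g l.+1 (b |: (c |: E)) +
  pl g l (c |: E) * pl g l.+1 (a |: (b |: E)).
Proof.
case/andP=> ab bc aE bE cE.
have ab' : a != b by rewrite -val_eqE /=; lia.
have bc' : b != c by rewrite -val_eqE /=; lia.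
have ac' : a != c by rewrite -val_eqE /=; lia.
have bcE : b \notin c |: E by rewrite !inE negb_or bc'.
have aZ : a \notin b |: (c |: E) by rewrite !inE !negb_or ab' ac'.
have := @incidence g l l.+1 E (a |: (b |: (c |: E))) (leqnSn l).
rewrite !big_setU1 //= [X in _ + (_ + (_ + X))]big1 ?addr0; last first.
  by move=> e eE; rewrite /vec eE mul0r mulr0.
rewrite /vec (negPf aE) (negPf bE) (negPf cE) setU1K //.
have -> : (a |: (b |: (c |: E))) :\ b = a |: (c |: E).
  by rewrite setUCA setU1K // !inE !negb_or eq_sym ab' bc'.
have -> : (a |: (b |: (c |: E))) :\ c = a |: (b |: E).
  rewrite (_ : a |: _ = c |: (a |: (b |: E))) ?setU1K // ?inE ?negb_or 1?eq_sym ?ac' 1?eq_sym ?bc' //.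
  by apply/setP=> x; rewrite !inE; do !case: eqP.
rewrite !(sgnU1 _ aZ) !(sgnU1 _ bcE) !(sgnU1 _ cE) ?ltnn ab bc (ltn_trans ab bc).
rewrite [(b < a)%N]ltnNge (ltnW ab) [(c < b)%N]ltnNge (ltnW bc) [(c < a)%N]ltnNge (ltnW (ltn_trans ab bc)) /=.
rewrite !expr0 !expr1 => H.
have sa := sgnsq E a; have sb := sgnsq E b; have sc := sgnsq E c.
move: H; move: (sgn E a) (sgn E b) (sgn E c) sa sb sc => x y z sx sy sz.
move: (pl g l (a |: E)) (pl g l (b |: E)) (pl g l (c |: E)) => A B C.
move: (pl _ _ _) (pl _ _ _) (pl _ _ _) => A' B' C' H.
have : (x * x) * (A * C') - (y * y) * (B * B') + (z * z) * (C * A') = 0.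
  by rewrite -H; ring.
by rewrite sx sy sz !mul1r => /eqP; rewrite addrAC subr_eq0 => /eqP ->.
Qed.

Lemma vec_span g k E : exists q : nat -> F,
  vec (pl g k) E =1 fun j => \sum_(0 <= a < k) q a * vcol g a j.
Proof.
elim: k E => [|k IH] E.
  exists (fun=> 0) => j; rewrite big_geq // /vec pl0; case: ifP => //= _.
  case: eqP => [e|]; last by rewrite mulr0.
  by have := setU11 j E; rewrite e inE.
have [Q QP] := choice IH.
exists (fun a => if a == k then pl g k E else \sum_(e in E) - (sgn E e * vcol g k e) * Q (E :\ e) a).
move=> j; rewrite vec_wedge big_nat_recr //= eqxx addrC; congr (_ + _).
rewrite (eq_bigr _ (fun e _ => congr1 _ (QP (E :\ e) j))).
under eq_bigr do rewrite big_distrr /=.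
rewrite exchange_big /= [LHS]big_nat [RHS]big_nat; apply: eq_bigr => a /andP[_ ak].
by rewrite (ltn_eqF ak) big_distrl; apply: eq_bigr => e _ /=; rewrite mulrA.
Qed.

(** The coefficient of the last column is [pl g k E]. If it is nonzero at every level of a chain of
    sets, the contractions form a triangular change of basis. *)
Lemma vec_spanS g k E : exists q : nat -> F, q k = pl g k E /\
  vec (pl g k.+1) E =1 fun j => \sum_(0 <= a < k.+1) q a * vcol g a j.
Proof.
have [Q QP] := choice (vec_span g k).
exists (fun a => if a == k then pl g k E else \sum_(e in E) - (sgn E e * vcol g k e) * Q (E :\ e) a).
rewrite eqxx; split=> // j; rewrite vec_wedge big_nat_recr //= eqxx addrC; congr (_ + _).
rewrite (eq_bigr _ (fun e _ => congr1 _ (QP (E :\ e) j))).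
under eq_bigr do rewrite big_distrr /=.
rewrite exchange_big /= [LHS]big_nat [RHS]big_nat; apply: eq_bigr => a /andP[_ ak].
by rewrite (ltn_eqF ak) big_distrl; apply: eq_bigr => e _ /=; rewrite mulrA.
Qed.

(** Modulo the first k columns, which [pl g k] kills, the contraction is [pl g k E] times the next
    column. *)
Lemma plS_vec g k E J :
  wedge (vec (pl g k.+1) E) (pl g k) J = pl g k E * pl g k.+1 J.
Proof.
rewrite (eq_wedge (vec_wedge _ _ _) (fun=> erefl)) wedgeDl wedgeZl wedge_sum.
by rewrite big1 ?addr0 // => e _; rewrite wedge_vec // mulr0.
Qed.

Lemma pl_eq0_le g k l : (k <= l)%N -> pl g k =1 (fun=> 0) -> pl g l =1 fun=> 0.
Proof.
move=> kl H; elim: l kl => [|l IH]; first by rewrite leqn0 => /eqP <-.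
rewrite leq_eqVlt => /orP[/eqP<- //|/IH {}IH] J.
by rewrite plS (wedge0r _ _ IH).
Qed.

(** Basis augmentation: if all contractions vanished, [plS_vec] would annihilate level k+1 and with
    it every later level up to the determinant. *)
Lemma vec_neq0 g k E : pl g n setT != 0 -> (k < n)%N -> pl g k E != 0 ->
  exists2 j, j \notin E & vec (pl g k.+1) E j != 0.
Proof.
move=> gU kn fE; apply: contrapT => H; move/negP: gU; apply.
rewrite (pl_eq0_le kn) // => J; apply: (mulfI fE); rewrite -plS_vec mulr0.
apply: wedge0l => j; apply/eqP; apply: contrapT => /negP H'; apply: H; exists j => //.
by move: H'; rewrite /vec; case: ifP => //; rewrite eqxx.
Qed.

(** Laplace expansion along the last column: k - i selected rows have a larger index than r i, and k
    - i has the parity of the cofactor exponent i + k. *)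
Lemma pl_det g (k : nat) (kn : (k <= n)%N) (r : 'I_k -> 'I_n) :
  {homo r : a b / (a < b)%N >-> (a < b)%N} ->
  \det (mxsub r (widen_ord kn) g) = pl g k [set r a | a : 'I_k].
Proof.
elim: k kn r => [|k IH] kn r rH.
  rewrite det_mx00 pl0 (_ : [set _ | _ in _] = set0) ?eqxx //.
  by apply/setP=> x; rewrite inE; apply/imsetP=> -[[]].
have rI : injective r.
  move=> a b e; apply: val_inj; have := rH a b; have := rH b a; rewrite e ltnn.
  by case: ltngtP => // _ => [/(_ isT)|_ /(_ isT)].
rewrite (expand_det_col _ ord_max) plS /wedge big_imset /=; last exact: in2W.
apply: eq_bigr => i _; rewrite !mxE /cofactor.
have -> : vcol g k (r i) = g (r i) (widen_ord kn ord_max) by exact: (vcolE g (widen_ord kn ord_max)).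
have kn' : (k <= n)%N by exact: ltnW.
have lH : {homo (r \o lift i) : a b / (a < b)%N >-> (a < b)%N}.
  by move=> a b ab; apply: rH; rewrite /= /bump; move: ab; do 2!case: leqP => /=; lia.
have -> : row' i (col' ord_max (mxsub r (widen_ord kn) g)) = mxsub (r \o lift i) (widen_ord kn') g.
  apply/matrixP=> a b; rewrite !mxE; congr (g _ _); apply: val_inj => /=.
  by rewrite /bump leqNgt ltn_ord.
rewrite (IH kn' _ lH) mulrCA; congr (_ * (_ * _)); last first.
  congr (pl g k _); apply/setP=> x; rewrite !inE; apply/imsetP/andP.
    case=> a _ -> /=; split; last exact: imset_f.
    by rewrite (inj_eq rI) eq_sym neq_lift.
  case=> xi /imsetP[a _ e]; have := unlift_some (_ : i != a) => /(_ _)[|b e1 _].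
    by apply: contraNneq xi => ->; rewrite e.
  by exists b; rewrite // e e1.
rewrite /sgn -signr_odd -[in RHS]signr_odd; congr (_ ^+ nat_of_bool _).
have -> : above [set r a | a : 'I_k.+1] (r i) = (k - i)%N.
  rewrite -subSS -(card_initial_seg (ltn_ord i)) -[X in (X - _)%N]card_ord.
  rewrite -[initial_seg _ _]setCK -cardsCs /above -[RHS](card_imset _ rI); congr #|pred_of_set _|.
  apply/setP=> x; rewrite inE; apply/andP/imsetP.
    case=> /imsetP[a _ ->] H; exists a => //; rewrite !inE ltnS -ltnNge ltnNge.
    apply/negP=> /=; rewrite leq_eqVlt => /orP[/eqP/val_inj e|/rH].
      by move: H; rewrite e ltnn.
    by move: H; lia.
  by case=> a; rewrite !inE ltnS -ltnNge => /rH H ->; split=> //; apply: imset_f.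
by rewrite oddD oddB; [exact: addbC|rewrite -ltnS ltn_ord].
Qed.

End Forms.

Arguments pl : simpl never.

(** * Row operations, simple reflections and column operations on coordinates *)

Section RowOps.
Variables (F : numFieldType) (n : nat).
Implicit Types (J K E : {set 'I_n}) (c d : 'I_n -> F) (f : {set 'I_n} -> F).
Implicit Types (g : 'M[F]_n) (i j p q : 'I_n) (t : F).

Definition adj p q : Prop := p = q.+1 :> nat \/ q = p.+1 :> nat.

Definition addrow p q t c : 'I_n -> F := fun j => c j + (j == p)%:R * (t * c q).
(** Effect on coordinates of adding t times row q to row p. There is no sign because, for adjacent p
    and q, the exchange passes no other element of J. *)
Definition fop p q t f : {set 'I_n} -> F :=
  fun J => f J + ((p \in J) && (q \notin J))%:R * (t * f (tperm p q @: J)).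
(** This is y_i(t) for p = [ord_hi i], q = [ord_lo i], and x_i(t) for the opposite choice. *)
Definition elmx p q t : 'M[F]_n := 1%:M + t *: delta_mx p q.

Lemma adj_neq p q : adj p q -> p != q.
Proof. by rewrite -val_eqE /=; case=> ->; lia. Qed.

Lemma adj_sym p q : adj p q -> adj q p.
Proof. by case; [right|left]. Qed.

Lemma sgn_tperm p q J j : adj p q -> p \in J -> q \notin J -> j \in J ->
  sgn F (tperm p q @: J) (tperm p q j) = sgn F J j.
Proof.
move=> pq pJ qJ jJ; rewrite /sgn; congr (_ ^+ _).
rewrite /above -[RHS](card_imset _ (@perm_inj _ (tperm p q))); congr #|pred_of_set _|.
apply/setP=> x; rewrite -{2}(tpermK p q x) mem_imset; last exact: perm_inj.
rewrite !inE mem_swap; case xJ: (tperm p q x \in J) => //=.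
have nn (y z : 'I_n) : y <> z -> (y : nat) <> z by move=> H /val_inj.
have xq : tperm p q x <> q by move=> e; move: qJ; rewrite -e xJ.
have jq : j <> q by move=> e; move: qJ; rewrite -e jJ.
case: tpermP xJ xq => [->|->|/nn x1 /nn x2] xJ xq; case: (tpermP p q j) jq => [->|->|/nn j1 /nn j2] jq;
  move: (nn _ _ jq) (nn _ _ xq); case: pq => pq; rewrite ?ltnn; lia.
Qed.

Lemma sgn_adj p q J : adj p q -> p \in J -> q \in J -> sgn F J p = - sgn F J q.
Proof.
move=> pq pJ qJ; have ne := adj_neq pq.
rewrite (sgnD1 _ p qJ) (sgnD1 _ q pJ) (sgn_swap _ ne) mulNr; congr (- (_ * _)).
rewrite /sgn; congr (_ ^+ _); rewrite /above; congr #|pred_of_set _|.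
have nn (y z : 'I_n) : y <> z -> (y : nat) <> z by move=> H /val_inj.
apply/setP=> x; rewrite !inE; case: (eqVneq x p) (eqVneq x q) => [->|/eqP/nn xp] [e|/eqP/nn xq].
- by rewrite e eqxx in ne.
- by rewrite ltnn /= andbF.
- by rewrite e ltnn /= andbF.
- by case: (x \in J) => //=; case: pq => pq; lia.
Qed.

(** If p is missing, nothing changes; if p and q are both present, the two extra terms cancel by
    [sgn_adj]; if only p is present, [sgn_tperm] matches the terms of J with those of the exchanged
    set. *)
Lemma wedge_addrow p q t c f : adj p q ->
  wedge (addrow p q t c) (fop p q t f) =1 fop p q t (wedge c f).
Proof.
move=> pq J; have ne := adj_neq pq; rewrite /fop.
case: (boolP (p \in J)) => pJ /=; last first.
  rewrite mul0r addr0; apply: eq_bigr => j jJ.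
  rewrite /addrow (_ : (j == p) = false) ?inE ?(negPf pJ) ?andbF ?mul0r ?addr0 //.
  by apply/negbTE; apply: contraNneq pJ => <-.
case: (boolP (q \in J)) => qJ /=.
  rewrite mul0r addr0 /wedge (bigD1 p) //= [X in _ + X](bigD1 q) /=; last by rewrite qJ eq_sym.
  rewrite [RHS](bigD1 p) //= [X in _ = _ + X](bigD1 q) /=; last by rewrite qJ eq_sym.
  have e : tperm p q @: (J :\ q) = J :\ p.
    apply/setP=> x; rewrite mem_swap !inE; case: tpermP => [->|->|/eqP x1 /eqP x2].
    - by rewrite !eqxx.
    - by rewrite ne eq_sym ne pJ qJ.
    - by rewrite x1 x2.
  rewrite /addrow !inE !eqxx pJ qJ ne (eq_sym q) (negPf ne) /= e (sgn_adj pq pJ qJ).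
  rewrite (_ : \sum_(_ | _) _ = \sum_(i | (i \in J) && (i != p) && (i != q)) sgn F J i * (c i * f (J :\ i))).
    by ring.
  apply: eq_bigr => j /andP[/andP[jJ jp] jq].
  by rewrite (negPf jp) !inE (eq_sym q) (negPf jq) qJ /= andbF !mul0r !addr0.
have e1 : tperm p q @: J = q |: J :\ p by rewrite swap_exch.
rewrite mul1r [X in _ + t * X](_ : _ = \sum_(j in J) sgn F J j * (c (tperm p q j) * f ((tperm p q @: J) :\ tperm p q j))); last first.
  rewrite /wedge big_imset /=; last by move=> x y _ _; apply: perm_inj.
  by apply: eq_bigr => j jJ; rewrite sgn_tperm.
rewrite /wedge big_distrr -big_split /=; apply: eq_bigr => j jJ.
have jq : j != q by apply: contraNneq qJ => <-.
rewrite /addrow !inE pJ (negPf qJ) andbF /=.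
have e2 : (tperm p q @: J) :\ tperm p q j = tperm p q @: (J :\ j).
  apply/setP=> x; rewrite !inE !mem_swap !inE; congr (~~ _ && _).
  by rewrite -(inj_eq (@perm_inj _ (tperm p q))) tpermK.
rewrite e2; case: (eqVneq j p) => [->|jp]; last first.
  by rewrite tpermD 1?eq_sym //= !mul0r !mul1r; ring.
rewrite /= tpermL (_ : tperm p q @: (J :\ p) = J :\ p); first by rewrite !mul1r ?mul0r; ring.
by rewrite swap_id // !inE eqxx (negPf qJ) andbF.
Qed.

Lemma elmxE p q t g i j : (elmx p q t *m g) i j = g i j + (i == p)%:R * (t * g q j).
Proof.
rewrite mulmxDl mul1mx mxE -scalemxAl !mxE; congr (_ + _).
rewrite (bigD1 q) //= big1 ?addr0 => [|k /negPf kq]; rewrite mxE ?eqxx ?kq ?andbF ?mul0r //.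
by rewrite andbT; ring.
Qed.

Lemma vcol_elmx p q t g k : vcol (elmx p q t *m g) k =1 addrow p q t (vcol g k).
Proof.
move=> j; rewrite /addrow /vcol; case: insubP => [a _ _|_]; first exact: elmxE.
by rewrite !mulr0 addr0.
Qed.

Lemma pl_elmx p q t g k : adj p q ->
  pl (elmx p q t *m g) k =1 fop p q t (pl g k).
Proof.
move=> pq; elim: k => [|k IH] J.
  rewrite /fop !pl0; case: (boolP (p \in J)) => pJ /=; last by rewrite mul0r addr0.
  rewrite [tperm p q @: J == set0](_ : _ = false) ?mulr0 ?addr0 //.
  by apply/negbTE/set0Pn; exists (tperm p q p); apply: imset_f.
by rewrite !plS -wedge_addrow //; apply: eq_wedge => //; apply: vcol_elmx.
Qed.

Lemma pl_elmx_id p q t g k J : adj p q -> (p \notin J) || (q \in J) ->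
  pl (elmx p q t *m g) k J = pl g k J.
Proof.
move=> pq H; rewrite pl_elmx // /fop.
by case: (p \in J) H => //=; [move=> -> /=|]; rewrite mul0r addr0.
Qed.

Lemma pl_elmx_op p q t g k J : adj p q -> p \in J -> q \notin J ->
  pl (elmx p q t *m g) k J = pl g k J + t * pl g k (tperm p q @: J).
Proof. by move=> pq pJ qJ; rewrite pl_elmx // /fop pJ qJ mul1r. Qed.

(** A lift of the transposition: row p becomes row q, and row q becomes minus row p. Its inverse is
    [sdot q p]. *)
Definition sdot p q : 'M[F]_n := elmx q p (-1) *m elmx p q 1 *m elmx q p (-1).

Lemma pl_sdot p q g k J : adj p q ->
  pl (sdot p q *m g) k J =
  (if (q \in J) && (p \notin J) then -1 else 1) * pl g k (tperm p q @: J).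
Proof.
move=> pq; have qp := adj_sym pq; rewrite /sdot -!mulmxA.
case: (boolP (p \in J)) (boolP (q \in J)) => [pJ|pJ] [qJ|qJ] /=.
- by rewrite !pl_elmx_id ?pJ ?qJ ?orbT // swap_id ?pJ ?qJ // mul1r.
- rewrite (pl_elmx_id _ _ _ qp) ?(negPf qJ) // (pl_elmx_op _ _ _ pq) //.
  rewrite (pl_elmx_id _ _ _ qp) ?(negPf qJ) // (pl_elmx_op _ _ _ qp) ?mem_swap ?tpermL ?tpermR //.
  by rewrite (tpermC q) swapK; ring.
- rewrite (pl_elmx_op _ _ _ qp) // (tpermC q) (pl_elmx_id _ _ _ pq) ?(negPf pJ) //.
  rewrite (pl_elmx_op _ _ _ qp) // (tpermC q) (pl_elmx_op _ _ _ pq) ?mem_swap ?tpermL ?tpermR //.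
  rewrite swapK (pl_elmx_id _ _ _ qp) ?mem_swap ?tpermL ?tpermR ?qJ ?pJ ?orbT //.
  by rewrite (pl_elmx_op _ _ _ qp) // (tpermC q); ring.
- by rewrite !pl_elmx_id ?(negPf pJ) ?(negPf qJ) ?orbT // swap_id ?(negPf pJ) ?(negPf qJ) // mul1r.
Qed.

Lemma elmxK p q t g : p != q -> elmx p q (- t) *m (elmx p q t *m g) = g.
Proof.
move=> pq; apply/matrixP=> i j; rewrite !elmxE (eq_sym q) (negPf pq) mul0r addr0; ring.
Qed.

Lemma elmxNK p q t g : p != q -> elmx p q t *m (elmx p q (- t) *m g) = g.
Proof. by move=> pq; rewrite -{1}(opprK t) elmxK. Qed.

Lemma elmx_unit p q t : p != q -> elmx p q t \in unitmx.
Proof.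
move=> pq; have /mulmx1_unit[] // : elmx p q t *m elmx p q (- t) = 1%:M.
by rewrite -[LHS]mulmx1 -mulmxA elmxNK.
Qed.

Lemma sdot_unit p q : p != q -> sdot p q \in unitmx.
Proof. by move=> pq; rewrite !unitmx_mul !elmx_unit // eq_sym. Qed.

Lemma sdotE p q g i j : p != q -> (sdot p q *m g) i j =
  if i == p then g q j else if i == q then - g p j else g i j.
Proof.
move=> pq; rewrite /sdot -!mulmxA !elmxE !eqxx (negPf pq) !mul0r !mul1r !addr0.
case: (eqVneq i p) => [->|ip]; first by rewrite (negPf pq) !mul0r !mul1r; ring.
by case: (eqVneq i q) => [->|iq]; rewrite ?mul0r ?mul1r; ring.
Qed.

Lemma sdotK p q g : p != q -> sdot q p *m (sdot p q *m g) = g.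
Proof.
move=> pq; apply/matrixP=> i j; have qp : q != p by rewrite eq_sym.
rewrite sdotE // !sdotE // !eqxx (negPf qp).
case: (eqVneq i q) => [->//|iq].
by case: (eqVneq i p) => [->|ip]; rewrite ?opprK.
Qed.

(** Invertible triangular matrices for the order h: upper for [hval], lower for [hrev]. *)
Definition tri (h : 'I_n -> nat) (b : 'M[F]_n) : Prop :=
  (forall i j, (h j < h i)%N -> b i j = 0) /\ (forall i, b i i != 0).

Lemma vcol_mulr g b k (kn : (k < n)%N) : tri (@hval n) b ->
  vcol (g *m b) k =1 fun j => \sum_(a : 'I_n | (a <= k)%N) b a (Ordinal kn) * vcol g a j.
Proof.
case=> tb _ j; have -> : vcol (g *m b) k j = (g *m b) j (Ordinal kn).
  exact: (vcolE (g *m b) (Ordinal kn)).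
rewrite mxE [RHS]big_mkcond; apply: eq_bigr => a _ /=; rewrite vcolE.
case: leqP => [_|ka]; [exact: mulrC|by rewrite tb ?mulr0].
Qed.

(** Each column is scaled and changed by earlier columns, which the wedge kills. So all coordinates
    of one level scale alike, and their vanishing depends on the flag alone. *)
Lemma pl_mulr g b k J : tri (@hval n) b ->
  pl (g *m b) k J = (\prod_(a : 'I_n | (a < k)%N) b a a) * pl g k J.
Proof.
move=> tb; elim: k J => [|k IH] J; first by rewrite big_pred0 // mul1r !pl0.
have [kn|nk] := ltnP k n; last first.
  have pl_0 (x : 'M[F]_n) : pl x k.+1 J = 0.
    apply/eqP; apply: contraLR nk; rewrite -ltnNge => /pl_card <-.
    by rewrite -[X in (_ <= X)%N]card_ord max_card.
  by rewrite !pl_0 mulr0.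
rewrite plS (eq_wedge (vcol_mulr g kn tb) IH) wedgeZr wedge_sum.
rewrite [X in _ * X](bigD1 (Ordinal kn)) //= [X in _ * (_ + X)]big1 ?addr0.
  rewrite plS [in RHS](bigD1 (Ordinal kn)) //= mulrA [_ * b _ _]mulrC.
  congr (_ * _ * _); apply: eq_bigl => a; rewrite -val_eqE /= ltnS.
  by case: ltngtP.
move=> a /andP[ak ne]; rewrite wedge_vcol ?mulr0 // ltn_neqAle ak andbT.
by move: ne; rewrite -val_eqE.
Qed.

Lemma tri_prod_neq0 h b (P : pred 'I_n) : tri h b -> \prod_(a | P a) b a a != 0.
Proof. by case=> _ d; apply/prodf_neq0 => a _. Qed.

Lemma pl_setT g : pl g n setT = \det g.
Proof.
have e := @pl_det F n g n (leqnn n) id (fun _ _ => id).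
have -> : \det g = \det (mxsub id (widen_ord (leqnn n)) g).
  by congr (\det _); apply/matrixP=> i j; rewrite mxE; congr (g _ _); apply: val_inj.
by rewrite e; congr (pl g n _); apply/setP=> x; rewrite inE; apply/esym/imsetP; exists x.
Qed.

Lemma unit_pl g : g \in unitmx -> pl g n setT != 0.
Proof. by rewrite pl_setT unitmxE unitfE. Qed.

Lemma tri_unit b : tri (@hval n) b -> b \in unitmx.
Proof.
move=> tb; rewrite unitmxE unitfE -pl_setT -(mul1mx b) pl_mulr //.
by apply: mulf_neq0; [exact: tri_prod_neq0 tb|exact/unit_pl/unitmx1].
Qed.

End RowOps.

(** * Bruhat cells through Gale-extremal coordinates *)

Section Cells.
Variables (F : numFieldType) (n : nat).
Implicit Types (J K E : {set 'I_n}) (g b : 'M[F]_n) (i j p q : 'I_n) (t : F).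
Implicit Types (u v w x : 'S_n) (h : 'I_n -> nat).

Definition cell_le h g w : Prop := forall k J, pl g k J != 0 -> gle h J (sset w k).
(** For [hval] this is B_+ w B_+ and for [hrev] it is B_- w B_+, with triangular matrices of any
    nonzero determinant; see [cell_triP]. *)
Definition cell h g w : Prop :=
  (forall k, (k <= n)%N -> pl g k (sset w k) != 0) /\ cell_le h g w.

Lemma cell_le_uniq h g u w : injective h -> cell h g u -> cell_le h g w ->
  forall k, gle h (sset u k) (sset w k).
Proof.
move=> hI [u0 _] gw k; have [kn|nk] := leqP k n; first exact: gw (u0 _ kn).
have e x : sset x k = sset x n.
  by apply/setP=> y; rewrite !mem_sset ltn_ord (ltn_trans _ nk) ?ltn_ord.
by rewrite !e !ssetn.
Qed.

Lemma cell_uniq h g u w : injective h -> cell h g u -> cell h g w -> u = w.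
Proof.
move=> hI cu cw; apply: sset_inj => k _; apply: (@gle_anti _ h _ _ hI).
  exact: cell_le_uniq cu (proj2 cw) k.
exact: cell_le_uniq cw (proj2 cu) k.
Qed.

Lemma cell_mulr h g b w : tri (@hval n) b -> cell h (g *m b) w <-> cell h g w.
Proof.
move=> tb; have e k J : (pl (g *m b) k J != 0) = (pl g k J != 0).
  by rewrite pl_mulr // mulf_eq0 (negPf (tri_prod_neq0 _ tb)).
by split=> -[c1 c2]; split=> [k kn|k J]; [rewrite -e; exact: c1|rewrite -e; exact: c2|rewrite e; exact: c1|rewrite e; exact: c2].
Qed.

Definition leading h g w : Prop :=
  (forall a j, (h (w a) < h j)%N -> g j a = 0) /\ (forall a, g (w a) a != 0).

Lemma leading_cell h g w : injective h -> leading h g w -> cell h g w.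
Proof.
move=> hI [lt0 neq0].
have H k : (k <= n)%N -> pl g k (sset w k) != 0 /\
                  forall J, pl g k J != 0 -> gle h J (sset w k).
  elim: k => [|k IH] kn.
    split=> [|J]; first by rewrite pl0 sset0 eqxx oner_neq0.
    by rewrite pl0 sset0; case: (eqVneq J set0) => [-> _ t //|_]; rewrite eqxx.
  have [IH1 IH2] := IH (ltnW kn); pose a := Ordinal kn.
  have colE j : vcol g k j = g j a by exact: (vcolE g a).
  rewrite (ssetS _ kn); have na := sset_notin w a; rewrite /= -/a in na *.
  have small j : g j a != 0 -> (h j <= h (w a))%N.
    by apply: contraNT; rewrite -ltnNge => /lt0 ->.
  split.
    rewrite plS /wedge big_setU1 //= setU1K // big1 ?addr0.
      by rewrite !mulf_neq0 ?sgn_neq0 // colE.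
    move=> j jw; rewrite colE.
    have [->|gj] := eqVneq (g j a) 0; first by rewrite mul0r mulr0.
    have [->|/IH2 H] := eqVneq (pl g k ((w a |: sset w k) :\ j)) 0; first by rewrite !mulr0.
    have ja : j != w a by apply: contraNneq na => <-.
    have lt : (h j < h (w a))%N.
      by rewrite ltn_neqAle small // andbT (inj_eq hI).
    have := H (h (w a)).
    have := @cntD1 _ h (h (w a)) (w a |: sset w k) j; rewrite !inE jw orbT => /(_ isT).
    by rewrite cntU1 // leqnn; move: lt; lia.
  move=> J /pl_sub[j jJ]; rewrite colE mulf_eq0 negb_or => /andP[/small sj /IH2 H].
  exact: gle_add H.
split=> [k /H[]//|k J Jk]; apply: (H k _).2 => //.
by rewrite -(pl_card Jk) -[X in (_ <= X)%N]card_ord max_card.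
Qed.

(** The new column a is the contraction of [pl g a.+1] by the first a pivots: it vanishes on those
    pivots and, by extremality, on the other rows higher than w a. *)
Lemma cell_leading h g w : injective h -> cell h g w ->
  exists2 b, tri (@hval n) b & leading h (g *m b) w.
Proof.
move=> hI [c1 c2].
have /choice[q qP] : forall a : 'I_n, exists q : nat -> F, q a != 0 /\
   vec (pl g a.+1) (sset w a) =1 fun j => \sum_(0 <= i < a.+1) q i * vcol g i j.
  move=> a; have [q [q1 q2]] := vec_spanS g a (sset w a).
  by exists q; rewrite q1; split=> //; apply: c1; apply: ltnW.
pose b := \matrix_(i, a) (if (i <= a)%N then q a i else 0) : 'M[F]_n.
have gb j a : (g *m b) j a = vec (pl g a.+1) (sset w a) j.
  rewrite (qP a).2 mxE big_mkord (big_ord_widen n (fun i : nat => q a i * vcol g i j)) //.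
  rewrite [RHS]big_mkcond; apply: eq_bigr => i _; rewrite mxE vcolE ltnS.
  by case: ifP; rewrite ?mulr0 // mulrC.
exists b.
  split=> [i j|i]; first by rewrite mxE /hval ltnNge => /negPf ->.
  by rewrite mxE leqnn; case: (qP i).
split=> [a j|a]; rewrite gb /vec; last first.
  by rewrite (negPf (sset_notin w a)) -ssetS_ord mulf_neq0 ?sgn_neq0 ?c1.
move=> lt; case: ifPn => // ja; apply/eqP; rewrite mulf_eq0 (negPf (sgn_neq0 _ _ _)) /=.
apply: contraLR lt => /c2; rewrite ssetS_ord.
move/(_ (h j)); rewrite !cntU1 ?sset_notin // leqnn.
by rewrite -leqNgt leq_add2r; case: (leqP (h j) (h (w a))).
Qed.

(** Greedy choice of pivots: each step adds the h-highest row that keeps the coordinate nonzero. *)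
Lemma cell_exists h g : injective h -> g \in unitmx -> exists w, cell h g w.
Proof.
move=> hI gU; pose good (s : seq 'I_n) := uniq s /\ forall l, (l <= size s)%N ->
  pl g l [set y in take l s] != 0 /\
  forall J, pl g l J != 0 -> gle h J [set y in take l s].
have H k : (k <= n)%N -> exists2 s, size s = k & good s.
  elim: k => [|k IH] kn.
    exists [::] => //; split=> // l; rewrite leqn0 => /eqP ->.
    rewrite (_ : [set y in _] = set0) ?pl0 ?eqxx ?oner_neq0; last by apply/setP=> y; rewrite !inE.
    by split=> // J; rewrite pl0; case: (eqVneq J set0) => [-> _ t //|_]; rewrite eqxx.
  have [s sk [us sP]] := IH (ltnW kn); pose E := [set y in s].
  have [E1 E2] : pl g k E != 0 /\ forall J, pl g k J != 0 -> gle h J E.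
    by have := sP k; rewrite -{1}sk leqnn -sk take_size => /(_ isT).
  have [j0 j0E j0P] := vec_neq0 (unit_pl gU) kn E1.
  case: (@arg_maxnP _ j0 (fun j => vec (pl g k.+1) E j != 0) h j0P) => j jP jmax.
  have jE : j \notin E by move: jP; rewrite /vec; case: ifP => //; rewrite eqxx.
  have jE' : [set y in rcons s j] = j |: E.
    by apply/setP=> y; rewrite !inE mem_rcons inE.
  exists (rcons s j); first by rewrite size_rcons sk.
  split; first by rewrite rcons_uniq us andbT; move: jE; rewrite inE.
  move=> l; rewrite size_rcons leq_eqVlt => /orP[/eqP ->|].
    rewrite -(size_rcons s j) take_size size_rcons sk jE'; split.
      by move: jP; rewrite /vec (negPf jE) mulf_eq0 (negPf (sgn_neq0 _ _ _)).
    (* By [plS_vec], a nonzero coordinate J splits off a row with nonzero contraction. That row is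
       at most j and the rest is dominated by E, so [gle_add] applies. *)
    move=> J Jn; have : wedge (vec (pl g k.+1) E) (pl g k) J != 0.
      by rewrite plS_vec mulf_neq0.
    move=> W; have [i iJ] : exists2 i, i \in J & vec (pl g k.+1) E i * pl g k (J :\ i) != 0.
      apply/exists_inP; apply: contraNT W; rewrite negb_exists_in => /forall_inP W.
      by apply/eqP; apply: big1 => i /W; rewrite negbK => /eqP ->; rewrite mulr0.
    rewrite mulf_eq0 negb_or => /andP[/jmax ij /E2 iE].
    exact: gle_add iE.
  rewrite ltnS => ls; rewrite -cats1 takel_cat //; exact: sP.
have [s sn [us sP]] := H n (leqnn n).
have [w wP] := perm_of_seq us sn; exists w; split=> [k kn|k J Jk]; rewrite wP.
  by have [] := sP k; rewrite ?sn.
have kn : (k <= size s)%N by rewrite sn -(pl_card Jk) -[X in (_ <= X)%N]card_ord max_card.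
exact: (sP k kn).2.
Qed.

(** [pl_sub] empties J one element at a time and [vec_neq0] completes it, so that J lies on a full
    chain of nonzero coordinates; such a chain is a permutation. *)
Lemma flag_of_bases g k J : g \in unitmx -> pl g k J != 0 ->
  exists x, sset x k = J /\ forall l, (l <= n)%N -> pl g l (sset x l) != 0.
Proof.
move=> gU Jk.
have kn : (k <= n)%N by rewrite -(pl_card Jk) -[X in (_ <= X)%N]card_ord max_card.
pose good (s : seq 'I_n) := uniq s /\ forall l, (l <= size s)%N ->
  pl g l [set y in take l s] != 0.
have [s0 [sk sJ s0P]] : exists s, [/\ size s = k, [set y in s] = J & good s].
  elim: k J Jk {kn} => [|k IH] J Jk.
    exists [::]; split=> //.
      apply/setP=> y; rewrite !inE; have := pl_card Jk => /eqP.
      by rewrite cards_eq0 => /eqP ->; rewrite inE.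
    split=> // l; rewrite leqn0 => /eqP ->.
    by rewrite (_ : [set y in _] = set0) ?pl0 ?eqxx ?oner_neq0 //; apply/setP=> y; rewrite !inE.
  have [j jJ] := pl_sub Jk; rewrite mulf_eq0 negb_or => /andP[_ /IH[s [sk sJ [us sP]]]].
  have js : j \notin s by have := setD11 j J; rewrite -sJ inE => ->.
  have e : [set y in rcons s j] = J.
    rewrite -(setD1K jJ) -sJ; apply/setP=> y; by rewrite !inE mem_rcons inE.
  exists (rcons s j); rewrite size_rcons sk; split=> //; split; first by rewrite rcons_uniq js.
  move=> l; rewrite size_rcons leq_eqVlt => /orP[/eqP ->|].
    by rewrite -(size_rcons s j) take_size size_rcons sk e.
  by rewrite ltnS => ls; rewrite -cats1 takel_cat //; exact: sP.
have [s [sn st [us sP]]] : exists s, [/\ size s = n, take k s = s0 & good s].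
  have H d : (d <= n - k)%N -> exists s, [/\ size s = (d + k)%N, take k s = s0 & good s].
    elim: d => [|d IH] dn; first by exists s0; rewrite -{2}sk take_size.
    have [s [ss st [us sP]]] := IH (ltnW dn).
    have dk : (d + k < n)%N by lia.
    have E1 : pl g (d + k) [set y in s] != 0.
      by have := sP (size s) (leqnn _); rewrite take_size ss.
    have [j js jP] := vec_neq0 (unit_pl gU) dk E1.
    have e : [set y in rcons s j] = j |: [set y in s].
      by apply/setP=> y; rewrite !inE mem_rcons inE.
    exists (rcons s j); rewrite size_rcons ss; split=> //.
      by rewrite -cats1 takel_cat // ss leq_addl.
    split; first by rewrite rcons_uniq us andbT; move: js; rewrite inE.
    move=> l; rewrite size_rcons leq_eqVlt => /orP[/eqP ->|].
      rewrite -(size_rcons s j) take_size size_rcons ss e; move: jP.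
      by rewrite /vec (negPf js) mulf_eq0 (negPf (sgn_neq0 _ _ _)).
    by rewrite ltnS => ls; rewrite -cats1 takel_cat //; exact: sP.
  by have [s] := H _ (leqnn _); rewrite subnK // => sP; exists s.
have [x xP] := perm_of_seq us sn; exists x; rewrite xP st sJ; split=> // l ln.
by rewrite xP; apply: sP; rewrite sn.
Qed.

Lemma cell_support g v w k J : g \in unitmx -> cell_le (@hval n) g w ->
  cell_le (@hrev n) g v -> pl g k J != 0 ->
  exists x, [/\ ble v x, ble x w & sset x k = J].
Proof.
move=> gU cw cv /(flag_of_bases gU)[x [xJ xP]].
have out l (y : 'S_n) : (n < l)%N -> sset y l = setT.
  by move=> nl; apply/setP=> z; rewrite mem_sset inE (ltn_trans _ nl) ?ltn_ord.
exists x; split=> // l; (have [ln|nl] := leqP l n; last by rewrite !out //; exact: gle_refl).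
  by have /gle_rev := cv l _ (xP l ln); apply; rewrite !card_sset.
by apply: cw; apply: xP.
Qed.

Section CellOps.
Variables (h : 'I_n -> nat) (hI : injective h) (p q : 'I_n) (pq : adj p q).
Hypothesis hpq : h p = (h q).+1.
Let s := tperm p q.

Lemma cell_le_raise g t w : bef w p q -> cell_le h g w -> cell_le h (elmx p q t *m g) w.
Proof.
move=> b gw k J; have [/andP[pJ qJ]|] := boolP ((p \in J) && (q \notin J)); last first.
  by rewrite negb_and negbK => H; rewrite pl_elmx_id //; apply: gw.
rewrite pl_elmx_op //; have [e|/gw //] := eqVneq (pl g k J) 0.
rewrite e add0r mulf_eq0 negb_or => /andP[_ /gw H].
rewrite -(swapK p q J); apply: gle_swapl => //; exact: bef_mem.
Qed.

Lemma cell_le_sdot g w : bef w p q -> cell_le h g w ->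
  cell_le h (sdot F p q *m g) w /\ cell_le h (sdot F q p *m g) w.
Proof.
move=> b gw; have H k J : pl g k (s @: J) != 0 -> gle h J (sset w k).
  by move/gw=> H; rewrite -(swapK p q J); apply: gle_swapl => //; exact: bef_mem.
split=> k J; rewrite pl_sdot; try by [|apply: adj_sym].
  by rewrite mulf_eq0 negb_or => /andP[_ /H].
by rewrite (tpermC q) mulf_eq0 negb_or => /andP[_ /H].
Qed.

Lemma cell_le_swap g w : bef w q p -> cell_le h g w -> cell_le h g (w * s)%g.
Proof.
move=> b gw k J /gw H; rewrite sset_mul; apply: gle_trans H _.
by apply: gle_swapr => //; exact: bef_mem.
Qed.

(** At a set that moves, extremality kills the old coordinate of the exchanged set, and the new one
    is t times the nonzero coordinate at w. *)
Lemma cell_raise g t w : bef w q p -> t != 0 -> cell h g w ->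
  cell h (elmx p q t *m g) (w * s)%g.
Proof.
move=> b t0 [c1 c2]; split; last first.
  by apply: cell_le_raise; [rewrite bef_swap|exact: cell_le_swap].
move=> k kn; rewrite sset_mul -/s; have := bef_mem (k := k) b.
case: (boolP (p \in sset w k)) => pw; first by move=> /(_ isT) qw;
  rewrite swap_id ?pw ?qw // pl_elmx_id ?qw ?orbT ?c1.
case: (boolP (q \in sset w k)) => qw _; last first.
  by rewrite swap_id ?(negPf pw) ?(negPf qw) // pl_elmx_id ?pw ?c1.
rewrite pl_elmx_op ?mem_swap ?tpermL ?tpermR // swapK.
have -> : pl g k (s @: sset w k) = 0; last by rewrite add0r mulf_neq0 ?c1.
apply/eqP; apply/negPn/negP=> /c2; rewrite /s tpermC swap_exch // => /(_ (h p)).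
rewrite cntU1; last by rewrite !inE (negPf pw) andbF.
by rewrite (cntD1 _ _ qw) hpq; lia.
Qed.

(** The factor [elmx q p t] belongs to the triangular group of h, whose left action preserves the
    cell. *)
Lemma cell_lower g t w : cell h g w -> cell h (elmx q p t *m g) w.
Proof.
have qp := adj_sym pq; move=> [c1 c2]; split=> [k kn|k J].
  have [/andP[qw pw]|] := boolP ((q \in sset w k) && (p \notin sset w k)); last first.
    by rewrite negb_and negbK => H; rewrite pl_elmx_id ?c1.
  rewrite pl_elmx_op //; have -> : pl g k (tperm q p @: sset w k) = 0; last by rewrite mulr0 addr0 c1.
  apply/eqP; apply/negPn/negP=> /c2; rewrite swap_exch // => /(_ (h p)).
  rewrite cntU1; last by rewrite !inE (negPf pw) andbF.
  by rewrite (cntD1 _ _ qw) hpq; lia.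
have [/andP[qJ pJ]|] := boolP ((q \in J) && (p \notin J)); last first.
  by rewrite negb_and negbK => H; rewrite pl_elmx_id //; apply: c2.
rewrite pl_elmx_op //; have [e|/c2 //] := eqVneq (pl g k J) 0.
rewrite e add0r mulf_eq0 negb_or => /andP[_ /c2]; rewrite swap_exch // => H t'.
have := H t'; rewrite cntU1 ?inE ?(negPf pJ) ?andbF // (cntD1 _ _ qJ) hpq; lia.
Qed.

Lemma cell_sdot g w : bef w q p -> cell h g w ->
  cell h (sdot F p q *m g) (w * s)%g /\ cell h (sdot F q p *m g) (w * s)%g.
Proof.
move=> b [c1 c2]; have qp := adj_sym pq.
have [||l1 l2] := @cell_le_sdot g (w * s)%g; first by rewrite bef_swap.
  exact: cell_le_swap.
split; split=> // k kn; rewrite pl_sdot // sset_mul ?(tpermC q) swapK mulf_neq0 ?c1 //;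
  by case: ifP => _; rewrite ?oppr_eq0 oner_neq0.
Qed.

End CellOps.

End Cells.

(** * Nonnegative flags: elimination of a left factor, positivity on the interval *)

Section TotalNonnegativity.
Variables (F : realFieldType) (n : nat).
Implicit Types (J K E A : {set 'I_n}) (g b : 'M[F]_n) (i j p q a : 'I_n) (t : F).
Implicit Types (u v w x : 'S_n).

Definition tnn g : Prop := forall k J, 0 <= pl g k J.

Lemma tnn_gt0 g k J : tnn g -> pl g k J != 0 -> 0 < pl g k J.
Proof. by move=> tg; rewrite lt_def tg andbT. Qed.

Lemma tnn_elmx p q t g : adj p q -> 0 <= t -> tnn g -> tnn (elmx p q t *m g).
Proof.
by move=> pq t0 tg k J; rewrite pl_elmx // addr_ge0 // mulr_ge0 ?ler0n // mulr_ge0.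
Qed.

Lemma adj_lohi (i : 'I_n.-1) : adj (ord_hi i) (ord_lo i). Proof. by left. Qed.

Lemma ord_hi_lt (i : 'I_n.-1) (z : 'I_n) :
  (ord_lo i <= z)%N -> z != ord_lo i -> z != ord_hi i -> (ord_hi i < z)%N.
Proof. by rewrite -!val_eqE /=; lia. Qed.

Section Elimination.
Variables (g : 'M[F]_n) (w : 'S_n) (p0 : 'I_n) (i : 'I_n.-1).
Hypotheses (tg : tnn g) (cg : cell (@hval n) g w).
Hypotheses (wfix : forall a : 'I_n, (a < p0)%N -> w a = a) (p0w : (p0 < w p0)%N).
Hypothesis wp0 : w p0 = ord_hi i.
Let m := ord_hi i.
Let l := ord_lo i.
Let seg := sset w p0.

Let ml : m = l.+1 :> nat. Proof. by []. Qed.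
Let aml : adj m l. Proof. by left. Qed.
Let mnl : m != l. Proof. exact: adj_neq aml. Qed.
Let p0l : (p0 <= l)%N. Proof. by move: p0w; rewrite wp0 ml ltnS. Qed.

Let sset_fix k : (k <= p0)%N -> sset w k = initial_seg n k.
Proof.
move=> kp; apply/setP=> y; rewrite mem_sset inE; apply/idP/idP => H.
  by rewrite -{1}(permKV w y) wfix // (leq_trans H).
by rewrite -{1}(wfix (leq_trans H kp)) permK.
Qed.

Let segE : seg = initial_seg n p0. Proof. exact: sset_fix. Qed.
Let mseg : m \notin seg. Proof. by rewrite segE inE -leqNgt ml ltnW // ltnS. Qed.
Let lseg : l \notin seg. Proof. by rewrite segE inE -leqNgt. Qed.

(** The Gale bound [sset w k] is here the smallest set of its size, so a single coordinate
    survives. *)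
Let small_support k J : (k <= p0)%N -> pl g k J != 0 -> J = initial_seg n k.
Proof.
move=> kp Jk; apply/eqP; rewrite eqEcard (pl_card Jk) card_initial_seg ?leqnn ?andbT; last first.
  exact: leq_trans kp (ltnW (ltn_ord p0)).
apply/subsetP=> y yJ; rewrite inE ltnNge; apply/negP=> ky.
have := (proj2 cg) k J Jk k; rewrite leqNgt => /negP; apply.
rewrite sset_fix // (cntD1 _ _ yJ) /hval ky /=.
rewrite /cnt (_ : [set j in initial_seg n k | _] = set0) ?cards0 //.
by apply/setP=> z; rewrite !inE; lia.
Qed.

(** Incidence of levels p0 and k: if J missed some j of [seg], the product of [pl g p0 seg] and
    [pl g k J] would be the only term. *)
Let seg_sub k J : (p0 <= k)%N -> pl g k J != 0 -> seg \subset J.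
Proof.
move=> pk Jk; apply/subsetP=> j jseg; apply: contraNT Jk => jJ.
have := @incidence F n g p0 k (seg :\ j) (j |: J) pk.
rewrite big_setU1 //= big1 ?addr0 => [|z zJ].
  move/eqP; rewrite !mulf_eq0 (negPf (sgn_neq0 _ _ _)) setU1K //= => /orP[|//].
  rewrite /vec setD11 setD1K // mulf_eq0 (negPf (sgn_neq0 _ _ _)) /=.
  by rewrite (negPf ((proj1 cg) p0 _)) // ltnW.
have zj : z != j by apply: contraNneq jJ => <-.
rewrite /vec; case: ifP => _; first by rewrite mul0r mulr0.
have [->|] := eqVneq (pl g p0 (z |: seg :\ j)) 0; first by rewrite mulr0 mul0r mulr0.
move/(small_support (leqnn _)) => e; move: jseg; rewrite segE -e !inE.
by rewrite eq_sym (negPf zj) eqxx.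
Qed.

Let supp_p0S A z : z \notin A -> z \notin seg -> pl g p0.+1 (z |: A) != 0 -> A = seg.
Proof.
move=> zA zseg H; have /subsetP sub := seg_sub (leqnSn p0) H.
apply/esym/eqP; rewrite eqEcard; apply/andP; split.
  by apply/subsetP=> y ys; have := sub y ys; rewrite !inE => /orP[/eqP e|//]; rewrite -e ys in zseg.
have := pl_card H; rewrite cardsU1 zA /= add1n => -[->].
by rewrite card_sset // ltnW.
Qed.

Let above_m (z : 'I_n) : (m < z)%N -> pl g p0.+1 (z |: seg) = 0.
Proof.
move=> mz; apply/eqP; apply/negPn/negP=> H.
have zs : z \notin seg by rewrite segE inE -leqNgt; move: mz p0l ml; lia.
have := (proj2 cg) _ _ H z; rewrite ssetS_ord wp0 -/seg -/m !cntU1 // /hval leqnn.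
by rewrite leq_add2r [(z <= m)%N]leqNgt mz.
Qed.

Let pm : 0 < pl g p0.+1 (m |: seg).
Proof.
by apply: tnn_gt0 => //; rewrite /m -wp0 -ssetS_ord; apply: (proj1 cg).
Qed.

Let low_zero k J : (k <= p0.+1)%N -> l \in J -> m \notin J ->
  (pl g p0.+1 (l |: seg) = 0) -> pl g k J = 0.
Proof.
move=> kp lJ mJ l0; apply/eqP; apply/negPn/negP=> H.
move: kp; rewrite leq_eqVlt => /orP[/eqP e|kp].
  move: H; rewrite e -(setD1K lJ) => H.
  by move: (H); rewrite (supp_p0S _ lseg H) ?l0 ?eqxx // !inE eqxx.
by move: lJ; rewrite (small_support kp H) inE; move: p0l; lia.
Qed.

Section CaseInfinite.
Hypothesis l0 : pl g p0.+1 (l |: seg) = 0.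

(** Incidence with level p0+1 produces a row a < l with a nonzero minor on l, m and A without a. In
    the three-term relation for a < l < m the left side is zero by induction, so nonnegativity kills
    [pl g k A]; then J has no nonzero minor one level down. *)
Lemma elim_inf k J : l \in J -> m \notin J -> pl g k J = 0.
Proof.
elim: k J => [|k IH] J lJ mJ; first exact: low_zero.
have [kp|pk] := leqP k.+1 p0.+1; first exact: low_zero.
apply/eqP; apply/negPn/negP=> H.
have [A [JA lA]] : exists A, J = l |: A /\ l \notin A.
  by exists (J :\ l); rewrite setD1K // setD11.
have mA : m \notin A by move: mJ; rewrite JA !inE negb_or => /andP[].
have AJ : J :\ l = A by rewrite JA setU1K.
have sub_lt a : a \in A -> (a != l) && (a != m).
  by move=> aA; apply/andP; split; [apply: contraNneq lA|apply: contraNneq mA] => <-.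
have [a aA /andP[al Za]] : exists2 a, a \in A & (a < l)%N && (pl g k.+1 (l |: (m |: A :\ a)) != 0).
  apply/exists_inP; apply: contraT; rewrite negb_exists_in => /forall_inP HA.
  (* Only a row z < l can balance the nonzero term at m: the row l drops out by [l0], rows beyond m
     by [above_m]. *)
  have := @incidence F n g p0.+1 k.+1 seg (m |: J) (ltnW pk).
  rewrite big_setU1 //= setU1K // big1 ?addr0 => [|z zJ].
    move/eqP; rewrite !mulf_eq0 (negPf (sgn_neq0 _ _ _)) (negPf H) orbF /=.
    by rewrite /vec (negPf mseg) mulf_eq0 (negPf (sgn_neq0 _ _ _)) /= gt_eqF.
  rewrite /vec; case: ifP => _; first by rewrite mul0r mulr0.
  have [->|zl] := eqVneq z l; first by rewrite l0 mulr0 mul0r mulr0.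
  have zA : z \in A by move: zJ; rewrite JA !inE (negPf zl).
  have /andP[_ zm] := sub_lt z zA.
  have [zlt|lz] := ltnP z l; last first.
    have mz : (m < z)%N by apply: ord_hi_lt.
    by rewrite above_m // mulr0 mul0r mulr0.
  have := HA z zA; rewrite zlt /= negbK => /eqP e0.
  have -> : (m |: J) :\ z = l |: (m |: A :\ z).
    apply/setP=> y; rewrite JA !inE; case: (eqVneq y z) => [->|_]; last by rewrite orbCA.
    by rewrite (negPf zl) (negPf zm).
  by rewrite e0 !mulr0.
pose E := A :\ a; have /andP[al' am'] := sub_lt a aA.
have aE : a \notin E by rewrite setD11.
have lE : l \notin E by rewrite !inE negb_and (negPf lA) orbT.
have mE : m \notin E by rewrite !inE negb_and (negPf mA) orbT.
have lm : (a < l < m)%N by rewrite al ml ltnSn.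
have := three_term g k lm aE lE mE.
rewrite (IH (l |: E)) ?setU11 //; last by rewrite in_setU1 negb_or mnl mE.
have eA : a |: E = A by rewrite setD1K.
have eJ : a |: (l |: E) = J by rewrite setUCA eA -JA.
rewrite eA eJ mul0r => /esym/eqP; rewrite paddr_eq0 ?mulr_ge0 //.
rewrite !mulf_eq0 (negPf Za) (negPf H) !orbF => /andP[/eqP A0 _].
have [j jJ] := pl_sub H; rewrite mulf_eq0 negb_or => /andP[_].
have [->|jl] := eqVneq j l; first by rewrite AJ A0 eqxx.
by rewrite IH ?eqxx // !inE ?(negPf mJ) ?andbF // eq_sym jl lJ.
Qed.

End CaseInfinite.

Section CaseFinite.
Hypothesis l0 : pl g p0.+1 (l |: seg) != 0.
(** The largest t for which the coordinate at m and [seg] stays nonnegative after division by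
    y_i(t). *)
Let t0 := pl g p0.+1 (m |: seg) / pl g p0.+1 (l |: seg).
Let g' := elmx m l (- t0) *m g.

Let same k J : (m \notin J) || (l \in J) -> pl g' k J = pl g k J.
Proof. exact: pl_elmx_id. Qed.

Let diff k J : m \in J -> l \notin J -> pl g' k J = pl g k J - t0 * pl g k (tperm m l @: J).
Proof. by move=> mJ lJ; rewrite pl_elmx_op // mulNr. Qed.

Lemma elim_m0 : pl g' p0.+1 (m |: seg) = 0.
Proof.
have lm : l \notin m |: seg by rewrite !inE negb_or eq_sym mnl.
rewrite diff ?setU11 // swap_exch ?setU11 // setU1K // /t0 divfK ?subrr //.
Qed.

(** Only sets with m and without l change. If the first negative minor is at J = m + A, its sign
    makes the two sides of three-term relations disagree, which forces zeros one level down; they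
    exclude every j that could be split off the positive minor at l + A. *)
Lemma elim_fin : tnn g'.
Proof.
move=> k J; have [/andP[mJ lJ]|] := boolP ((m \in J) && (l \notin J)); last first.
  by rewrite negb_and negbK => H; rewrite same.
elim: k J mJ lJ => [|k IH] J mJ lJ.
  rewrite diff // (_ : pl g 0 (tperm m l @: J) = 0) ?mulr0 ?subr0 //.
  rewrite pl0 (_ : (_ == _) = false) //; apply/negbTE/set0Pn.
  by exists (tperm m l m); apply: imset_f.
have {}IH J' : 0 <= pl g' k J'.
  have [/andP[mJ' lJ']|] := boolP ((m \in J') && (l \notin J')); first exact: IH.
  by rewrite negb_and negbK => H; rewrite same.
have [A [JA mA]] : exists A, J = m |: A /\ m \notin A.
  by exists (J :\ m); rewrite setD1K // setD11.
have lA : l \notin A by move: lJ; rewrite JA !inE negb_or => /andP[].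
have sJ : tperm m l @: J = l |: A by rewrite swap_exch // JA setU1K.
have [kp|pk] := leqP k.+1 p0.+1.
  rewrite diff // sJ {1}JA.
  move: kp; rewrite leq_eqVlt => /orP[/eqP e|kp].
    rewrite e; have [es|ns] := eqVneq A seg.
      by rewrite es /t0 divfK // subrr.
    have -> : pl g p0.+1 (l |: A) = 0.
      by apply/eqP; apply: contraNT ns => /(supp_p0S lA lseg) ->.
    by rewrite mulr0 subr0 tg.
  have -> : pl g k.+1 (l |: A) = 0; last by rewrite mulr0 subr0 tg.
  rewrite ltnS in kp; apply/eqP; apply/negPn/negP=> /(small_support kp)/setP/(_ l).
  by rewrite setU11 inE; move: p0l; lia.
rewrite leNgt; apply/negP=> N.
have Jl : 0 < pl g k.+1 (l |: A).
  apply: tnn_gt0 => //; apply/negP=> /eqP e; move: N.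
  by rewrite diff // sJ e mulr0 subr0 ltNge tg.
have Jl' : pl g' k.+1 (l |: A) = pl g k.+1 (l |: A) by rewrite same // setU11 orbT.
have sub_lt a : a \in A -> (a != l) && (a != m).
  by move=> aA; apply/andP; split; [apply: contraNneq lA|apply: contraNneq mA] => <-.
(* For a < l the left side of the relation is at most 0, since it contains the negative minor at J,
   while the right side is a sum of nonnegative terms. *)
have low a : a \in A -> (a < l)%N ->
  [/\ pl g' k (l |: A :\ a) = 0 & pl g' k A * pl g' k.+1 (l |: (m |: A :\ a)) = 0].
  move=> aA al; pose E := A :\ a.
  have aE : a \notin E by rewrite setD11.
  have lE : l \notin E by rewrite !inE negb_and (negPf lA) orbT.
  have mE : m \notin E by rewrite !inE negb_and (negPf mA) orbT.
  have lm : (a < l < m)%N by rewrite al ml ltnSn.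
  have := three_term g' k lm aE lE mE.
  have -> : a |: (m |: E) = J by rewrite setUCA setD1K // -JA.
  have -> : a |: (l |: E) = l |: A by rewrite setUCA setD1K.
  rewrite [a |: E]setD1K //.
  have P1 : 0 <= pl g' k A * pl g' k.+1 (l |: (m |: E)).
    by rewrite mulr_ge0 // same ?setU11 ?orbT.
  have P2 : 0 <= pl g' k (m |: E) * pl g' k.+1 (l |: A).
    by rewrite mulr_ge0 // Jl' ltW.
  have P3 := IH (l |: E); move: P1 P2 P3 N; rewrite -/E.
  move: (pl g' k (l |: E)) (pl g' k.+1 J) (_ * pl g' k.+1 (l |: (m |: E))) (_ * pl g' k.+1 (l |: A)).
  move=> x1 x2 x3 x4 P1 P2 P3 N e.
  have e1 : x1 * x2 = 0.
    by apply/eqP; rewrite eq_le mulr_ge0_le0 ?(ltW N) // e addr_ge0.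
  move/eqP: (e1); rewrite mulf_eq0 (lt_eqF N) orbF => /eqP ->; split=> //.
  by apply/eqP; rewrite eq_le P1 andbT -e1 e lerDl.
have [a aA /andP[al Za]] : exists2 a, a \in A & (a < l)%N && (pl g' k.+1 (l |: (m |: A :\ a)) != 0).
  apply/exists_inP; apply: contraT; rewrite negb_exists_in => /forall_inP HA.
  have := @incidence F n g' p0.+1 k.+1 seg (l |: J) (ltnW pk).
  rewrite big_setU1 //= setU1K // big1 ?addr0 => [|z zJ].
    move/eqP; rewrite !mulf_eq0 (negPf (sgn_neq0 _ _ _)) (lt_eqF N) orbF /=.
    rewrite /vec (negPf lseg) mulf_eq0 (negPf (sgn_neq0 _ _ _)) /=.
    by rewrite same ?setU11 ?orbT // (negPf l0).
  rewrite /vec; case: ifP => _; first by rewrite mul0r mulr0.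
  have [->|zm] := eqVneq z m; first by rewrite elim_m0 mulr0 mul0r mulr0.
  have zA : z \in A by move: zJ; rewrite JA !inE (negPf zm).
  have /andP[zl _] := sub_lt z zA.
  have [zlt|lz] := ltnP z l; last first.
    have mz : (m < z)%N by apply: ord_hi_lt.
    rewrite same ?above_m // ?mulr0 ?mul0r ?mulr0 //.
    by rewrite !inE negb_or eq_sym zm mseg.
  have := HA z zA; rewrite zlt /= negbK => /eqP e0.
  have -> : (l |: J) :\ z = l |: (m |: A :\ z).
    apply/setP=> y; rewrite JA !inE; case: (eqVneq y z) => [->|//].
    by rewrite (negPf zl) (negPf zm).
  by rewrite e0 !mulr0.
have A0 : pl g' k A = 0.
  by have [_ /eqP] := low a aA al; rewrite mulf_eq0 (negPf Za) orbF => /eqP.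
have H : pl g' k.+1 (l |: A) != 0 by rewrite Jl' gt_eqF.
have [j jJ] := pl_sub H; rewrite mulf_eq0 negb_or => /andP[_].
have [->|jl] := eqVneq j l; first by rewrite setU1K // A0 eqxx.
have jA : j \in A by move: jJ; rewrite !inE (negPf jl).
have /andP[_ jm] := sub_lt j jA.
have -> : (l |: A) :\ j = l |: A :\ j.
  by apply/setP=> y; rewrite !inE; case: (eqVneq y j) => [->|//]; rewrite (negPf jl).
have [jlt|lj] := ltnP j l; first by have [-> _] := low j jA jlt; rewrite eqxx.
pose E := A :\ j; rewrite -/E => lE0.
have jE : j \notin E by rewrite setD11.
have lE : l \notin E by rewrite !inE negb_and (negPf lA) orbT.
have mE : m \notin E by rewrite !inE negb_and (negPf mA) orbT.
(* For j > m the relation for l < m < j equates a nonnegative product with a negative one. *)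
have lmj : (l < m < j)%N by rewrite ml ltnSn ord_hi_lt.
have := three_term g' k lmj lE mE jE.
have -> : l |: (j |: E) = l |: A by rewrite setD1K.
have -> : m |: (j |: E) = J by rewrite setD1K // -JA.
rewrite [j |: E]setD1K // A0 mul0r addr0 => e.
have : 0 <= pl g' k (m |: E) * pl g' k.+1 (l |: A) by rewrite mulr_ge0 // Jl' ltW.
rewrite e leNgt => /negP; apply; rewrite nmulr_llt0 //.
by rewrite lt_def lE0 IH.
Qed.

End CaseFinite.

End Elimination.

Variant elim_spec g w (i : 'I_n.-1) : Prop :=
| ElimFinite t of 0 < t & tnn (elmx (ord_hi i) (ord_lo i) (- t) *m g)
   & cell (@hval n) (elmx (ord_hi i) (ord_lo i) (- t) *m g) (w * tperm (ord_hi i) (ord_lo i))%g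
| ElimInfinite of (forall k J, ord_lo i \in J -> ord_hi i \notin J -> pl g k J = 0)
   & tnn (sdot F (ord_lo i) (ord_hi i) *m g)
   & cell (@hval n) (sdot F (ord_lo i) (ord_hi i) *m g) (w * tperm (ord_hi i) (ord_lo i))%g.

(** The cell u of the stripped matrix is found indirectly: restoring the factor must give w, so u =
    s w if s is an ascent of u. Otherwise u = w, which the coordinate made to vanish refutes. *)
Lemma elimination g w : g \in unitmx -> tnn g -> cell (@hval n) g w -> w != 1%g ->
  exists2 i, bef w (ord_hi i) (ord_lo i) & elim_spec g w i.
Proof.
move=> gU tg cg /first_descent[p0 [i [wfix p0w wp0 b]]]; exists i => //.
set p := ord_hi i in wp0 b *; set q := ord_lo i in b *.
have pq : adj p q := adj_lohi i; have qp := adj_sym pq; have npq := adj_neq pq.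
have hI := @hval_inj n; have hpq : hval p = (hval q).+1 by [].
have tot u : bef u p q = ~~ bef u q p by apply: bef_total.
have anti u g' : cell (@hval n) g' u -> cell_le (@hval n) g' w -> cell_le (@hval n) g u -> u = w.
  move=> cu lw lu; apply: sset_inj => k _; apply: (gle_anti hI).
    exact: (cell_le_uniq hI cu lw).
  exact: (cell_le_uniq hI cg lu).
have seg1 : sset w p0.+1 = p |: sset w p0 by rewrite ssetS_ord wp0.
have kn : (p0.+1 <= n)%N by exact: ltn_ord.
have [l0|l0] := eqVneq (pl g p0.+1 (q |: sset w p0)) 0; last first.
  have t0 : 0 < pl g p0.+1 (p |: sset w p0) / pl g p0.+1 (q |: sset w p0).
    by rewrite divr_gt0 ?tnn_gt0 // -seg1; apply: (proj1 cg).
  apply: (ElimFinite t0); first exact: (elim_fin tg cg wfix p0w wp0 l0).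
  rewrite -/p -/q in t0 *; set t := (X in elmx p q (- X)) in t0 *; set g' := elmx p q (- t) *m g.
  have gg' : g = elmx p q t *m g' by rewrite elmxNK.
  have [u cu] : exists u, cell (@hval n) g' u.
    by apply: cell_exists => //; rewrite unitmx_mul elmx_unit.
  have [bu|] := boolP (bef u q p).
    have := cell_raise hI pq hpq bu (lt0r_neq0 t0) cu; rewrite -gg' => /(cell_uniq hI cg) ->.
    by rewrite mulgtK.
  rewrite -tot => bu.
  have uw : u = w.
    apply: (anti _ _ cu); first by apply: cell_le_raise => //; exact: (proj2 cg).
    by rewrite gg'; apply: cell_le_raise => //; exact: (proj2 cu).
  have := (proj1 cu) p0.+1 kn; rewrite uw seg1.
  by rewrite (elim_m0 wfix p0w wp0 l0) eqxx.
have v0 := elim_inf tg cg wfix p0w wp0 l0; rewrite -/p -/q in v0.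
apply: ElimInfinite => //.
  move=> k J; rewrite -/p -/q pl_sdot // tpermC; case: ifP => [/andP[pJ qJ]|_].
    by rewrite v0 ?mulr0 // mem_swap ?tpermR ?tpermL.
  by rewrite mul1r tg.
rewrite -/p -/q; set g' := sdot F q p *m g.
have gg' : g = sdot F p q *m g' by rewrite sdotK // eq_sym.
have [u cu] : exists u, cell (@hval n) g' u.
  by apply: cell_exists => //; rewrite unitmx_mul sdot_unit // eq_sym.
have [bu|] := boolP (bef u q p).
  have [+ _] := cell_sdot hI pq hpq bu cu; rewrite -gg' => /(cell_uniq hI cg) ->.
  by rewrite mulgtK.
rewrite -tot => bu.
have uw : u = w.
  apply: (anti _ _ cu).
    by have [_] := cell_le_sdot hI pq hpq b (proj2 cg).
  by rewrite gg'; have [] := cell_le_sdot hI pq hpq bu (proj2 cu).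
have := (proj1 cu) p0.+1 kn; rewrite uw seg1 /g' pl_sdot //.
rewrite tpermC swap_exch ?setU11 //; last first.
  rewrite !inE negb_or eq_sym npq mem_sset -leqNgt.
  by move: b; rewrite /bef -wp0 permK => /ltnW.
rewrite setU1K; last by rewrite -wp0 sset_notin.
by rewrite l0 mulr0 eqxx.
Qed.

Lemma hrev_lohi (i : 'I_n.-1) : @hrev n (ord_lo i) = (hrev (ord_hi i)).+1.
Proof. by rewrite /hrev /=; have := ltn_ord i; lia. Qed.

Theorem tnn_full v w g x k : g \in unitmx -> tnn g ->
  cell (@hval n) g w -> cell (@hrev n) g v -> ble v x -> ble x w -> (k <= n)%N ->
  0 < pl g k (sset x k).
Proof.
move: {2}(perm_length w).+1 (ltnSn (perm_length w)) => N.
elim: N v w g x k => // N IH v w g x k wN gU tg cw cv vx xw kn.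
apply: tnn_gt0 => //.
have [w1|w1] := eqVneq w 1%g.
  by move: xw; rewrite w1 => /ble1 ->; rewrite -w1; apply: (proj1 cw).
have [i b es] := elimination gU tg cw w1.
set p := ord_hi i in b es *; set q := ord_lo i in b es *.
have pq : adj p q := adj_lohi i; have qp := adj_sym pq; have npq := adj_neq pq.
have pqE : p = q.+1 :> nat by [].
have hI := @hval_inj n; have hpq : hval p = (hval q).+1 by [].
have rI := @hrev_inj n; have hqp : hrev q = (hrev p).+1 := hrev_lohi i.
have tot u : bef u p q = ~~ bef u q p by apply: bef_total.
have {wN} : (perm_length (w * tperm p q)%g < N)%N.
  by have := perm_length_desc pqE b; lia.
set w' := (w * tperm p q)%g => w'N.
have both : bef x p q -> ~~ ((p \in sset x k) && (q \notin sset x k)) ->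
     (p \in sset x k) = (q \in sset x k).
  move=> bx; have := bef_mem (k := k) bx.
  by case: (p \in _) => //=; case: (q \in _) => // /(_ isT).
have swx : sset (x * tperm p q)%g k = tperm p q @: sset x k by rewrite sset_mul.
case: es => [t t0 tg' cg'|v0 tg' cg'].
  rewrite -/p -/q -/w' in tg' cg'; set g' := elmx p q (- t) *m g in tg' cg'.
  have g'U : g' \in unitmx by rewrite unitmx_mul elmx_unit.
  have gg' : g = elmx p q t *m g' by rewrite elmxNK.
  have cv' : cell (@hrev n) g' v by exact: cell_lower.
  have ge J : pl g' k J != 0 -> pl g k J != 0.
    move=> H; rewrite gg' pl_elmx //; apply: lt0r_neq0; apply: ltr_pwDl; first exact: tnn_gt0.
    by rewrite mulr_ge0 ?ler0n // mulr_ge0 // ltW.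
  have [bx|] := boolP (bef x q p).
    by apply/ge/lt0r_neq0/(IH v w') => //; apply: ble_swapr.
  rewrite -tot => bx; have x'w' : ble (x * tperm p q)%g w' by apply: ble_swap2.
  have [bv|] := boolP (bef v q p).
    have vx' : ble v (x * tperm p q)%g by apply: ble_swapr.
    have := IH v w' g' _ k w'N g'U tg' cg' cv' vx' x'w' kn; rewrite swx => H.
    have [/andP[px qx]|] := boolP ((p \in sset x k) && (q \notin sset x k)); last first.
      by move/(both bx)=> e; apply: ge; rewrite lt0r_neq0 //; move: H; rewrite swap_id.
    rewrite gg' pl_elmx_op //; apply: lt0r_neq0.
    by rewrite ltr_wpDl // mulr_gt0.
  (* Now the interval has to be lowered at both ends: x_i(1) moves the opposite cell to s v and
     keeps s w. If the set at x moves, the coordinates of [g1] at s x and of g at x are both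
     positive combinations of those of [g'] at x and s x. *)
  rewrite -tot => bv; set g1 := elmx q p 1 *m g'.
  have g1U : g1 \in unitmx by rewrite unitmx_mul elmx_unit // eq_sym.
  have tg1 : tnn g1 by apply: tnn_elmx.
  have cg1 : cell (@hval n) g1 w' by exact: cell_lower.
  have cv1 : cell (@hrev n) g1 (v * tperm p q)%g.
    by rewrite tpermC; apply: cell_raise => //; apply: oner_neq0.
  have vx1 : ble (v * tperm p q)%g (x * tperm p q)%g by apply: ble_swap2.
  have := IH _ w' g1 _ k w'N g1U tg1 cg1 cv1 vx1 x'w' kn; rewrite swx => H.
  have [/andP[px qx]|] := boolP ((p \in sset x k) && (q \notin sset x k)); last first.
    move/(both bx)=> e; apply: ge; rewrite lt0r_neq0 //; move: H; rewrite swap_id //.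
    by rewrite /g1 pl_elmx_id // e; case: (q \in _).
  move: H; rewrite /g1 pl_elmx_op ?mem_swap ?tpermL ?tpermR // (tpermC q) swapK mul1r.
  rewrite gg' pl_elmx_op // => H; apply/negP; rewrite paddr_eq0 // ?mulr_ge0 ?(ltW t0) //.
  rewrite mulf_eq0 (gt_eqF t0) /= => /andP[/eqP e1 /eqP e2].
  by move: H; rewrite e1 e2 addr0 ltxx.
rewrite -/p -/q -/w' in v0 tg' cg'; set g' := sdot F q p *m g in tg' cg'.
have g'U : g' \in unitmx by rewrite unitmx_mul sdot_unit // eq_sym.
(* Coordinates with q and without p vanish, but the coordinates at v do not; so q cannot precede p
   in v. *)
have bv : bef v p q.
  rewrite tot; apply/negP=> /bef_sset[l ln /andP[ql pl']].
  by have := (proj1 cv) l ln; rewrite v0 ?eqxx.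
have cv' : cell (@hrev n) g' (v * tperm p q)%g.
  by have [+ _] := cell_sdot rI qp hqp bv cv; rewrite tpermC.
(* An ascent of x is impossible: then v <= x <= s w, and the induction hypothesis at v would give g
   a nonzero coordinate with q and without p. *)
have [bx|] := boolP (bef x q p).
  have xw' : ble x w' by apply: ble_swapr.
  have [l ln /andP[pl' ql]] := bef_sset bv.
  have := IH _ w' g' v l w'N g'U tg' cg' cv' (ble_desc pqE bv) (ble_trans vx xw') ln.
  rewrite /g' pl_sdot // pl' ql /= tpermC v0 ?mulr0 ?ltxx // mem_swap ?tpermL ?tpermR //.
rewrite -tot => bx; have x'w' : ble (x * tperm p q)%g w' by apply: ble_swap2.
have vx1 : ble (v * tperm p q)%g (x * tperm p q)%g by apply: ble_swap2.
have := IH _ w' g' _ k w'N g'U tg' cg' cv' vx1 x'w' kn; rewrite swx.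
rewrite /g' pl_sdot // (tpermC q) swapK => /lt0r_neq0.
by rewrite mulf_eq0 negb_or => /andP[].
Qed.

End TotalNonnegativity.

(** * Bruhat decomposition, dual flags and the alternating sign matrix *)

Section Triangular.
Variables (F : numFieldType) (n : nat).
Implicit Types (J K E : {set 'I_n}) (g b M : 'M[F]_n) (i j p q : 'I_n) (t : F).
Implicit Types (u v w x : 'S_n) (h : 'I_n -> nat).

Lemma tri_mul h a b : injective h -> tri h a -> tri h b -> tri h (a *m b).
Proof.
move=> hI [a0 ad] [b0 bd]; split=> [i j ji|i]; rewrite mxE.
  rewrite big1 // => k _; have [ki|ik] := ltnP (h k) (h i); first by rewrite a0 ?mul0r.
  by rewrite b0 ?mulr0 // (leq_trans ji).
rewrite (bigD1 i) //= big1 ?addr0 ?mulf_neq0 // => k; rewrite -(inj_eq hI) neq_ltn.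
by case/orP=> H; [rewrite a0 ?mul0r|rewrite b0 ?mulr0].
Qed.

Lemma tri1 (h : 'I_n -> nat) : tri h (1%:M : 'M[F]_n).
Proof.
split=> [i j ij|i]; rewrite mxE ?eqxx ?oner_neq0 //.
by case: (eqVneq i j) ij => [->|//]; rewrite ltnn.
Qed.

Lemma tri_inv h b : injective h -> b \in unitmx -> tri h b -> tri h (invmx b).
Proof.
move=> hI bU [b0 bd]; set c := invmx b; have cb : c *m b = 1%:M by rewrite mulVmx.
have z N i j : (h j < N)%N -> (h j < h i)%N -> c i j = 0.
  elim: N i j => // N IH i j jN ji.
  have : (c *m b) i j = 0.
    by rewrite cb mxE (_ : (i == j) = false) //; apply/negbTE; rewrite -(inj_eq hI) gtn_eqF.
  rewrite mxE (bigD1 j) //= big1 ?addr0 => [/eqP|k].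
    by rewrite mulf_eq0 (negPf (bd j)) orbF => /eqP.
  rewrite -(inj_eq hI) neq_ltn => /orP[] H; last by rewrite b0 ?mulr0.
  by rewrite IH ?mul0r //; [exact: leq_trans H _|exact: ltn_trans H ji].
split=> [i j|i]; first exact: (z _ _ _ (ltnSn _)).
have : (c *m b) i i = 1 by rewrite cb mxE eqxx.
rewrite mxE (bigD1 i) //= big1 ?addr0 => [e|k].
  by have := oner_neq0 F; rewrite -e mulf_eq0 negb_or => /andP[].
rewrite -(inj_eq hI) neq_ltn => /orP[] H; last by rewrite b0 ?mulr0.
by rewrite (z _ _ _ (ltnSn _)) ?mul0r.
Qed.

Definition mono M w : Prop :=
  exists2 e : 'I_n -> F, (forall a, e a != 0) & forall j a, M j a = (j == w a)%:R * e a.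

(** The sign of column a counts the larger values at earlier positions, which makes every
    left-justified minor 0 or 1; see [perm_lift_plift]. *)
Definition plift w : 'M[F]_n := \matrix_(j, a) ((j == w a)%:R * sgn F (sset w a.+1) (w a)).

Lemma mono_plift w : mono (plift w) w.
Proof. by exists (fun a : 'I_n => sgn F (sset w a.+1) (w a)) => [a|j a]; rewrite ?sgn_neq0 ?mxE. Qed.

Lemma pl_plift w k J : (k <= n)%N -> pl (plift w) k J = (J == sset w k)%:R.
Proof.
elim: k J => [|k IH] J kn; first by rewrite pl0 sset0.
pose a := Ordinal kn.
have colE j : vcol (plift w) k j = (j == w a)%:R * sgn F (sset w a.+1) (w a).
  by rewrite -[LHS]/(vcol (plift w) a j) vcolE mxE.
have Sa : sset w k.+1 = w a |: sset w k by rewrite -(ssetS_ord w a).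
have na : w a \notin sset w k := sset_notin w a.
rewrite plS /wedge.
have [aJ|aJ] := boolP (w a \in J); last first.
  rewrite big1 => [|j jJ]; last first.
    rewrite colE (_ : (j == w a) = false) ?mul0r ?mul0r ?mulr0 //.
    by apply/negbTE; apply: contraNneq aJ => <-.
  by rewrite (_ : (J == _) = false) //; apply/negbTE; apply: contraNneq aJ => ->; rewrite Sa setU11.
rewrite (bigD1 (w a)) //= big1 ?addr0 => [|j /andP[_ /negPf ja]]; last first.
  by rewrite colE ja !mul0r mulr0.
rewrite colE eqxx mul1r (IH _ (ltnW kn)).
have -> : (J == sset w k.+1) = (J :\ w a == sset w k).
  apply/eqP/eqP => [->|e]; first by rewrite Sa setU1K.
  by rewrite Sa -e setD1K.
case: eqP => [e|_]; last by rewrite !mulr0.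
by rewrite mulr1 /= Sa -e setD1K // sgnsq.
Qed.

Lemma plift_unit w : plift w \in unitmx.
Proof.
by rewrite unitmxE unitfE -pl_setT pl_plift // ssetn eqxx oner_neq0.
Qed.

Lemma mulmx_mono b M w j a : (forall j a, M j a = (j == w a)%:R * M (w a) a) ->
  (b *m M) j a = b j (w a) * M (w a) a.
Proof.
move=> HM; rewrite mxE (bigD1 (w a)) //= big1 ?addr0 // => k /negPf ka.
by rewrite HM ka mul0r mulr0.
Qed.

Lemma monoE M w : mono M w -> (forall j a, M j a = (j == w a)%:R * M (w a) a).
Proof. by case=> e _ H j a; rewrite !H eqxx mul1r. Qed.

Lemma leading_mono h b M w : tri h b -> mono M w -> leading h (b *m M) w.
Proof.
move=> [b0 bd] mM; have HM := monoE mM; case: mM => e e0 ME.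
split=> [a j lt|a]; rewrite (mulmx_mono _ _ _ HM); first by rewrite b0 ?mul0r.
by rewrite mulf_neq0 ?bd // ME eqxx mul1r.
Qed.

(** Bruhat decomposition: in leading form, column a becomes column w a of the left factor, up to the
    sign of the pivot. *)
Lemma cell_triP h g w : injective h ->
  cell h g w <-> exists b c, [/\ tri h b, tri (@hval n) c & g = b *m plift w *m c].
Proof.
move=> hI; split; last first.
  move=> [b [c [tb tc ->]]]; apply/cell_mulr => //; apply: leading_cell => //.
  by apply: leading_mono => //; apply: mono_plift.
move=> /(cell_leading hI)[c tc [l1 l2]].
have cU := tri_unit tc; set G := g *m c in l1 l2.
pose b := \matrix_(j, k) (G j (w^-1%g k) * sgn F (sset w (w^-1%g k).+1) k) : 'M[F]_n.
exists b, (invmx c); split; last 1 first.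
- have -> : b *m plift w = G; last by rewrite /G mulmxK.
  apply/matrixP=> j a; rewrite (mulmx_mono _ _ _ (monoE (mono_plift w))).
  by rewrite !mxE permK eqxx mul1r -mulrA sgnsq mulr1.
- split=> [j k jk|j]; rewrite mxE.
    by rewrite l1 ?mul0r // permKV.
  by rewrite mulf_neq0 ?sgn_neq0 // -{1}(permKV w j) l2.
- exact: tri_inv (@hval_inj n) cU tc.
Qed.

Lemma mono_mulr_plift M w : mono M w -> exists2 c, tri (@hval n) c & M *m c = plift w.
Proof.
case=> e e0 ME; exists (diag_mx (\row_a (sgn F (sset w a.+1) (w a) / e a))).
  split=> [i j ij|i]; rewrite !mxE; last by rewrite eqxx mulr1n mulf_neq0 ?sgn_neq0 ?invr_eq0.
  by rewrite (_ : (i == j) = false) //; apply/negbTE; rewrite -val_eqE gtn_eqF.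
apply/matrixP=> j a; rewrite mul_mx_diag !mxE ME -!mulrA; congr (_ * _).
by rewrite mulrCA mulfV ?mulr1.
Qed.

Definition revmx : 'M[F]_n := \matrix_(i, j) (i == rev_ord j)%:R.

Lemma mulmx_rev g i j : (g *m revmx) i j = g i (rev_ord j).
Proof.
rewrite mxE (bigD1 (rev_ord j)) //= big1 ?addr0 => [|k /negPf kj]; rewrite mxE ?eqxx ?mulr1 //.
by rewrite kj mulr0.
Qed.

Lemma mul_revmx g i j : (revmx *m g) i j = g (rev_ord i) j.
Proof.
rewrite mxE (bigD1 (rev_ord i)) //= big1 ?addr0 => [|k ki]; rewrite mxE.
  by rewrite rev_ordK eqxx mul1r.
by rewrite (_ : (i == _) = false) ?mul0r //; apply: contraNF ki => /eqP ->; rewrite rev_ordK.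
Qed.

Lemma revmxK : revmx *m revmx = 1%:M.
Proof. by apply/matrixP=> i j; rewrite mulmx_rev !mxE rev_ordK. Qed.

Lemma trmx_rev : revmx^T = revmx.
Proof.
by apply/matrixP=> i j; rewrite !mxE; congr (_%:R); rewrite -(inj_eq rev_ord_inj) rev_ordK eq_sym.
Qed.

(** The columns of the inverse transpose are the dual basis; in reversed order, the first k of them
    span the annihilator of the first n - k columns of g. *)
Definition dualmx g : 'M[F]_n := (invmx g)^T *m revmx.

Lemma invmxM (a b : 'M[F]_n) : a \in unitmx -> b \in unitmx ->
  invmx (a *m b) = invmx b *m invmx a.
Proof.
move=> aU bU; have abU : a *m b \in unitmx by rewrite unitmx_mul aU.
by rewrite -[RHS](mulmxK abU) -!mulmxA (mulKmx aU) (mulKmx bU).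
Qed.

Lemma revmx_unit : revmx \in unitmx.
Proof. by case: (mulmx1_unit revmxK). Qed.

Lemma invmx_rev : invmx revmx = revmx.
Proof. by rewrite -[LHS]mul1mx -revmxK mulmxK // revmx_unit. Qed.

Lemma conj_mulmx_rev g (x : 'M[F]_n) : g \in unitmx ->
  invmx (g *m revmx) *m x *m (g *m revmx) = revmx *m (invmx g *m x *m g) *m revmx.
Proof. by move=> gU; rewrite invmxM ?revmx_unit // invmx_rev !mulmxA. Qed.

Lemma rev_conjK g : revmx *m (revmx *m g *m revmx) *m revmx = g.
Proof. by rewrite !mulmxA revmxK mul1mx -mulmxA revmxK mulmx1. Qed.

Lemma dualmx_unit g : g \in unitmx -> dualmx g \in unitmx.
Proof. by move=> gU; rewrite unitmx_mul unitmx_tr unitmx_inv gU revmx_unit. Qed.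

Lemma dualmx_mulr g b : g \in unitmx -> b \in unitmx ->
  dualmx (g *m b) = dualmx g *m (revmx *m (invmx b)^T *m revmx).
Proof.
move=> gU bU; rewrite /dualmx invmxM // trmx_mul !mulmxA; congr (_ *m _); congr (_ *m _).
by rewrite -mulmxA revmxK mulmx1.
Qed.

Lemma trmx_dualmx g : g \in unitmx -> (dualmx g)^T *m g = revmx.
Proof. by move=> gU; rewrite trmx_mul trmxK trmx_rev -mulmxA mulVmx // mulmx1. Qed.

Lemma dualmxM a g : a \in unitmx -> g \in unitmx ->
  dualmx (a *m g) = (invmx a)^T *m dualmx g.
Proof. by move=> aU gU; rewrite /dualmx invmxM // trmx_mul mulmxA. Qed.

Definition flip (h h' : 'I_n -> nat) : Prop := forall i j, (h' j < h' i)%N = (h i < h j)%N.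

Lemma flip_vr : flip (@hval n) (@hrev n).
Proof. by move=> i j; rewrite /hval /hrev; have := ltn_ord i; have := ltn_ord j; lia. Qed.

Lemma flip_rv : flip (@hrev n) (@hval n).
Proof. by move=> i j; rewrite /hval /hrev; have := ltn_ord i; have := ltn_ord j; lia. Qed.

Lemma tri_tr h h' b : flip h h' -> tri h b -> tri h' b^T.
Proof.
by move=> fl [b0 bd]; split=> [i j|i]; rewrite mxE; [rewrite fl => /b0|exact: bd].
Qed.

Lemma tri_unit_gen h b : injective h -> tri h b -> b \in unitmx.
Proof.
move=> hI tb; rewrite unitmxE unitfE -pl_setT.
have : leading h (b *m plift 1%g) 1%g by apply: leading_mono => //; apply: mono_plift.
move/(leading_cell hI) => [/(_ n (leqnn n))]; rewrite ssetn !pl_setT det_mulmx.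
by rewrite mulf_eq0 negb_or => /andP[].
Qed.

Lemma plift_orth w : (invmx (plift w))^T = plift w.
Proof.
have e : (plift w)^T *m plift w = 1%:M.
  apply/matrixP=> i j; rewrite (mulmx_mono _ _ _ (monoE (mono_plift w))) !mxE eqxx mul1r.
  rewrite (inj_eq perm_inj) eq_sym; case: (eqVneq i j) => [->|_]; rewrite ?mul0r //.
  by rewrite mul1r sgnsq.
have -> : invmx (plift w) = (plift w)^T; last by rewrite trmxK.
by rewrite -[LHS]mul1mx -e mulmxK ?plift_unit.
Qed.

Definition Dm : 'M[F]_n := diag_mx (\row_i (-1) ^+ i).

Lemma DmE g i j : (Dm *m g) i j = (-1) ^+ i * g i j.
Proof. by rewrite mul_diag_mx !mxE. Qed.

Lemma DmK g : Dm *m (Dm *m g) = g.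
Proof. by apply/matrixP=> i j; rewrite !DmE mulrA -expr2 sqrr_sign mul1r. Qed.

Lemma Dm_unit : Dm \in unitmx.
Proof. by have /mulmx1_unit[] : Dm *m Dm = 1%:M by rewrite -{2}(mulmx1 Dm) DmK. Qed.

Lemma tri_Dm h b : tri h b -> tri h (Dm *m b).
Proof.
by move=> [b0 bd]; split=> [i j|i]; rewrite DmE; [move/b0=> ->; rewrite mulr0|rewrite mulf_neq0 ?signr_eq0].
Qed.

(** Inverse transposition fixes [plift w] and exchanges the two triangular types; the final [revmx]
    multiplies w by w_0 and makes the right factor upper triangular again. *)
Lemma dual_tri h h' g b c w : injective h -> flip h h' -> tri h b -> tri (@hval n) c ->
  g = b *m plift w *m c ->
  exists b' M c', [/\ tri h' b', mono M (pmul w (longest n)), tri (@hval n) c'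
     & dualmx g = b' *m M *m c'].
Proof.
move=> hI fl tb tc ->.
have bU := tri_unit_gen hI tb; have cU := tri_unit tc; have pU := plift_unit w.
exists (invmx b)^T, (plift w *m revmx), (revmx *m (invmx c)^T *m revmx); split.
- exact: tri_tr fl (tri_inv hI bU tb).
- have [e e0 eE] := mono_plift w; exists (fun a => e (rev_ord a)) => // j a.
  by rewrite mulmx_rev eE pmulE permE.
- have := tri_tr flip_vr (tri_inv (@hval_inj n) cU tc); set d := (invmx c)^T => -[d0 dd].
  split=> [i j ij|i]; rewrite mulmx_rev mul_revmx; last exact: dd.
  apply: d0; rewrite /hrev /=; move: ij; rewrite /hval.
  by have := ltn_ord i; have := ltn_ord j; lia.
rewrite dualmxM ?unitmx_mul ?bU // invmxM // trmx_mul plift_orth.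
rewrite /dualmx -!mulmxA; congr (_ *m (_ *m _)).
by rewrite !mulmxA revmxK mul1mx.
Qed.

Lemma cell_dualmx h h' g w : injective h -> injective h' -> flip h h' ->
  cell h g w -> cell h' (dualmx g) (pmul w (longest n)).
Proof.
move=> hI hI' fl /(cell_triP _ _ hI)[b [d [tb td e]]].
have [b' [M [c' [tb' mM tc' ->]]]] := dual_tri hI fl tb td e.
by apply/cell_mulr => //; apply: leading_cell => //; apply: leading_mono.
Qed.

Lemma dualmxK g : g \in unitmx -> dualmx (dualmx g) = g.
Proof.
move=> gU; rewrite {1}/dualmx /dualmx invmxM ?revmx_unit ?unitmx_tr ?unitmx_inv // invmx_rev.
by rewrite trmx_mul -trmx_inv trmxK invmxK trmx_rev -mulmxA revmxK mulmx1.
Qed.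

Lemma det_fix g : (0 < n)%N -> g \in unitmx ->
  exists t : 'rV[F]_n, (forall i, t 0 i != 0) /\ \det (g *m diag_mx t) = 1.
Proof.
move=> n0 gU; pose i0 := Ordinal n0.
exists (\row_i (if i == i0 then (\det g)^-1 else 1)).
have d0 : \det g != 0 by move: gU; rewrite unitmxE unitfE.
split=> [i|]; first by rewrite mxE; case: ifP => _; rewrite ?invr_eq0 ?oner_neq0.
rewrite det_mulmx det_diag (bigD1 i0) //= mxE eqxx big1 ?mulr1 ?mulfV // => i /negPf ii.
by rewrite mxE ii.
Qed.

Lemma tri_diag h (t : 'rV[F]_n) : (forall i, t 0 i != 0) -> tri h (diag_mx t).
Proof.
move=> t0; split=> [i j ij|i]; rewrite mxE ?eqxx ?mulr1n //.
by case: (eqVneq i j) ij => [->|_]; rewrite ?ltnn ?mulr0n.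
Qed.

Lemma cell_dual h h' g c w : injective h -> injective h' -> flip h h' ->
  tri (@hval n) c -> cell h g w ->
  cell h' (Dm *m dualmx g *m c) (pmul w (longest n)).
Proof.
move=> hI hI' fl tc /(cell_triP _ _ hI)[b [d [tb td e]]].
have [b' [M [c' [tb' mM tc' ->]]]] := dual_tri hI fl tb td e.
rewrite !mulmxA; apply/cell_mulr => //; apply/cell_mulr => //.
by apply: leading_cell => //; apply: leading_mono => //; apply: tri_Dm.
Qed.

Lemma elmx_inv p q t : p != q -> invmx (elmx p q t) = elmx p q (- t).
Proof.
move=> pq; have U := elmx_unit t pq.
by rewrite -[RHS]mulmx1 -(mulmxV U) elmxK.
Qed.

Lemma elmx_tr p q t : (elmx p q t)^T = elmx q p t.
Proof. by rewrite linearD /= trmx1 linearZ /= trmx_delta. Qed.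

Lemma dualmx_elmx p q t g : p != q -> g \in unitmx ->
  dualmx (elmx p q t *m g) = elmx q p (- t) *m dualmx g.
Proof. by move=> pq gU; rewrite dualmxM ?elmx_unit // elmx_inv // elmx_tr. Qed.

Lemma Dm_elmx p q t g : adj p q -> Dm *m (elmx p q t *m g) = elmx p q (- t) *m (Dm *m g).
Proof.
move=> pq; apply/matrixP=> i j; rewrite !(DmE, elmxE) mulrDr; congr (_ + _).
case: (eqVneq i p) => [->|_]; last by rewrite !mul0r mulr0.
by rewrite !mul1r; case: pq => ->; rewrite exprS; ring.
Qed.

(** Inverse transposition and D each change the sign of the parameter, so every factor [elmx p q t]
    becomes [elmx q p t]. *)
Lemma Dm_dual_sdot p q g : adj p q -> g \in unitmx ->
  Dm *m dualmx (sdot F p q *m g) = sdot F q p *m (Dm *m dualmx g).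
Proof.
move=> pq gU; have qp := adj_sym pq; have npq := adj_neq pq; have nqp := adj_neq qp.
rewrite /sdot -!mulmxA !dualmx_elmx ?unitmx_mul ?elmx_unit //.
by rewrite !Dm_elmx ?opprK.
Qed.

End Triangular.

(** * Reduced words and lengths *)

Section Words.
Variable n : nat.
Implicit Types (w : 'S_n).

Lemma perm_length1 : perm_length (1%g : 'S_n) = 0%N.
Proof.
apply/eqP; rewrite cards_eq0; apply/eqP/setP=> -[a b]; rewrite !inE !perm1 /=.
by case: ltngtP.
Qed.

Lemma word_perm_cons i (s : seq 'I_n.-1) :
  word_perm (i :: s) = (word_perm s * tperm (ord_hi i) (ord_lo i))%g.
Proof. by rewrite /= /pmul /sref tpermC. Qed.

Lemma perm_length_word (s : seq 'I_n.-1) : (perm_length (word_perm s) <= size s)%N.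
Proof.
elim: s => [|i s IH]; first by rewrite perm_length1.
rewrite word_perm_cons; apply: leq_trans (perm_length_leS _ _) _ => //.
Qed.

Lemma reduced_word_length s w : word_perm s = w -> size s = perm_length w -> reduced_word s w.
Proof. by move=> sw e; split=> // s' e'; rewrite e -e' perm_length_word. Qed.

Lemma longestM : (longest n * longest n = 1)%g.
Proof. by apply/permP=> x; rewrite permM !permE rev_ordK. Qed.

(** Since w_0 reverses values, a left descent of w_0 w is a left ascent of w at the reversed
    index. *)
Lemma ascent w : w != longest n -> exists i : 'I_n.-1, bef w (ord_lo i) (ord_hi i).
Proof.
move=> wl; have : (w * longest n)%g != 1%g.
  apply: contraNneq wl => e; apply/eqP; apply: (mulIg (longest n)).
  by rewrite e longestM.
move=> /first_descent[_ [i [_ _ _ b]]].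
exists (rev_ord i); move: b; rewrite /bef invMg !permM.
have e (x y : 'I_n) : y = rev_ord x -> (longest n)^-1%g x = y.
  by move=> ->; apply: (@perm_inj _ (longest n)); rewrite permKV permE rev_ordK.
rewrite (e _ (ord_lo (rev_ord i))) ?(e _ (ord_hi (rev_ord i))) //;
  apply: val_inj => /=; have := ltn_ord i; lia.
Qed.

Lemma bef_longest w (p q : 'I_n) : bef (pmul w (longest n)) p q = bef w q p.
Proof.
rewrite /bef /pmul invMg !permM.
have e (x : 'I_n) : (longest n)^-1%g x = rev_ord x.
  by apply: (@perm_inj _ (longest n)); rewrite permKV permE rev_ordK.
rewrite !e /=; move: (w^-1%g p) (w^-1%g q) => a b.
by have := ltn_ord a; have := ltn_ord b; lia.
Qed.

Lemma perm_length_le w : (perm_length w <= n * n)%N.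
Proof. by rewrite -[X in (_ <= X)%N](_ : #|{: 'I_n * 'I_n}| = _) ?max_card // card_prod card_ord. Qed.

End Words.

(** * Existence, factorization and perturbation of nonnegative flags *)

Section TnnCells.
Variables (F : realFieldType) (n : nat).
Implicit Types (J K E : {set 'I_n}) (g b : 'M[F]_n) (p q : 'I_n) (t : F).
Implicit Types (u v w x : 'S_n).

Lemma det_elmx p q t g : adj p q -> \det (elmx p q t *m g) = \det g.
Proof. by move=> pq; rewrite -!pl_setT pl_elmx_id // !in_setT. Qed.

Definition tnn_in v w g : Prop :=
  [/\ g \in unitmx, tnn g, cell (@hval n) g w & cell (@hrev n) g v].

Lemma tnn_plift w : tnn (plift F w).
Proof.
move=> k J; have [kn|nk] := leqP k n; first by rewrite pl_plift // ler0n.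
rewrite (_ : pl _ _ _ = 0) //; apply/eqP; apply: contraLR nk => /pl_card <-.
by rewrite -leqNgt -[X in (_ <= X)%N]card_ord max_card.
Qed.

Lemma cell_plift (h : 'I_n -> nat) w : injective h -> cell h (plift F w) w.
Proof.
move=> hI; apply/cell_triP => //; exists 1%:M, 1%:M.
by rewrite mul1mx mulmx1; split=> //; apply: tri1.
Qed.

(** Along a descent s of w, the matrix receives a left factor y_i(1) if v <= s w, and a lift of s if
    not; its twisted dual receives x_i(1) or the inverse lift. The matrix c absorbs the column signs
    left over at the identity. *)
Theorem tnn_exists v w : ble v w -> exists2 g, tnn_in v w g &
  exists2 c, tri (@hval n) c & tnn (Dm F n *m dualmx g *m c).
Proof.
move: {2}(perm_length w).+1 (ltnSn (perm_length w)) => N.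
elim: N v w => // N IH v w wN vw.
have hI := @hval_inj n; have rI := @hrev_inj n.
have [w1|w1] := eqVneq w 1%g.
  have v1 : v = 1%g by apply: ble1; rewrite -w1.
  exists (plift F 1%g); first by rewrite w1 v1; split; [exact: plift_unit|exact: tnn_plift|exact: cell_plift|exact: cell_plift].
  have : mono (Dm F n *m dualmx (plift F (1%g : 'S_n))) (longest n).
    have [d d0 dE] := mono_plift F (1%g : 'S_n).
    exists (fun a => (-1) ^+ (rev_ord a) * d (rev_ord a)) => [a|j a].
      by rewrite mulf_neq0 // signr_eq0.
    rewrite DmE /dualmx plift_orth mulmx_rev dE perm1 permE.
    by case: eqP => [->|]; rewrite ?mul1r ?mul0r ?mulr0.
  by move=> /mono_mulr_plift[c tc e]; exists c; rewrite // e; apply: tnn_plift.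
have [p0 [i [_ _ _ b]]] := first_descent w1.
set p := ord_hi i in b *; set q := ord_lo i in b *.
have pq : adj p q := adj_lohi i; have qp := adj_sym pq; have npq := adj_neq pq.
have pqE : p = q.+1 :> nat by [].
have hpq : hval p = (hval q).+1 by []; have hqp : hrev q = (hrev p).+1 := hrev_lohi i.
have tot u : bef u p q = ~~ bef u q p by apply: bef_total.
have lt := perm_length_desc pqE b.
set w' := (w * tperm p q)%g in lt *; have w'N : (perm_length w' < N)%N by lia.
have ww' : w = (w' * tperm p q)%g by rewrite mulgtK.
have bw' : bef w' q p by rewrite bef_swap'.
have [vw'|nvw'] := pselect (ble v w').
  have [g [gU tg cw cv] [c tc tgc]] := IH v w' w'N vw'.
  exists (elmx p q 1 *m g).
    split; first by rewrite unitmx_mul elmx_unit.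
    - by apply: tnn_elmx.
    - by rewrite ww'; apply: cell_raise => //; apply: oner_neq0.
    - exact: cell_lower.
  exists c => //; rewrite dualmx_elmx // Dm_elmx // opprK -mulmxA.
  exact: tnn_elmx.
have bv : bef v p q by rewrite tot; apply/negP=> bv; apply: nvw'; apply: ble_swapr.
set v' := (v * tperm p q)%g; have vv' : v = (v' * tperm p q)%g by rewrite mulgtK.
have v'w' : ble v' w' by apply: ble_swap2.
have [g [gU tg cw cv] [c tc tgc]] := IH v' w' w'N v'w'.
(* Every x in [s v, s w] has s as an ascent, as otherwise v <= x <= s w. Hence the coordinates to
   which [sdot] would give a minus sign are zero. *)
have asc x : ble v' x -> ble x w' -> bef x q p.
  move=> vx xw; rewrite -[bef x q p]negbK -tot; apply/negP=> bx; apply: nvw'.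
  by apply: ble_trans xw; rewrite vv'; apply: ble_swapl.
have supp k J : pl g k J != 0 -> exists x, [/\ ble v' x, bef x q p & sset x k = J].
  move=> /(cell_support gU (proj2 cw) (proj2 cv))[x [vx xw xJ]].
  by exists x; split=> //; apply: asc.
exists (sdot F p q *m g); last first.
  exists c => //; rewrite Dm_dual_sdot // -mulmxA.
  set h := Dm F n *m dualmx g *m c in tgc *.
  move=> k J; rewrite pl_sdot // tpermC; case: ifP => [/andP[pJ qJ]|_]; last by rewrite mul1r.
  have [->|H] := eqVneq (pl h k (tperm p q @: J)) 0; first by rewrite mulr0.
  have hU : h \in unitmx by rewrite /h 2!unitmx_mul Dm_unit dualmx_unit // tri_unit.
  have ch1 := cell_dual rI hI (@flip_rv n) tc cv.
  have ch2 := cell_dual hI rI (@flip_vr n) tc cw.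
  have [y [y1 y2 yJ]] := cell_support hU (proj2 ch1) (proj2 ch2) H.
  (* The same ascent property, carried to the dual flag by multiplication with w_0. *)
  have by' : bef y p q.
    have : bef (pmul y (longest n)) q p.
      apply: asc; first by rewrite -(longestK v'); apply: ble_longest.
      by rewrite -(longestK w'); apply: ble_longest.
    by rewrite bef_longest.
  have := bef_mem (k := k) by'; rewrite yJ !mem_swap tpermL tpermR pJ => /(_ isT).
  by rewrite (negPf qJ).
split; first by rewrite unitmx_mul sdot_unit.
- move=> k J; rewrite pl_sdot //; case: ifP => [/andP[qJ pJ]|_]; last by rewrite mul1r.
  have [->|H] := eqVneq (pl g k (tperm p q @: J)) 0; first by rewrite mulr0.
  have [x [vx bx xJ]] := supp k _ H.
  have := bef_mem (k := k) bx; rewrite xJ !mem_swap tpermL tpermR qJ => /(_ isT).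
  by rewrite (negPf pJ).
- by rewrite ww'; have [] := cell_sdot hI pq hpq bw' cw.
- split=> [k kn|k J].
    rewrite pl_sdot // vv' sset_mul swapK mulf_neq0 ?(proj1 cv) //.
    by case: ifP => _; rewrite ?oppr_eq0 oner_neq0.
  rewrite pl_sdot // mulf_eq0 negb_or => /andP[_ H].
  have Jk : #|J| = k by rewrite -(card_swap p q) (pl_card H).
  have kn : (k <= n)%N by rewrite -Jk -[X in (_ <= X)%N]card_ord max_card.
  have [x [vx bx xJ]] := supp k _ H.
  have Jx : J = sset (x * tperm p q)%g k by rewrite sset_mul xJ swapK.
  apply/gle_rev; first by rewrite Jk card_sset.
  rewrite Jx vv'; apply: ble_swapl => //; first by rewrite bef_swap.
  exact: ble_trans vx (ble_asc _ _).
Qed.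

Theorem tnn_factor w g : tnn_in 1%g w g ->
  exists s : seq ('I_n.-1 * F),
   [/\ word_perm [seq r.1 | r <- s] = w, size s = perm_length w,
       (forall r, r \in s -> 0 < r.2)
     & exists2 c, tri (@hval n) c &
        g = (\big[mulmx/1%:M]_(r <- s) elmx (ord_hi r.1) (ord_lo r.1) r.2) *m c].
Proof.
move: {2}(perm_length w).+1 (ltnSn (perm_length w)) => N.
elim: N w g => // N IH w g wN [gU tg cw cv].
have hI := @hval_inj n; have rI := @hrev_inj n.
have [w1|w1] := eqVneq w 1%g.
  exists [::]; rewrite w1 perm_length1; split=> //.
  move: cw; rewrite w1 => /(cell_triP _ _ hI)[b [c [tb tc e]]].
  exists g; last by rewrite big_nil mul1mx.
  rewrite e; apply: tri_mul => //; apply: tri_mul => //.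
  have [d d0 dE] := mono_plift F (1%g : 'S_n); split=> [i j ij|i]; rewrite dE perm1.
    by case: (eqVneq i j) ij => [->|_]; rewrite ?ltnn ?mul0r.
  by rewrite eqxx mul1r.
have [i b es] := elimination gU tg cw w1.
set p := ord_hi i in b es *; set q := ord_lo i in b es *.
have pq : adj p q := adj_lohi i; have qp := adj_sym pq; have npq := adj_neq pq.
have pqE : p = q.+1 :> nat by [].
have hpq : hval p = (hval q).+1 by []; have hqp : hrev q = (hrev p).+1 := hrev_lohi i.
have lt := perm_length_desc pqE b; have le := perm_length_leS pqE (w * tperm p q)%g.
rewrite mulgtK in le.
case: es => [t t0 tg' cg'|v0 _ _]; last first.
  (* For v = 1 the coordinates on initial segments are nonzero, and one of these segments contains q
     but not p; this excludes the infinite case. *)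
  have b1 : bef (1%g : 'S_n) q p by rewrite /bef invg1 !perm1 pqE.
  have [l ln /andP[ql pl']] := bef_sset b1.
  by have := (proj1 cv) l ln; rewrite v0 ?eqxx.
rewrite -/p -/q in tg' cg'; set g' := elmx p q (- t) *m g in tg' cg'.
have Hg' : tnn_in 1%g (w * tperm p q)%g g'.
  by split=> //; [rewrite unitmx_mul elmx_unit|exact: cell_lower].
have [|s [sw ss sp [c tc e]]] := IH (w * tperm p q)%g g' _ Hg'; first by lia.
exists ((i, t) :: s); split.
- by rewrite [map _ _]/= word_perm_cons sw mulgtK.
- by rewrite /= ss; lia.
- by move=> r; rewrite inE => /orP[/eqP ->|/sp].
- exists c => //; rewrite big_cons /= -mulmxA -e /g' -/p -/q elmxNK //.
Qed.

(** The word l is chosen before g and e, see [tnn_pert], so that a bound linear in e holds along the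
    whole family. *)
Definition pert (l : seq ('I_n * 'I_n)) (e : F) g : 'M[F]_n :=
  foldl (fun (y : 'M[F]_n) r => elmx r.1 r.2 e *m y) g l.

(** At a descent of v, a left factor x_i(e) lowers the opposite cell, keeps the other one and
    preserves nonnegativity. *)
Lemma pert_down v : exists l, forall w g e, 0 < e ->
  tnn_in v w g -> tnn_in 1%g w (pert l e g) /\ \det (pert l e g) = \det g.
Proof.
move: {2}(perm_length v).+1 (ltnSn (perm_length v)) => N.
elim: N v => // N IH v vN.
have [v1|v1] := eqVneq v 1%g; first by exists [::] => w g e _; rewrite v1.
have [p0 [i [_ _ _ b]]] := first_descent v1.
set p := ord_hi i in b *; set q := ord_lo i in b *.
have pq : adj p q := adj_lohi i; have qp := adj_sym pq; have nqp := adj_neq qp.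
have pqE : p = q.+1 :> nat by [].
have hqp : hrev q = (hrev p).+1 := hrev_lohi i.
have lt := perm_length_desc pqE b.
have [l lP] := IH (v * tperm p q)%g ltac:(lia).
exists ((q, p) :: l) => w g e e0 [gU tg cw cv] /=; rewrite -(det_elmx e g qp); apply: lP => //; split.
- by rewrite unitmx_mul elmx_unit.
- by apply: tnn_elmx => //; apply: ltW.
- exact: (cell_lower pq).
- by rewrite tpermC; apply: cell_raise => //; [exact: hrev_inj|rewrite gt_eqF].
Qed.

Lemma pert_up w : exists l, forall v g e, 0 < e ->
  tnn_in v w g -> tnn_in v (longest n) (pert l e g) /\ \det (pert l e g) = \det g.
Proof.
move: {2}(n * n - perm_length w).+1 (ltnSn (n * n - perm_length w)) => N.
elim: N w => // N IH w wN.
have [w1|/ascent[i b]] := eqVneq w (longest n); first by exists [::] => v g e _; rewrite w1.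
set p := ord_hi i in b *; set q := ord_lo i in b *.
have pq : adj p q := adj_lohi i; have qp := adj_sym pq; have npq := adj_neq pq.
have pqE : p = q.+1 :> nat by [].
have hqp : hrev q = (hrev p).+1 := hrev_lohi i.
have lt : (perm_length w < perm_length (w * tperm p q)%g)%N.
  by have := @perm_length_desc _ (w * tperm p q)%g p q pqE; rewrite bef_swap mulgtK; apply.
have le := perm_length_le (w * tperm p q)%g.
have [l lP] := IH (w * tperm p q)%g ltac:(lia).
exists ((p, q) :: l) => v g e e0 [gU tg cw cv] /=; rewrite -(det_elmx e g pq); apply: lP => //; split.
- by rewrite unitmx_mul elmx_unit.
- by apply: tnn_elmx => //; apply: ltW.
- by apply: cell_raise => //; [exact: hval_inj|rewrite gt_eqF].
- exact: (cell_lower qp).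
Qed.

Lemma pert_cat l l' e g : pert (l ++ l') e g = pert l' e (pert l e g).
Proof. exact: foldl_cat. Qed.

Lemma tnn_pert v w : exists l, forall g e, 0 < e ->
  tnn_in v w g -> tnn_in 1%g (longest n) (pert l e g) /\ \det (pert l e g) = \det g.
Proof.
have [l1 H1] := pert_down v; have [l2 H2] := pert_up w.
exists (l1 ++ l2) => g e e0 H; rewrite pert_cat; have [K1 <-] := H1 _ _ _ e0 H.
exact: H2.
Qed.

Lemma pert_bound l g : exists2 B : F, 0 <= B & forall e, 0 < e -> e <= 1 ->
  forall i j, `|pert l e g i j - g i j| <= e * B.
Proof.
elim/last_ind: l => [|l [p q] [B B0 BP]].
  by exists 0 => // e _ _ i j; rewrite /= subrr normr0 mulr0.
(* One more factor adds at most e times an entry of the previous matrix; as e <= 1, that entry is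
   bounded by B plus the absolute entries of g. *)
exists (2 * B + \sum_i \sum_j `|g i j|).
  by rewrite addr_ge0 ?mulr_ge0 // sumr_ge0 // => i _; rewrite sumr_ge0.
move=> e e0 e1 i j; rewrite -cats1 pert_cat /= elmxE.
set x := pert l e g; have Bx := BP e e0 e1.
have gq : `|g q j| <= \sum_i \sum_j `|g i j|.
  rewrite (bigD1 q) //= (bigD1 j) //= -addrA lerDl addr_ge0 ?sumr_ge0 // => k _.
  by rewrite sumr_ge0.
have xq : `|x q j| <= B + \sum_i \sum_j `|g i j|.
  rewrite -(subrK (g q j) (x q j)); apply: le_trans (ler_normD _ _) _.
  apply: lerD gq; apply: le_trans (Bx q j) _.
  by rewrite -{2}(mul1r B) ler_wpM2r.
rewrite addrAC; apply: le_trans (ler_normD _ _) _.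
have -> : e * (2 * B + \sum_i \sum_j `|g i j|) = e * B + e * (B + \sum_i \sum_j `|g i j|) by ring.
apply: lerD; first exact: Bx.
rewrite normrM normrM (gtr0_norm e0); case: (i == p); rewrite ?normr1 ?mul1r.
  by rewrite ler_wpM2l // ltW.
by rewrite normr0 mul0r mulr_ge0 ?(ltW e0) // (le_trans (normr_ge0 _) xq).
Qed.

End TnnCells.

(** * Pairing of coordinates and LU factorization *)

Section Pairing.
Variables (F : numFieldType) (n : nat).
Implicit Types (J K E : {set 'I_n}) (g : 'M[F]_n) (c d : 'I_n -> F) (f : {set 'I_n} -> F).

Definition ctr c f : {set 'I_n} -> F :=
  fun J => \sum_(j | j \notin J) sgn F J j * (c j * f (j |: J)).

Lemma wedge_ctr c f f' :
  \sum_J wedge c f J * f' J = \sum_J f J * ctr c f' J.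
Proof.
under eq_bigr do rewrite /wedge big_distrl /=.
under [in RHS]eq_bigr do rewrite /ctr big_distrr /=.
rewrite !pair_big_dep /= (reindex_onto (fun x => (x.2 |: x.1, x.2)) (fun x => (x.1 :\ x.2, x.2))) /=.
  apply: eq_big => [[J j]|[J j]] /=.
    rewrite setU11 /= xpair_eqE eqxx andbT; apply/eqP/idP => [<-|jJ]; first by rewrite setD11.
    by rewrite setU1K.
  rewrite setU11 /= xpair_eqE eqxx andbT => /eqP e.
  have jJ : j \notin J by rewrite -e setD11.
  by rewrite setU1K // sgnU1id //; ring.
by move=> [J j] /= jJ; rewrite setD1K.
Qed.

(** Clifford relation between contraction and wedge: the diagonal terms give the scalar product, the
    others cancel by [sgn_swap]. *)
Lemma ctr_wedge c d f J :
  ctr c (wedge d f) J = (\sum_j c j * d j) * f J - wedge d (ctr c f) J.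
Proof.
apply/eqP; rewrite eq_sym subr_eq eq_sym; apply/eqP.
rewrite (bigID (fun j => j \in J)) /= mulrDl [LHS]addrC.
rewrite /ctr /wedge.
have -> : \sum_(j in J) sgn F J j * (d j * \sum_(j0 | j0 \notin J :\ j) sgn F (J :\ j) j0 * (c j0 * f (j0 |: J :\ j)))
  = (\sum_(j in J) c j * d j) * f J +
    \sum_(j in J) \sum_(i | i \notin J) sgn F J j * (d j * (sgn F (J :\ j) i * (c i * f (i |: J :\ j)))).
  rewrite big_distrl -big_split; apply: eq_bigr => j jJ /=.
  rewrite (bigD1 j) /=; last by rewrite setD11.
  rewrite setD1K // sgnD1id // !mulrDr; congr (_ + _).
    have -> : sgn F J j * (d j * (sgn F J j * (c j * f J))) = (sgn F J j * sgn F J j) * (c j * d j * f J) by ring.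
    by rewrite sgnsq mul1r.
  rewrite !big_distrr /=; apply: eq_bigl => i; rewrite !inE negb_and negbK.
  by case: (eqVneq i j) => [->|_] /=; rewrite ?jJ ?andbT ?andbF.
have -> : \sum_(j | j \notin J) sgn F J j * (c j * \sum_(i in j |: J) sgn F (j |: J) i * (d i * f ((j |: J) :\ i)))
  = (\sum_(j | j \notin J) c j * d j) * f J +
    \sum_(j | j \notin J) \sum_(i in J) sgn F J j * (c j * (sgn F (j |: J) i * (d i * f (j |: J :\ i)))).
  rewrite big_distrl -big_split; apply: eq_bigr => j jJ /=.
  rewrite big_setU1 //= setU1K // sgnU1id // !mulrDr; congr (_ + _).
    have -> : sgn F J j * (c j * (sgn F J j * (d j * f J))) = (sgn F J j * sgn F J j) * (c j * d j * f J) by ring.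
    by rewrite sgnsq mul1r.
  rewrite !big_distrr /=; apply: eq_bigr => i iJ; congr (_ * (_ * (_ * (_ * f _)))).
  have ij : i != j by apply: contraNneq jJ => <-.
  by apply/setP=> y; rewrite !inE; case: (eqVneq y i) => [->|//]; rewrite (negPf ij).
rewrite exchange_big /=.
have -> : \sum_(j | j \notin J) \sum_(i in J) sgn F J j * (c j * (sgn F (j |: J) i * (d i * f (j |: J :\ i))))
  = - \sum_(j | j \notin J) \sum_(i in J) sgn F J i * (d i * (sgn F (J :\ i) j * (c j * f (j |: J :\ i)))).
  rewrite -sumrN; apply: eq_bigr => j jJ; rewrite -sumrN; apply: eq_bigr => i iJ.
  have ij : i != j by apply: contraNneq jJ => <-.
  rewrite (sgnU1 _ i jJ) (sgnD1 _ j iJ) (sgn_swap _ ij).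
  by case: (j < i)%N; rewrite ?expr0 ?expr1; ring.
by ring.
Qed.

(** By Cauchy-Binet this is the leading principal k-minor of [g2^T *m g]. *)
Definition pairpl g2 g k : F := \sum_J pl g2 k J * pl g k J.

Lemma vcol_pair g2 g (a b : 'I_n) : \sum_j vcol g2 a j * vcol g b j = (g2^T *m g) a b.
Proof. by rewrite mxE; apply: eq_bigr => j _; rewrite !vcolE mxE. Qed.

Lemma ctr_pl0 c g k : (forall b : 'I_n, (b < k)%N -> \sum_j c j * vcol g b j = 0) ->
  ctr c (pl g k) =1 fun=> 0.
Proof.
elim: k => [|k IH] H J.
  rewrite /ctr big1 // => j jJ; rewrite pl0 (_ : (_ == _) = false) ?mulr0 //.
  by apply/negbTE/set0Pn; exists j; rewrite setU11.
rewrite plS ctr_wedge (wedge0r _ _ (IH _)) ?subr0 => [|b bk]; last by apply: H; apply: ltnW.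
have [kn|nk] := ltnP k n; first by rewrite (H (Ordinal kn)) // mul0r.
rewrite [\sum_j _]big1 ?mul0r // => j _; rewrite /vcol insubF ?mulr0 //.
by apply/negbTE; rewrite -leqNgt.
Qed.

Lemma pairplS g2 g (k : 'I_n) : (forall b : 'I_n, (b < k)%N -> (g2^T *m g) k b = 0) ->
  pairpl g2 g k.+1 = (g2^T *m g) k k * pairpl g2 g k.
Proof.
move=> H; rewrite /pairpl plS wedge_ctr big_distrr; apply: eq_bigr => J _ /=.
rewrite plS ctr_wedge (wedge0r _ _ (ctr_pl0 _)) ?subr0 => [|b bk].
  by rewrite vcol_pair; ring.
by rewrite vcol_pair H.
Qed.

Lemma pairpl0 g2 g : pairpl g2 g 0 = 1.
Proof.
rewrite /pairpl (bigD1 set0) //= big1 ?addr0 ?pl0 ?eqxx ?mulr1 // => J /negPf J0.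
by rewrite pl0 J0 mul0r.
Qed.

Lemma pairpl_upper g2 g k : (k <= n)%N ->
  (forall a b : 'I_n, (b < a)%N -> (g2^T *m g) a b = 0) ->
  (forall a : 'I_n, (g2^T *m g) a a != 0) -> pairpl g2 g k != 0.
Proof.
move=> kn H0 Hd; elim: k kn => [|k IH] kn; first by rewrite pairpl0 oner_neq0.
rewrite (@pairplS g2 g (Ordinal kn)); last by move=> b bk; apply: H0.
by rewrite mulf_neq0 // IH // ltnW.
Qed.

Lemma pairpl_mulr g2 g (c2 c : 'M[F]_n) k : tri (@hval n) c2 -> tri (@hval n) c ->
  (pairpl (g2 *m c2) (g *m c) k != 0) = (pairpl g2 g k != 0).
Proof.
move=> t2 t; have -> : pairpl (g2 *m c2) (g *m c) k =
   (\prod_(a : 'I_n | (a < k)%N) c2 a a * \prod_(a : 'I_n | (a < k)%N) c a a) * pairpl g2 g k.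
  by rewrite /pairpl big_distrr; apply: eq_bigr => J _ /=; rewrite !pl_mulr //; ring.
by rewrite mulf_eq0 negb_or mulf_neq0 //; [apply: tri_prod_neq0 t2|apply: tri_prod_neq0 t].
Qed.

(** The cell of [g2^T *m g] for [hrev] gives L x U, and triangular factors do not affect
    nonvanishing. If x first moves p0, row p0 of [plift x] is zero up to the diagonal, and the
    pairing at level p0+1 vanishes. *)
Lemma pairpl_LU g2 g : g2 \in unitmx -> g \in unitmx ->
  (forall k, (k <= n)%N -> pairpl g2 g k != 0) ->
  exists L U, [/\ tri (@hrev n) L, tri (@hval n) U & g2^T *m g = L *m U].
Proof.
move=> g2U gU H.
have MU : g2^T *m g \in unitmx by rewrite unitmx_mul unitmx_tr g2U.
have rI := @hrev_inj n; have vI := @hval_inj n.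
have [x] := cell_exists rI MU => /(cell_triP _ _ rI)[L [U [tL tU e]]].
have LU := tri_unit_gen rI tL; have UU := tri_unit tU.
have tL' : tri (@hval n) (invmx L)^T := tri_tr (@flip_rv n) (tri_inv rI LU tL).
have tU' := tri_inv vI UU tU.
have e' : (g2 *m (invmx L)^T)^T *m (g *m invmx U) = plift F x.
  by rewrite trmx_mul trmxK -!mulmxA [g2^T *m _]mulmxA e !mulmxA mulVmx // mul1mx mulmxK.
have x1 : x = 1%g.
  apply/eqP; apply/negPn/negP=> /first_moved[p0 fx lt].
  have := H p0.+1 (ltn_ord p0); rewrite -(pairpl_mulr _ _ _ tL' tU').
  have z (b : 'I_n) : (b <= p0)%N -> plift F x p0 b = 0.
    move=> bp; rewrite mxE (_ : (p0 == x b) = false) ?mul0r //; apply/negbTE/eqP => E.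
    move: bp; rewrite leq_eqVlt => /orP[/eqP/val_inj eb|bp].
      by move: lt; rewrite -eb -E eb ltnn.
    by have fb := fx b bp; move: bp; rewrite E fb ltnn.
  rewrite pairplS e'; last by move=> b bp; apply: z; apply: ltnW.
  by rewrite z // mul0r eqxx.
exists L, (plift F x *m U); split=> //; last by rewrite mulmxA.
apply: tri_mul => //; have [d d0 dE] := mono_plift F x; split=> [i j ij|i]; rewrite dE x1 perm1.
  by case: (eqVneq i j) ij => [->|_]; rewrite ?ltnn ?mul0r.
by rewrite eqxx mul1r.
Qed.

End Pairing.

(** * Base change along a field morphism *)

Section Map.
Variables (F F' : numFieldType) (f : {rmorphism F -> F'}) (n : nat).
Implicit Types (g : 'M[F]_n).

Lemma vcol_map g k j : vcol (map_mx f g) k j = f (vcol g k j).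
Proof. by rewrite /vcol; case: insubP => [a _ _|_]; rewrite ?mxE ?rmorph0. Qed.

Lemma pl_map g k J : pl (map_mx f g) k J = f (pl g k J).
Proof.
elim: k J => [|k IH] J; first by rewrite !pl0 rmorph_nat.
rewrite !plS /wedge rmorph_sum; apply: eq_bigr => j _.
by rewrite !rmorphM IH vcol_map /sgn rmorph_sign.
Qed.

Lemma cell_map h g w : cell h g w -> cell h (map_mx f g) w.
Proof.
by move=> [c1 c2]; split=> [k kn|k J]; rewrite pl_map fmorph_eq0; [exact: c1|exact: c2].
Qed.

Lemma elmx_map p q t : map_mx f (elmx p q t : 'M[F]_n) = elmx p q (f t).
Proof.
by apply/matrixP=> i j; rewrite !mxE rmorphD rmorphM !rmorph_nat.
Qed.

Lemma dualmx_map g : map_mx f (dualmx g) = dualmx (map_mx f g).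
Proof.
rewrite /dualmx map_mxM -map_trmx map_invmx; congr (_ *m _).
by apply/matrixP=> i j; rewrite !mxE rmorph_nat.
Qed.

Lemma pairpl_map g2 g k : pairpl (map_mx f g2) (map_mx f g) k = f (pairpl g2 g k).
Proof. by rewrite /pairpl rmorph_sum; apply: eq_bigr => J _; rewrite rmorphM !pl_map. Qed.

Lemma tri_map h g : tri h g -> tri h (map_mx f g).
Proof.
by move=> [g0 gd]; split=> [i j|i]; rewrite mxE ?fmorph_eq0 //; move/g0 ->; rewrite rmorph0.
Qed.

End Map.

Import numFieldNormedType.Exports.

(** * Closure properties of algebras of regular functions *)

Section Generated.
Variables (K : comNzRingType) (X I : Type) (gen : I -> X -> K).

Lemma generated_sum (T : Type) (r : seq T) (P : pred T) (p : T -> X -> K) :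
  (forall t, generated_fun gen (p t)) ->
  generated_fun gen (fun x => \sum_(t <- r | P t) p t x).
Proof.
move=> H; elim: r => [|t r IH].
  by rewrite (_ : (fun _ => _) = fun=> 0); [exact: gen_const|apply/funext=> x; rewrite big_nil].
case Pt: (P t); last first.
  by rewrite (_ : (fun _ => _) = fun x => \sum_(t <- r | P t) p t x) //; apply/funext=> x; rewrite big_cons Pt.
rewrite (_ : (fun _ => _) = fun x => p t x + \sum_(t <- r | P t) p t x); first exact: gen_add.
by apply/funext=> x; rewrite big_cons Pt.
Qed.

Lemma generated_prod (T : Type) (r : seq T) (P : pred T) (p : T -> X -> K) :
  (forall t, generated_fun gen (p t)) ->
  generated_fun gen (fun x => \prod_(t <- r | P t) p t x).
Proof.
move=> H; elim: r => [|t r IH].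
  by rewrite (_ : (fun _ => _) = fun=> 1); [exact: gen_const|apply/funext=> x; rewrite big_nil].
case Pt: (P t); last first.
  by rewrite (_ : (fun _ => _) = fun x => \prod_(t <- r | P t) p t x) //; apply/funext=> x; rewrite big_cons Pt.
rewrite (_ : (fun _ => _) = fun x => p t x * \prod_(t <- r | P t) p t x); first exact: gen_mul.
by apply/funext=> x; rewrite big_cons Pt.
Qed.

Lemma generated_mulmx n (a b : 'M[K]_n) (p : X -> 'M[K]_n) i j :
  (forall k l, generated_fun gen (fun x => p x k l)) ->
  generated_fun gen (fun x => (a *m p x *m b) i j).
Proof.
move=> H; rewrite (_ : (fun _ => _) = fun x => \sum_l (\sum_k a i k * p x k l) * b l j).
  apply: generated_sum => l; apply: gen_mul; last exact: gen_const.
  by apply: generated_sum => k; apply: gen_mul; [exact: gen_const|exact: H].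
by apply/funext=> x; rewrite mxE; apply: eq_bigr => l _; rewrite mxE.
Qed.

End Generated.

(** * Conjugates of B_+, its normalizer, and Richardson varieties *)

Section Borel.
Variables (R : realType) (n : nat).
Local Notation C := (Cx R).
Local Notation M := 'M[Cx R]_n.
Implicit Types (g b c x y : M) (B T : set M).

Lemma conjgP g B x : g \in unitmx -> conjg_set g B x <-> B (invmx g *m x *m g).
Proof.
move=> gU; split=> [[y By <-]|Bx].
  by rewrite !mulmxA mulVmx // mul1mx -mulmxA mulVmx // mulmx1.
by exists (invmx g *m x *m g) => //; rewrite !mulmxA mulmxV // mul1mx -mulmxA mulmxV // mulmx1.
Qed.

Lemma det_conj g x : g \in unitmx -> \det (invmx g *m x *m g) = \det x.
Proof.
move=> gU; rewrite !det_mulmx mulrAC -det_mulmx mulVmx // det1 mul1r //.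
Qed.

Lemma det_upper b : (forall i j : 'I_n, (j < i)%N -> b i j = 0) -> \det b = \prod_i b i i.
Proof.
move=> H; rewrite -det_tr det_trig; first by apply: eq_bigr => i _; rewrite mxE.
by apply/is_trig_mxP => i j ij; rewrite mxE H.
Qed.

Lemma prod1_neq0 (e : 'I_n -> C) : \prod_i e i = 1 -> forall i, e i != 0.
Proof.
move=> H i; apply/eqP=> e0; have := oner_neq0 C; rewrite -H (bigD1 i) //= e0 mul0r eqxx //.
Qed.

Lemma BplusE b : Bplus b <-> tri (@hval n) b /\ \det b = 1.
Proof.
split=> [[db ub]|[[ub _] db]]; last by split.
by split=> //; split=> // i; apply: (prod1_neq0 (e := fun i => b i i)); rewrite -det_upper.
Qed.

Lemma Bminus_tri b : Bminus b -> tri (@hrev n) b.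
Proof.
move=> [db lb]; split=> [i j|i].
  by move=> H; apply: lb; move: H; rewrite flip_vr.
move: i; apply: (prod1_neq0 (e := fun i => b i i)); rewrite -[RHS]db det_trig //.
by apply/is_trig_mxP.
Qed.

Lemma Bminus_of_tri b : tri (@hrev n) b -> \det b = 1 -> Bminus b.
Proof. by move=> [b0 _] db; split=> // i j ij; apply: b0; rewrite flip_vr. Qed.

Lemma conj_upper g c : g \in unitmx -> tri (@hval n) c ->
  conjg_set (g *m c) (@Bplus R n) = conjg_set g (@Bplus R n).
Proof.
move=> gU tc; have cU := tri_unit tc; have gcU : g *m c \in unitmx by rewrite unitmx_mul gU.
have vI := @hval_inj n.
have e x : invmx (g *m c) *m x *m (g *m c) = invmx c *m (invmx g *m x *m g) *m c.
  by rewrite invmxM // !mulmxA.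
apply/funext=> x; apply/propext; split.
  move=> /(conjgP _ _ gcU); rewrite e => /BplusE[t d]; apply/(conjgP _ _ gU)/BplusE.
  rewrite det_conj // in d; split=> //.
  have -> : invmx g *m x *m g = c *m (invmx c *m (invmx g *m x *m g) *m c) *m invmx c.
    by rewrite !mulmxA mulmxV // mul1mx mulmxK.
  by apply: tri_mul => //; [apply: tri_mul|apply: tri_inv].
move=> /(conjgP _ _ gU)/BplusE[t d]; apply/(conjgP _ _ gcU)/BplusE.
rewrite e det_conj //; split=> //.
by apply: tri_mul => //; apply: tri_mul => //; apply: tri_inv.
Qed.

Lemma mulmx_mono_l (P : M) (x : 'S_n) y i j : mono P x ->
  (P *m y) (x i) j = P (x i) i * y i j.
Proof.
case=> e e0 PE; rewrite mxE (bigD1 i) //= big1 ?addr0 // => k ki.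
by rewrite PE (inj_eq perm_inj) eq_sym (negPf ki) !mul0r.
Qed.

Lemma mono_conj (P : M) (x : 'S_n) y (z : M) i j : mono P x -> z *m P = P *m y ->
  z (x i) (x j) * P (x j) j = P (x i) i * y i j.
Proof.
by move=> mP e; rewrite -(mulmx_mono_l _ _ _ mP) -e (mulmx_mono _ _ _ (monoE mP)).
Qed.

Lemma mono_neq0 (P : M) (x : 'S_n) i : mono P x -> P (x i) i != 0.
Proof. by case=> e e0 ->; rewrite eqxx mul1r. Qed.

Lemma elmx_upper (p q : 'I_n) (t : C) : (p < q)%N -> Bplus (elmx p q t).
Proof.
move=> pq; have z i j : elmx p q t i j = (i == j)%:R + t * ((i == p) && (j == q))%:R by rewrite !mxE.
have U (i j : 'I_n) : (j < i)%N -> elmx p q t i j = 0.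
  move=> ji; rewrite z (_ : (i == j) = false) ?add0r; last by rewrite -val_eqE gtn_eqF.
  case: (eqVneq i p) => [e|_]; last by rewrite mulr0.
  case: (eqVneq j q) => [e'|_]; last by rewrite andbF mulr0.
  by move: ji; rewrite e e' ltnNge (ltnW pq).
split=> //; rewrite /SL /= det_upper // big1 // => i _; rewrite z eqxx.
case: (eqVneq i p) => [->|_]; last by rewrite mulr0 addr0.
by rewrite -val_eqE ltn_eqF // mulr0 addr0.
Qed.

Lemma cell1_tri h g : injective h -> cell h g (1%g : 'S_n) ->
  exists b c, [/\ tri h b, tri (@hval n) c & g = b *m c].
Proof.
move=> hI /(cell_triP _ _ hI)[b [c [tb tc ->]]]; exists b, (plift C 1%g *m c); split=> //.
  apply: tri_mul => //; first exact: hval_inj.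
  have [d d0 dE] := mono_plift C (1%g : 'S_n); split=> [i j ij|i]; rewrite dE perm1.
    by case: (eqVneq i j) ij => [->|_]; rewrite ?ltnn ?mul0r.
  by rewrite eqxx mul1r.
by rewrite mulmxA.
Qed.

(** Write h as b x c. Conjugation by x keeps the elementary matrices at (i, j), i < j, upper
    triangular, so x is increasing and hence the identity. *)
Lemma conj_Bplus_inj g g' : g \in unitmx -> g' \in unitmx ->
  conjg_set g (@Bplus R n) = conjg_set g' (@Bplus R n) ->
  exists2 c, tri (@hval n) c & g' = g *m c.
Proof.
move=> gU g'U e; pose h := invmx g *m g'.
have hU : h \in unitmx by rewrite unitmx_mul unitmx_inv gU.
have vI := @hval_inj n.
have [x /[dup] cx] := cell_exists vI hU => /(cell_triP _ _ vI)[b [c [tb tc hE]]].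
have bU := tri_unit tb; have cU := tri_unit tc; have pU := plift_unit C x.
have x1 : x = 1%g.
  have mono_lt (i j : 'I_n) : (i < j)%N -> (x i < x j)%N.
    move=> ij; pose y := elmx i j 1 : M.
    have By : Bplus y by apply: elmx_upper.
    have : conjg_set (g' *m invmx c) (@Bplus R n) (g' *m invmx c *m y *m invmx (g' *m invmx c)).
      by exists y.
    rewrite (conj_upper g'U (tri_inv vI cU tc)).
    rewrite -e => /(conjgP _ _ gU).
    pose z := plift C x *m y *m invmx (plift C x).
    have -> : invmx g *m (g' *m invmx c *m y *m invmx (g' *m invmx c)) *m g = b *m z *m invmx b.
      have -> : g' = g *m b *m plift C x *m c.
        by rewrite -2!mulmxA (mulmxA b) -hE /h mulmxA mulmxV ?mul1mx.
      rewrite mulmxK // !invmxM ?unitmx_mul ?gU ?bU // /z !mulmxA mulVmx // mul1mx.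
      by rewrite mulmxKV.
    move=> /BplusE[tz _].
    have : tri (@hval n) (invmx b *m (b *m z *m invmx b) *m b).
      by apply: tri_mul => //; apply: tri_mul => //; apply: tri_inv.
    rewrite !mulmxA mulVmx // mul1mx mulmxKV // => -[z0 _].
    have zP : z *m plift C x = plift C x *m y by rewrite /z mulmxKV.
    have := mono_conj i j (mono_plift C x) zP.
    have yij : y i j = 1.
      by rewrite !mxE !eqxx -val_eqE ltn_eqF // add0r mulr1.
    rewrite yij mulr1 => H; rewrite ltnNge leq_eqVlt; apply/negP=> /orP[].
      by rewrite val_eqE (inj_eq perm_inj) -val_eqE gtn_eqF.
    by move=> /z0 E; have := mono_neq0 i (mono_plift C x); rewrite -H E mul0r eqxx.
  apply/eqP; apply/negPn/negP=> /first_descent[_ [i [_ _ _]]]; rewrite /bef => H.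
  by have := mono_lt _ _ H; rewrite !permKV /= ltnNge leqnSn.
rewrite x1 in cx; have [b1 [c1 [tb1 tc1 e1]]] := cell1_tri vI cx.
exists h; last by rewrite /h mulmxA mulmxV // mul1mx.
by rewrite e1; apply: tri_mul.
Qed.

Lemma perm_lift_mono (w : 'S_n) (d : M) : perm_lift w d -> mono d w.
Proof.
move=> [H _]; exists (fun a => d (w a) a) => [a|j a].
  by case: (H (w a) a) => ->; rewrite eqxx ?oppr_eq0 oner_neq0.
case: (eqVneq j (w a)) => [->|ne]; first by rewrite mul1r.
by case: (H j a) => ->; rewrite (negPf ne) ?oppr0 mul0r.
Qed.

Lemma perm_lift_plift (w : 'S_n) : perm_lift w (plift C w).
Proof.
split=> [i j|k kn r rH].
  by rewrite mxE /sgn -signr_odd; case: (odd _); [right|left]; rewrite ?expr1 ?expr0 ?mulrN1 ?mulr1.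
by rewrite pl_det // pl_plift // ler0n.
Qed.

Lemma richardson_cells (v w : 'S_n) B : richardson v w B ->
  exists g, [/\ g \in unitmx, B = conjg_set g (@Bplus R n), cell (@hval n) g w & cell (@hrev n) g v].
Proof.
move=> [[b [d [Bb Pd ->]]] [b' [d' [Bb' Pd' e]]]].
have vI := @hval_inj n; have rI := @hrev_inj n.
have tb := Bminus_tri Bb; have [tb' _] := (BplusE b').1 Bb'.
have c1 : cell (@hrev n) (b *m d) v.
  by apply: leading_cell => //; apply: leading_mono => //; apply: perm_lift_mono.
have c2 : cell (@hval n) (b' *m d') w.
  by apply: leading_cell => //; apply: leading_mono => //; apply: perm_lift_mono.
have unit_cell h (g : M) (x : 'S_n) : cell h g x -> g \in unitmx.
  by case=> /(_ n (leqnn n)); rewrite ssetn pl_setT unitmxE unitfE.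
have U1 := unit_cell _ _ _ c1; have U2 := unit_cell _ _ _ c2.
have [c tc E] := conj_Bplus_inj U1 U2 e.
by exists (b *m d); split=> //; move: c2; rewrite E => /cell_mulr; apply.
Qed.

Lemma cell_conj h g (w : 'S_n) : (0 < n)%N -> injective h -> g \in unitmx -> cell h g w ->
  exists b, [/\ tri h b, \det b = 1 & conjg_set g (@Bplus R n) = conjg_set (b *m plift C w) (@Bplus R n)].
Proof.
move=> n0 hI gU /(cell_triP _ _ hI)[b [c [tb tc e]]].
have bU := tri_unit_gen hI tb; have pU := plift_unit C w.
have [t [t0 dt]] := det_fix n0 bU; exists (b *m diag_mx t); split; [|exact: dt|].
  by apply: tri_mul => //; apply: tri_diag.
have bpU : b *m plift C w \in unitmx by rewrite unitmx_mul bU.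
rewrite e (conj_upper bpU tc); have -> : b *m diag_mx t *m plift C w = b *m plift C w *m diag_mx (\row_a t 0 (w a)).
  rewrite -!mulmxA; congr (_ *m _); apply/matrixP=> i j.
  rewrite mul_diag_mx mul_mx_diag !mxE.
  by case: (eqVneq i (w j)) => [->|_]; rewrite ?mul0r ?mulr0 // mulrC.
have td : tri (@hval n) (diag_mx (\row_a t 0 (w a)) : M) by apply: tri_diag => a; rewrite mxE.
by rewrite (conj_upper bpU td).
Qed.

Lemma cells_richardson g (v w : 'S_n) : (0 < n)%N -> g \in unitmx ->
  cell (@hval n) g w -> cell (@hrev n) g v -> richardson v w (conjg_set g (@Bplus R n)).
Proof.
move=> n0 gU cw cv.
have [b [tb db e]] := cell_conj n0 (@hval_inj n) gU cw.
have [b' [tb' db' e']] := cell_conj n0 (@hrev_inj n) gU cv.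
split.
  by exists b', (plift C v); split; [apply: Bminus_of_tri|apply: perm_lift_plift|].
by exists b, (plift C w); split; [apply/BplusE|apply: perm_lift_plift|].
Qed.

Lemma conj_flag g : (0 < n)%N -> g \in unitmx -> flag_variety (conjg_set g (@Bplus R n)).
Proof.
move=> n0 gU; have [t [t0 dt]] := det_fix n0 gU.
exists (g *m diag_mx t); first exact: dt.
by rewrite (conj_upper gU (tri_diag _ t0)).
Qed.

Lemma torus_comm T x y : is_torus T -> T x -> T y -> x *m y = y *m x.
Proof.
move=> [_ _ [m [f [h [_ [_ hT] [_ fh] hom]]]]] Tx Ty.
rewrite -(fh x Tx) -(fh y Ty) -!hom; try exact: hT.
by congr f; apply/funext=> k; rewrite mulrC.
Qed.

Definition diag_torus : set M := [set x | SL x /\ forall i j : 'I_n, i != j -> x i j = 0]%classic.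

(** An element of the diagonal torus with distinct entries at a and b: a matrix commuting with it
    has a zero at (a, b). *)
Definition twist (a b : 'I_n) : 'rV[C]_n := \row_i (if i == a then 2 else if i == b then 2^-1 else 1).

Lemma twist_det (a b : 'I_n) : a != b -> \det (diag_mx (twist a b)) = 1.
Proof.
move=> ab; rewrite det_diag (bigD1 a) //= (bigD1 b) 1?eq_sym //= big1 => [|i /andP[/negPf ia /negPf ib]].
  by rewrite !mxE eqxx (eq_sym b) (negPf ab) eqxx mulr1 mulfV // pnatr_eq0.
by rewrite mxE ia ib.
Qed.

Lemma two_neq_half : (2 : C) != 2^-1.
Proof.
rewrite -(inj_eq (mulfI (_ : (2 : C) != 0))) ?pnatr_eq0 // mulfV ?pnatr_eq0 //.
by rewrite -natrM -[1]/(1%:R) eqr_nat.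
Qed.

Lemma twist_commute (a b : 'I_n) x : a != b ->
  diag_mx (twist a b) *m x = x *m diag_mx (twist a b) -> x a b = 0.
Proof.
move=> ab /matrixP/(_ a b); rewrite mul_diag_mx mul_mx_diag !mxE eqxx (eq_sym b) (negPf ab) eqxx.
move/eqP; rewrite mulrC -subr_eq0 -mulrBr mulf_eq0 => /orP[/eqP //|].
by rewrite subr_eq0 (negPf two_neq_half).
Qed.

Lemma twist_diag (a b : 'I_n) : a != b -> diag_torus (diag_mx (twist a b)).
Proof.
by move=> ab; split=> [|i j ij]; [exact: twist_det|rewrite mxE (negPf ij)].
Qed.

End Borel.

(** * Maximal tori and opposed Borel subgroups *)

Section Torus.
Variables (R : realType) (n' : nat).
Local Notation n := n'.+1.
Local Notation C := (Cx R).
Local Notation M := 'M[Cx R]_n.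
Implicit Types (g b c x y : M) (B T : set M) (t s : 'I_n' -> C).
Local Notation T0 := (@diag_torus R n).

Lemma diag_torusE y : T0 y <-> [/\ tri (@hval n) y, tri (@hrev n) y & \det y = 1].
Proof.
split=> [[dy y0]|[[y1 _] [y2 _] dy]].
  have dU i : y i i != 0.
    move: i; apply: (prod1_neq0 (e := fun i => y i i)); rewrite -[RHS]dy det_upper //.
    by move=> i j ji; apply: y0; rewrite -val_eqE gtn_eqF.
  by split=> //; split=> // i j ij; apply: y0; apply: contraTneq ij => ->; rewrite ltnn.
split=> // i j; rewrite -val_eqE neq_ltn => /orP[] ij; last exact: y1.
by apply: y2; rewrite flip_vr.
Qed.

(** Determinant 1 forces the last diagonal entry and leaves n' free coordinates. *)
Definition dvec t : 'rV[C]_n :=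
  \row_k (if insub (val k) is Some l then t l else \prod_l (t l)^-1).

Lemma dvec_lo t (l : 'I_n') : dvec t 0 (ord_lo (l : 'I_n.-1)) = t l.
Proof. by rewrite mxE /= valK. Qed.

Lemma dvec_max t : dvec t 0 ord_max = \prod_l (t l)^-1.
Proof. by rewrite mxE /= insubF // ltnn. Qed.

Lemma ord_loE (l : 'I_n') : ord_lo (l : 'I_n.-1) = widen_ord (leqnSn n') l.
Proof. exact: val_inj. Qed.

Lemma dvec_prod t : Gm t -> \prod_k dvec t 0 k = 1.
Proof.
move=> t0; rewrite big_ord_recr /= dvec_max -big_split /= big1 // => l _.
by rewrite -ord_loE dvec_lo mulfV //; apply: t0.
Qed.

Lemma dvecM s t : dvec (fun k => s k * t k) = \row_k (dvec s 0 k * dvec t 0 k).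
Proof.
apply/rowP=> k; rewrite !mxE; case: insubP => [l _ _|_] //.
by rewrite -big_split; apply: eq_bigr => l _ /=; rewrite invfM.
Qed.

Lemma diag_of_dvec y : T0 y -> y = diag_mx (dvec (fun l => y (ord_lo (l : 'I_n.-1)) (ord_lo (l : 'I_n.-1)))).
Proof.
move=> Ty; have [dy y0] := Ty; have [[_ yd] _ _] := (diag_torusE y).1 Ty.
apply/matrixP=> i j; rewrite mxE; case: (eqVneq i j) => [<-|ne]; last by rewrite mulr0n y0.
rewrite mulr1n mxE; case: insubP => [l _ e|/=].
  by have -> : i = ord_lo (l : 'I_n.-1) by apply: val_inj.
rewrite -leqNgt => n'i.
have -> : i = ord_max by apply: val_inj => /=; apply/eqP; rewrite eqn_leq n'i -ltnS ltn_ord.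
have : \prod_k y k k = 1.
  by rewrite -det_upper // => a b ba; apply: y0; rewrite -val_eqE gtn_eqF.
rewrite big_ord_recr /= prodfV => H.
apply: (mulfI (_ : \prod_(l < n') y (widen_ord (leqnSn n') l) (widen_ord (leqnSn n') l) != 0)).
  by apply/prodf_neq0 => l _.
rewrite H; under [X in _ = _ * X^-1]eq_bigr do rewrite ord_loE.
by rewrite mulfV //; apply/prodf_neq0 => l _.
Qed.

Section Conj.
Variables (g : M) (gU : g \in unitmx).
Local Notation T := (conjg_set g T0).
Let cg x := invmx g *m x *m g.

Let cgM x y : cg (x *m y) = cg x *m cg y.
Proof. by rewrite /cg !mulmxA mulmxK. Qed.

Let cg1 : cg 1%:M = 1%:M. Proof. by rewrite /cg mulmx1 mulVmx. Qed.

Let TP x : T x <-> T0 (cg x). Proof. exact: conjgP. Qed.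

Let unitT0 y : T0 y -> y \in unitmx.
Proof. by move=> [dy _]; rewrite unitmxE dy unitr1. Qed.

Lemma conj_torus_subgroup : subgroup_SL T.
Proof.
split.
- by move=> x /TP[]; rewrite /SL /= /cg det_conj.
- apply/TP; rewrite cg1; apply/diag_torusE; rewrite det1; split=> //; exact: tri1.
- move=> x y /TP/diag_torusE[x1 x2 dx] /TP/diag_torusE[y1 y2 dy]; apply/TP/diag_torusE.
  rewrite cgM det_mulmx dx dy mul1r; split=> //; apply: tri_mul => //; [exact: hval_inj|exact: hrev_inj].
- move=> x /TP Tx; have U := unitT0 Tx; have /diag_torusE[x1 x2 dx] := Tx.
  have xU : x \in unitmx.
    by rewrite unitmxE -(det_conj _ gU) -/(cg x) dx unitr1.
  apply/TP/diag_torusE; have -> : cg (invmx x) = invmx (cg x).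
    by rewrite -[RHS]mul1mx -cg1 -(mulVmx xU) cgM mulmxK.
  rewrite det_inv dx invr1; split=> //; apply: tri_inv => //; [exact: hval_inj|exact: hrev_inj].
Qed.

Lemma conj_torus_closed : zariski_closed T.
Proof.
exists [set p | (exists i j : 'I_n, i != j /\ p = (fun x => cg x i j)) \/ p = (fun x => \det x - 1)]%classic.
  move=> p [[i [j [_ ->]]]|->].
    apply: generated_mulmx => k l; exact: (gen_gen (fun (ij : 'I_n * 'I_n) (x : M) => x ij.1 ij.2) (k, l)).
  apply: gen_add; last exact: gen_const.
  apply: generated_sum => s; apply: gen_mul; first exact: gen_const.
  apply: generated_prod => i.
  exact: (gen_gen (fun (ij : 'I_n * 'I_n) (x : M) => x ij.1 ij.2) (i, s i)).
apply/funext=> x; apply/propext; split.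
  move=> /TP[dx x0] p [[i [j [ij ->]]]|->]; first exact: x0.
  by rewrite -(det_conj x gU) -/(cg x) dx subrr.
move=> H; apply/TP; split=> [|i j ij].
  have /eqP := H (fun x => \det x - 1) (or_intror erefl).
  by rewrite subr_eq0 /SL /= /cg det_conj // => /eqP.
by apply: (H (fun x => cg x i j)); left; exists i, j.
Qed.

Lemma conj_torus_is_torus : is_torus T.
Proof.
split; [exact: conj_torus_subgroup|exact: conj_torus_closed|].
pose f t : M := g *m diag_mx (dvec t) *m invmx g.
pose h x (l : 'I_n') : C := cg x (ord_lo (l : 'I_n.-1)) (ord_lo (l : 'I_n.-1)).
have cf t : cg (f t) = diag_mx (dvec t).
  by rewrite /cg /f !mulmxA mulVmx // mul1mx mulmxKV.
have Tf t : Gm t -> T0 (diag_mx (dvec t)).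
  move=> t0; split; first by rewrite /SL /= det_diag dvec_prod.
  by move=> i j ij; rewrite mxE (negPf ij).
exists n', f, h; split.
- split=> [i j|k].
    apply: generated_mulmx => k l; case: (eqVneq k l) => [<-|kl]; last first.
      have -> : (fun t => diag_mx (dvec t) k l) = fun=> 0.
        by apply/funext=> t; rewrite mxE (negPf kl).
      exact: gen_const.
    have -> : (fun t => diag_mx (dvec t) k k) = fun t => dvec t 0 k.
      by apply/funext=> t; rewrite mxE eqxx mulr1n.
    case e: (insub (val k) : option 'I_n') => [l0|].
      have -> : (fun t => dvec t 0 k) = fun t => t l0 by apply/funext=> t; rewrite mxE e.
      exact: (gen_gen (fun (ke : 'I_n' * bool) (t : 'I_n' -> C) => if ke.2 then t ke.1 else (t ke.1)^-1) (l0, true)).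
    have -> : (fun t => dvec t 0 k) = fun t => \prod_l1 (t l1)^-1 by apply/funext=> t; rewrite mxE e.
    apply: generated_prod => l1.
    exact: (gen_gen (fun (ke : 'I_n' * bool) (t : 'I_n' -> C) => if ke.2 then t ke.1 else (t ke.1)^-1) (l1, false)).
  apply: generated_mulmx => i j; exact: (gen_gen (fun (ij : 'I_n * 'I_n) (x : M) => x ij.1 ij.2) (i, j)).
- split=> [t t0|x /TP/diag_torusE[[_ xd] _ _] k]; last exact: xd.
  by apply/TP; rewrite cf; apply: Tf.
- split=> [t _|x /TP Tx].
    by apply/funext=> l; rewrite /h cf mxE eqxx mulr1n dvec_lo.
  rewrite /f -(diag_of_dvec Tx) /cg !mulmxA mulmxV // mul1mx mulmxK //.
- move=> s t _ _; rewrite /f !mulmxA (mulmxKV gU); congr (_ *m _); rewrite -mulmxA; congr (_ *m _).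
  by rewrite mulmx_diag dvecM.
Qed.

(** A torus containing T is commutative, so it centralizes every conjugated [twist]; this kills all
    off-diagonal entries of [cg x]. *)
Theorem conj_torus_maximal : maximal_torus T.
Proof.
split; first exact: conj_torus_is_torus.
move=> T' tT' sub; apply/funext=> x; apply/propext; split; last exact: sub.
move=> Tx; apply/TP; split.
  by have [[+ _ _ _] _ _] := tT' => /(_ x Tx); rewrite /SL /= /cg det_conj.
move=> i j ij; apply: (twist_commute ij).
pose d := diag_mx (twist R i j) : M; pose D := g *m d *m invmx g.
have TD : T D by exists d => //; apply: twist_diag.
have cD : cg D = d by rewrite /cg /D !mulmxA mulVmx // mul1mx mulmxKV.
by rewrite -/d -cD -!cgM (torus_comm tT' Tx (sub _ TD)).
Qed.

End Conj.

Lemma tri_revK (h h' : 'I_n -> nat) b : (forall i j : 'I_n, (h' j < h' i)%N = (h (rev_ord j) < h (rev_ord i))%N) ->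
  tri h b -> tri h' (revmx C n *m b *m revmx C n).
Proof.
move=> H [b0 bd]; split=> [i j|i]; rewrite mulmx_rev mul_revmx; last exact: bd.
by rewrite H; apply: b0.
Qed.

Lemma hrev_rev (i j : 'I_n) : (hval j < hval i)%N = (hrev (rev_ord j) < hrev (rev_ord i))%N.
Proof. by rewrite /hrev /hval /=; have := ltn_ord i; have := ltn_ord j; lia. Qed.

Lemma hval_rev (i j : 'I_n) : (hrev j < hrev i)%N = (hval (rev_ord j) < hval (rev_ord i))%N.
Proof. by rewrite /hrev /hval /=; have := ltn_ord i; have := ltn_ord j; lia. Qed.

Local Notation Bp := (@Bplus R n).

(** At an ascent of x, both Borel subgroups contain, up to conjugation by g', an elementary
    unipotent matrix and a diagonal matrix that do not commute, contrary to the commutativity of a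
    torus. *)
Lemma opposed_relative_position g g' (x : 'S_n) : g \in unitmx -> g' \in unitmx ->
  g = g' *m plift C x -> is_torus (conjg_set g Bp `&` conjg_set g' Bp)%classic -> x = longest n.
Proof.
move=> gU g'U e tT; apply/eqP; apply/negPn/negP=> /ascent[i b].
set p := ord_hi i in b *; set q := ord_lo i in b *.
have qp : (q < p)%N by []; have nqp : q != p by rewrite -val_eqE ltn_eqF.
have mP := mono_plift C x; have pU := plift_unit C x.
pose y := elmx q p 1 : M; pose d := diag_mx (twist R q p) : M.
have By : Bplus y by apply: elmx_upper.
have Bd : Bplus d by apply/BplusE; have /diag_torusE[] := twist_diag R nqp.
have yE (k l : 'I_n) : k != l -> y k l = ((k == q) && (l == p))%:R.
  by move=> kl; rewrite !mxE (negPf kl) add0r mul1r.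
have key z : Bplus z -> (forall k l : 'I_n, (l < k)%N -> z (x k) (x l) = 0) ->
   (conjg_set g Bp `&` conjg_set g' Bp)%classic (g' *m z *m invmx g').
  move=> Bz Hz; split; last by exists z.
  apply/conjgP => //; rewrite e invmxM // !mulmxA mulmxKV // mulmxKV //.
  have /BplusE[_ dz] := Bz; split; first by rewrite /SL /= det_conj.
  move=> k l lk; set z' := invmx _ *m z *m _.
  have zP : z *m plift C x = plift C x *m z' by rewrite /z' !mulmxA mulmxV // mul1mx.
  have /eqP := mono_conj k l mP zP; rewrite (Hz k l lk) mul0r eq_sym mulf_eq0.
  by rewrite (negPf (mono_neq0 k mP)) => /eqP.
have Ty : (conjg_set g Bp `&` conjg_set g' Bp)%classic (g' *m y *m invmx g').
  apply: key => // k l lk; rewrite yE; last by rewrite (inj_eq perm_inj) -val_eqE gtn_eqF.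
  case: eqP => // xk; case: eqP => // xl; move: b; rewrite /bef -xk -xl !permK.
  by rewrite ltnNge (ltnW lk).
have Td : (conjg_set g Bp `&` conjg_set g' Bp)%classic (g' *m d *m invmx g').
  apply: key => // k l lk; rewrite mxE (_ : (x k == x l) = false) //.
  by rewrite (inj_eq perm_inj) -val_eqE gtn_eqF.
have E (a a' : M) : invmx g' *m (g' *m a *m invmx g' *m (g' *m a' *m invmx g')) *m g' = a *m a'.
  by rewrite !mulmxA mulVmx // mul1mx !mulmxKV.
have yd : d *m y = y *m d by rewrite -(E d y) -(E y d) (torus_comm tT Td Ty).
have := twist_commute nqp yd; rewrite yE // !eqxx => /eqP.
by rewrite oner_eq0.
Qed.

Lemma opposed_pairing g g' : g \in unitmx -> g' \in unitmx ->
  opposed_borel (conjg_set g Bp) (conjg_set g' Bp) <->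
  (forall k, (k <= n)%N -> pairpl (dualmx g') g k != 0).
Proof.
move=> gU g'U; have vI := @hval_inj n; have rI := @hrev_inj n.
have dU := dualmx_unit g'U; split.
  move=> [_ _ [tT _]] k kn.
  have MU : invmx g' *m g \in unitmx by rewrite unitmx_mul unitmx_inv g'U.
  have [x /(cell_triP _ _ vI)[b [c [tb tc e]]]] := cell_exists vI MU.
  have bU := tri_unit tb; have cU := tri_unit tc; have tc' := tri_inv vI cU tc.
  have g'bU : g' *m b \in unitmx by rewrite unitmx_mul g'U.
  have gcU : g *m invmx c \in unitmx by rewrite unitmx_mul gU unitmx_inv.
  have e1 : g *m invmx c = g' *m b *m plift C x.
    have -> : g = g' *m (invmx g' *m g) by rewrite mulmxA mulmxV ?mul1mx.
    by rewrite e !mulmxA mulmxK.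
  have tT' : is_torus (conjg_set (g *m invmx c) Bp `&` conjg_set (g' *m b) Bp)%classic.
    by rewrite (conj_upper gU tc') (conj_upper g'U tb).
  have xl := opposed_relative_position gcU g'bU e1 tT'.
  have tb' : tri (@hval n) (revmx C n *m (invmx b)^T *m revmx C n).
    exact: tri_revK hrev_rev (tri_tr (@flip_vr n) (tri_inv vI bU tb)).
  rewrite -(pairpl_mulr _ _ _ tb' tc') -dualmx_mulr //.
  (* As x is w_0, the reversal of the rows of [plift C x] is diagonal, so all pairings are
     nonzero. *)
  have P : (dualmx (g' *m b))^T *m (g *m invmx c) = revmx C n *m plift C x.
    by rewrite e1 mulmxA trmx_dualmx.
  have [d d0 dE] := mono_plift C x.
  apply: pairpl_upper => // [a a' aa'|a]; rewrite P mul_revmx dE xl permE (inj_eq rev_ord_inj).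
    by rewrite -val_eqE gtn_eqF // mul0r.
  by rewrite eqxx mul1r.
move=> /(pairpl_LU dU gU)[L [U [tL tU e]]].
have LU := tri_unit_gen rI tL; have UU := tri_unit tU.
(* The factorization yields one basis g3 adapted to the first flag whose reversal is adapted to the
   second. *)
pose g3 := g *m invmx U; pose L' := revmx C n *m L *m revmx C n.
have tU' := tri_inv vI UU tU.
have tL' : tri (@hval n) L' := tri_revK hrev_rev tL.
have g3U : g3 \in unitmx by rewrite unitmx_mul gU unitmx_inv.
have e3 : g' *m L' = g3 *m revmx C n.
  rewrite /g3 /L' !mulmxA; congr (_ *m _).
  have : revmx C n *m invmx g' *m g = L *m U.
    by rewrite -e /dualmx trmx_mul trmxK trmx_rev.
  move/(congr1 (fun z => revmx C n *m z *m invmx U)); rewrite !mulmxA revmxK mul1mx mulmxK //.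
  move/(congr1 (mulmx g')); rewrite !mulmxA mulmxV // mul1mx => ->.
  by [].
have eB : conjg_set g Bp = conjg_set g3 Bp by rewrite (conj_upper gU tU').
have eB' : conjg_set g' Bp = conjg_set (g3 *m revmx C n) Bp by rewrite -e3 (conj_upper g'U tL').
split; [exact: conj_flag|exact: conj_flag|].
have g3'U : g3 *m revmx C n \in unitmx by rewrite unitmx_mul g3U revmx_unit.
rewrite eB eB' (_ : (_ `&` _)%classic = conjg_set g3 T0); first exact: conj_torus_maximal.
apply/funext=> x; apply/propext.
split.
  move=> [/(conjgP _ _ g3U)/BplusE[t1 d1] /(conjgP _ _ g3'U)/BplusE[]].
  rewrite (conj_mulmx_rev _ g3U) => t2 _; apply/(conjgP _ _ g3U)/diag_torusE; split; [exact: t1| |exact: d1].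
  by have := tri_revK hval_rev t2; rewrite rev_conjK.
move=> /(conjgP _ _ g3U)/diag_torusE[t1 t2 d1]; split; first by apply/(conjgP _ _ g3U)/BplusE.
apply/(conjgP _ _ g3'U)/BplusE; rewrite (conj_mulmx_rev _ g3U); split; first exact: tri_revK hrev_rev t2.
by rewrite 2!det_mulmx mulrAC -det_mulmx revmxK det1 mul1r.
Qed.

End Torus.

(** * Reversed words *)

Section ReverseWords.
Variable n : nat.

Lemma word_perm_rev (s : seq 'I_n.-1) : word_perm (rev s) = (word_perm s)^-1%g.
Proof.
have wcat (s1 s2 : seq 'I_n.-1) : word_perm (s1 ++ s2) = (word_perm s2 * word_perm s1)%g.
  elim: s1 => [|i s1 IH]; first by rewrite mulg1.
  by rewrite cat_cons !word_perm_cons IH mulgA.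
elim: s => [|i s IH]; first by rewrite invg1.
rewrite rev_cons -cats1 wcat IH !word_perm_cons /= mul1g invMg tpermV.
by [].
Qed.

End ReverseWords.

(** * Nonnegative flags as limits of U_-^{>0} and U_-^{<0} *)

Section Closure.
Variables (R : realType) (n : nat).
Local Notation C := (Cx R).
Local Notation M := 'M[Cx R]_n.
Local Notation Bp := (@Bplus R n).
Implicit Types (g u c : 'M[R]_n) (s : seq ('I_n.-1 * R)).

Definition cmx g : M := map_mx (real_complex R : R -> C) g.

Lemma norm_real_complex (x : R) : `|(real_complex R x : C)| = real_complex R `|x|.
Proof. by rewrite normc_def /= expr0n /= addr0 sqrtr_sqr. Qed.

Lemma flag_closure_limit (F : set (set M)) g (G : R -> 'M[R]_n) (B : R) :
  0 <= B -> \det g = 1 ->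
  (forall e, 0 < e -> e <= 1 -> forall i j, `|G e i j - g i j| <= e * B) ->
  (forall e, 0 < e -> e <= 1 -> \det (G e) = 1 /\ F (conjg_set (cmx (G e)) Bp)) ->
  flag_closure F (conjg_set (cmx g) Bp).
Proof.
move=> B0 dg bnd GF.
have dC (x : 'M[R]_n) : \det x = 1 -> SL (cmx x).
  by move=> dx; rewrite /SL /= /cmx det_map_mx dx rmorph1.
split; first by exists (cmx g) => //; apply: dC.
move=> Z cZ FZ.
suff [] : [set x : M | SL x /\ Z (conjg_set x Bp)]%classic (cmx g) by [].
rewrite ((closure_id _).1 cZ) => U /nbhs_ballP[e /= e0 eU].
have [r eR] : exists r, e = real_complex R r by apply/complex_realP; exact: gtr0_real.
have r0 : 0 < r by rewrite -ltcR -eR.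
(* Makes d * B < r; the summand 1 keeps the denominator positive when B = 0. *)
pose d := Num.min 1 (r / (B + 1)).
have B1 : 0 < B + 1 by rewrite ltr_wpDl.
have d0 : 0 < d by rewrite lt_min ltr01 divr_gt0.
have d1 : d <= 1 by rewrite ge_min lexx.
have [dG FG] := GF d d0 d1.
exists (cmx (G d)); split; first by split; [exact: dC|exact: FZ].
apply: eU; split=> // i j; rewrite -ball_normE /= !mxE -rmorphB norm_real_complex eR ltcR distrC.
apply: le_lt_trans (bnd d d0 d1 i j) _.
apply: (@lt_le_trans _ _ (d * (B + 1))); first by rewrite ltr_pM2l // ltrDl.
by rewrite -ler_pdivlMr // ge_min lexx orbT.
Qed.

Definition yprod s : 'M[R]_n :=
  \big[mulmx/1%:M]_(r <- s) elmx (ord_hi r.1) (ord_lo r.1) r.2.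

Lemma yprod_rcons s r :
  yprod (rcons s r) = yprod s *m elmx (ord_hi r.1) (ord_lo r.1) r.2.
Proof.
rewrite /yprod; elim: s => [|r' s IH] /=; first by rewrite big_cons !big_nil mulmx1 mul1mx.
by rewrite !big_cons IH mulmxA.
Qed.

Lemma cmx_yprod s : cmx (yprod s) = \big[mulmx/1%:M]_(r <- s) ymx r.1 (real_complex R r.2).
Proof.
rewrite /yprod; elim: s => [|r s IH]; first by rewrite !big_nil /cmx map_mx1.
by rewrite !big_cons -IH /cmx map_mxM elmx_map.
Qed.

(** Conjugation by D negates the parameters, so the reversed word cancels the product factor by
    factor. This places D u D in U_-^{<0} for u in U_-^{>0}. *)
Lemma yprod_rev s : yprod (rev s) *m (Dm R n *m yprod s *m Dm R n) = 1%:M.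
Proof.
elim: s => [|r s IH].
  by rewrite /yprod big_nil mul1mx mulmx1 -{2}(mulmx1 (Dm R n)) DmK.
rewrite rev_cons yprod_rcons {2}/yprod big_cons -/(yprod s) -!mulmxA.
rewrite Dm_elmx; last exact: adj_lohi.
rewrite elmxNK; last exact: adj_neq (adj_lohi _).
by rewrite -IH !mulmxA.
Qed.

Lemma Uminus_yprod s : word_perm [seq r.1 | r <- s] = longest n ->
  size s = perm_length (longest n) -> (forall r, r \in s -> 0 < r.2) ->
  Uminus_pos (cmx (yprod s)) /\ Uminus_neg (cmx (Dm R n *m yprod s *m Dm R n)).
Proof.
move=> sw ss sp.
have pos s1 : word_perm [seq r.1 | r <- s1] = longest n ->
  size s1 = perm_length (longest n) -> (forall r, r \in s1 -> 0 < r.2) ->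
  Uminus_pos (cmx (yprod s1)).
  move=> h1 h2 h3; exists s1; split=> //; last exact: cmx_yprod.
  by apply: reduced_word_length; rewrite ?size_map.
split; first exact: pos.
exists (cmx (yprod (rev s))).
  apply: pos => [||r]; rewrite ?size_rev ?mem_rev //; last exact: sp.
  rewrite map_rev word_perm_rev sw; apply: (mulIg (longest n)).
  by rewrite mulVg longestM.
have E : cmx (yprod (rev s)) *m cmx (Dm R n *m yprod s *m Dm R n) = 1%:M.
  by rewrite /cmx -map_mxM yprod_rev map_mx1.
have [U _] := mulmx1_unit E.
by rewrite -[LHS]mulmx1 -E mulKmx.
Qed.

Lemma pert_mulr l (e : R) g c : pert l e (g *m c) = pert l e g *m c.
Proof.
by elim: l g => [|r l IH] g //=; rewrite -IH mulmxA.
Qed.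

Lemma cmx_tri h c : tri h c -> tri h (cmx c).
Proof. exact: tri_map. Qed.

Lemma cmx_unit g : g \in unitmx -> cmx g \in unitmx.
Proof. by rewrite /cmx map_unitmx. Qed.

Lemma conj_cmx g c : g \in unitmx -> tri (@hval n) c ->
  conjg_set (cmx (g *m c)) Bp = conjg_set (cmx g) Bp.
Proof.
by move=> gU tc; rewrite /cmx map_mxM (conj_upper (cmx_unit gU) (cmx_tri tc)).
Qed.

Hypothesis n_gt0 : (0 < n)%N.

(** After rescaling to determinant 1, the perturbed matrices lie in the cells of 1 and w_0, where
    [tnn_factor] writes them as an element of U_-^{>0} times an upper triangular matrix. *)
Lemma tnn_flag_ge0 v w g : tnn_in v w g -> flag_ge0 (conjg_set (cmx g) Bp).
Proof.
move=> tg; have [gU _ _ _] := tg; have vI := @hval_inj n.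
have [t [t0 dt]] := det_fix n_gt0 gU; have tt := tri_diag (@hval n) t0.
rewrite -(conj_cmx gU tt).
have [l lP] := tnn_pert R v w.
have [B B0 BP] := pert_bound l (g *m diag_mx t).
apply: (flag_closure_limit B0 dt BP) => e e0 _.
have [te de] := lP g e e0 tg.
have [s [sw ss sp [c tc E]]] := tnn_factor te.
rewrite pert_mulr det_mulmx de -det_mulmx dt; split=> //.
have uU : yprod s \in unitmx.
  by have [+ _ _ _] := te; rewrite E unitmx_mul => /andP[].
exists (cmx (yprod s)); first by have [] := Uminus_yprod sw ss sp.
by rewrite E -mulmxA (conj_cmx uU (tri_mul vI tc tt)).
Qed.

Lemma tnn_flag_le0 v w g c : g \in unitmx -> tri (@hval n) c ->
  tnn_in v w (Dm R n *m g *m c) -> flag_le0 (conjg_set (cmx g) Bp).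
Proof.
move=> gU tc tg; have vI := @hval_inj n; have cU := tri_unit tc.
have [t [t0 dt]] := det_fix n_gt0 gU; have tt := tri_diag (@hval n) t0.
rewrite -(conj_cmx gU tt).
(* The nonnegative matrix h is the one perturbed; Y undoes c and normalizes the determinant, and a
   further D leads back to g. *)
pose h := Dm R n *m g *m c; pose Y := invmx c *m diag_mx t.
have tY : tri (@hval n) Y by apply: tri_mul => //; apply: tri_inv.
have DhY : Dm R n *m (h *m Y) = g *m diag_mx t.
  by rewrite /h /Y -!mulmxA (mulKVmx cU) DmK.
have [l lP] := tnn_pert R v w.
have [B B0 BP] := pert_bound l (h *m Y).
apply: (@flag_closure_limit _ _ (fun e => Dm R n *m pert l e (h *m Y)) _ B0 dt).
  move=> e e0 e1 i j; rewrite -DhY !DmE -mulrBr normrM normrX normrN1 expr1n mul1r.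
  exact: BP.
move=> e e0 _; have [te de] := lP h e e0 tg.
have [s [sw ss sp [c2 tc2 E]]] := tnn_factor te.
rewrite pert_mulr; split.
  by rewrite !det_mulmx de -!det_mulmx DhY.
have uU : yprod s \in unitmx.
  by have [+ _ _ _] := te; rewrite E unitmx_mul => /andP[].
have duU : Dm R n *m yprod s *m Dm R n \in unitmx by rewrite !unitmx_mul uU Dm_unit.
exists (cmx (Dm R n *m yprod s *m Dm R n)); first by have [] := Uminus_yprod sw ss sp.
have -> : Dm R n *m (pert l e h *m Y) = Dm R n *m yprod s *m Dm R n *m (Dm R n *m (c2 *m Y)).
  by rewrite E -!mulmxA DmK.
rewrite (conj_cmx duU) //; apply: tri_Dm; exact: tri_mul.
Qed.

End Closure.

Theorem theorem6p9 (R : realType) (n : nat) (n_gt0 : (0 < n)%N)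
    (v w v' w' : 'S_n) (vw : bruhat_le v w) (vw' : bruhat_le v' w') :
  opposed_intervals R v w v' w' <->
  forall k : nat, (1 <= k <= n.-1)%N ->
    exists x x' : 'S_n,
      [/\ bruhat_interval v w x, bruhat_interval v' w' x'
        & (x @: initial_seg n k = x' @: initial_seg n k)%SET].
Proof.
case: n n_gt0 v w v' w' vw vw' => // n n_gt0 v w v' w' vw vw'.
have vI := @hval_inj n.+1; have rI := @hrev_inj n.+1.
have vr := @flip_vr n.+1; have rv := @flip_rv n.+1.
move/bruhat_leP: vw => vw; move/bruhat_leP: vw' => vw'.
split.
  move=> [B [B' [[/richardson_cells[g [gU -> cw cv]] _] [/richardson_cells[g' [g'U -> cw' cv']] _]]]].
  move=> /(opposed_pairing gU g'U) H k /andP[_ kn].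
  have dU := dualmx_unit g'U.
  (* Dualizing multiplies by w_0 once more, so the dual of the second flag has the cells of v' and
     w'. *)
  have dv := cell_dualmx vI rI vr cw'; have dw := cell_dualmx rI vI rv cv'.
  rewrite !longestK in dv dw.
  have [J _] : exists2 J, true & pl (dualmx g') k J * pl g k J != 0.
    apply: contrapT => H0; have /negP := H k (leqW kn); apply; apply/eqP.
    apply: big1 => J _; apply/eqP; apply/negPn/negP=> HJ.
    by apply: H0; exists J.
  rewrite mulf_eq0 negb_or => /andP[J2 J1].
  have [x [vx xw xJ]] := cell_support gU (proj2 cw) (proj2 cv) J1.
  have [x' [vx' xw' xJ']] := cell_support dU (proj2 dw) (proj2 dv) J2.
  exists x, x'; split; [split; exact/bruhat_leP|split; exact/bruhat_leP|].
  by rewrite -/(sset x k) xJ -/(sset x' k) xJ'.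
move=> H.
have [g tg _] := tnn_exists R vw; have [gU tng cw cv] := tg.
(* The second Borel subgroup will come from the dual of g2: its own dual is then g2, with
   nonnegative coordinates, and the twisted dual shows membership in the nonpositive part. *)
have [g2 [g2U tng2 cw2 cv2] [c tc tc2]] := tnn_exists R vw'.
have g'U := dualmx_unit g2U.
have cw' := cell_dualmx rI vI rv cv2; have cv' := cell_dualmx vI rI vr cw2.
have pos k : (k <= n.+1)%N -> 0 < pairpl g2 g k.
  move=> kn.
  have [x [x' [vx xw vx' xw' e]]] : exists x x', [/\ ble v x, ble x w, ble v' x', ble x' w' & sset x k = sset x' k].
    have [kin|kout] := boolP (1 <= k <= n.+1.-1)%N.
      have [x [x' [[/bruhat_leP vx /bruhat_leP xw] [/bruhat_leP vx' /bruhat_leP xw'] e]]] := H k kin.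
      by exists x, x'.
    (* At the levels 0 and n all permutations give the same set. *)
    exists w, w'; split=> //; [exact: ble_refl|exact: ble_refl|].
    have [->|k0] := eqVneq k 0%N; first by rewrite !sset0.
    have -> : k = n.+1 by move: kout k0 kn; lia.
    by rewrite !ssetn.
  (* No term is negative, and the one at the common set is positive by [tnn_full]. *)
  rewrite /pairpl (bigD1 (sset x k)) //= ltr_pwDl //; last first.
    by apply: sumr_ge0 => J _; rewrite mulr_ge0.
  rewrite mulr_gt0 //; first by rewrite e; apply: (tnn_full g2U tng2 cw2 cv2).
  exact: (tnn_full gU tng cw cv).
have th : tnn_in (pmul w' (longest n.+1)) (pmul v' (longest n.+1)) (Dm R n.+1 *m dualmx g2 *m c).
  split=> //; [|exact: cell_dual rI vI rv tc cv2|exact: cell_dual vI rI vr tc cw2].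
  by rewrite 2!unitmx_mul Dm_unit g'U tri_unit.
exists (conjg_set (cmx g) (@Bplus R n.+1)), (conjg_set (cmx (dualmx g2)) (@Bplus R n.+1)).
split.
- split; last exact: tnn_flag_ge0 tg.
  by apply: cells_richardson => //; [exact: cmx_unit|exact: cell_map|exact: cell_map].
- split; last exact: tnn_flag_le0 g'U tc th.
  by apply: cells_richardson => //; [exact: cmx_unit|exact: cell_map|exact: cell_map].
- apply/opposed_pairing; [exact: cmx_unit|exact: cmx_unit|].
  by move=> k kn; rewrite /cmx -dualmx_map dualmxK // pairpl_map fmorph_eq0 lt0r_neq0 // pos.
Qed.
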